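(* Let $x\ge 0$ and suppose that $g_0$ is bounded, i.e. $\|g_0\|_\infty=\sup_{z\ge 0}\left|\int_z^\infty \frac{dV_0(s)}{\pi\sqrt{s-z}}\right|<\infty$. Let $G\sim \mathrm{DP}(\alpha)$ a priori, where the base measure $\alpha$ satisfies $\int_x^\infty (s-x)^{-1/2}\,d\alpha(s)<\infty$, so that $G\mid Z_1,\dots,Z_n\sim \mathrm{DP}(\alpha+n\mathbb{G}_n)$. Then, in probability under $G_0$, as $n\to\infty$, $$\frac{\sqrt{n}}{\sqrt{\log n}}\big(V_G(x)-V_n(x)\big)\ \Big|\ Z_1,\dots,Z_n\ \rightsquigarrow\ N\big(0,g_0(x)\big).$$
   Context: Wicksell's problem. Let $F_0$ be a cumulative distribution function on $(0,\infty)$. The observations $Z_1,Z_2,\dots$ are i.i.d. from the distribution $G_0$ on $[0,\infty)$ with density (this version is fixed) $$g_0(z)=\int_z^\infty \frac{dF_0(x)}{2\sqrt{x^2-xz}},\qquad z\ge 0.$$ Define $V_0(x)=\int_x^\infty \frac{g_0(z)}{\sqrt{z-x}}\,dz$, a nonincreasing function; one has $g_0(z)=-\int_z^\infty \frac{dV_0(s)}{\pi\sqrt{s-z}}$. $\mathbb{G}_n=\frac1n\sum_{i=1}^n\delta_{Z_i}$ is the empirical measure. $\mathrm{DP}(\alpha)$ is the Dirichlet process with base measure $\alpha$, a finite nonzero measure on $[0,\infty)$ of total mass $|\alpha|$. In the Bayesian model $G\sim\mathrm{DP}(\alpha)$ and $Z_1,\dots,Z_n\mid G$ i.i.d. from $G$,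 the posterior is $\mathrm{DP}(\alpha+n\mathbb{G}_n)$; conditional laws of functionals of $G$ given $Z_1,\dots,Z_n$ refer to this posterior, while the $Z_i$ are in fact i.i.d. from $G_0$. $V_G(x)=\int_{(x,\infty)}\frac{dG(z)}{\sqrt{z-x}}$ and $V_n(x)=\int_{(x,\infty)}\frac{d\mathbb{G}_n(z)}{\sqrt{z-x}}$. Conditional weak convergence: $X_n\mid Z_1,\dots,Z_n\rightsquigarrow L$ in probability under $G_0$ means $\sup_{f\in BL_1}\left|\mathrm{E}(f(X_n)\mid Z_1,\dots,Z_n)-\int f\,dL\right|\to 0$ in $G_0$-probability, where $BL_1$ is the set of functions bounded by $1$ in absolute value and Lipschitz with constant $1$ (bounded Lipschitz metric). *)

(* Defs.v *)
From HB Require Import structures.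
From mathcomp Require Import all_boot all_order all_algebra finmap.
From mathcomp Require Import all_classical all_reals all_analysis.

Set Implicit Arguments.
Unset Strict Implicit.
Unset Printing Implicit Defensive.

Import Order.TTheory GRing.Theory Num.Theory.
Import numFieldNormedType.Exports.

Local Open Scope classical_set_scope.
Local Open Scope ring_scope.

Section Independence.
Context d d' (T : measurableType d) (T' : measurableType d') (R : realType).

Definition mutually_independent (I : choiceType) (P : probability T R)
    (X : I -> T -> T') : Prop :=
  forall (J : {fset I}) (A : I -> set T'), (forall i, measurable (A i)) ->
    P (\bigcap_(i in [set` J]) X i @^-1` A i)
    = (\prod_(i <- J) P (X i @^-1` A i))%E.

Definition iid (I : choiceType) (P : probability T R) (X : I -> {RV P >-> T'})
    (L : set T' -> \bar R) : Prop :=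
  mutually_independent P X /\
  forall i A, measurable A -> distribution P (X i) A = L A.

End Independence.

Section Dirichlet.
Context (R : realType).

Definition gamma_fun (a : R) : R :=
  \int[lebesgue_measure]_(y in `]0, +oo[) (y `^ (a - 1) * expR (- y)).

(* The Gamma(a, 1) law for a >= 0; Gamma(0, 1) is the point mass at 0. *)
Definition gamma_law (a : R) (A : set R) : \bar R :=
  if a == 0 then \d_(0 : R) A
  else (\int[lebesgue_measure]_(y in A `&` `]0%R, +oo[)
          (y `^ (a - 1) * expR (- y) / gamma_fun a)%:E)%E.

(* Under P, the random vector X has the Dirichlet distribution with
   nonnegative, not all zero, parameters a.  As in Ferguson (1973), this is
   the law of a normalised vector of independent Gamma(a i, 1) variables, so
   that coordinates with a i = 0 vanish almost surely. *)
Definition dirichlet_vector d (T : measurableType d) (P : probability T R)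
    (k : nat) (X : 'I_k -> T -> R) (a : 'I_k -> R) : Prop :=
  exists (d' : measure_display) (W : measurableType d') (Q : probability W R)
         (Y : 'I_k -> {RV Q >-> R}),
    [/\ mutually_independent Q Y,
        (forall i B, measurable B ->
           distribution Q (Y i) B = gamma_law (a i) B) &
        forall B : set (k.-tuple R), measurable B ->
          P [set t | B [tuple X i t | i < k]] =
          Q [set w | B [tuple Y i w / \sum_(j < k) Y j w | i < k]]].

(* A random probability measure on T is given by its law D on the space
   [pprobability T R] of probability measures, whose sigma-algebra is
   generated by the evaluations G |-> G A. *)
Definition dirichlet_process d (T : measurableType d)
    (alpha : {measure set T -> \bar R})
    (D : probability (pprobability T R) R) : Prop :=
  forall (k : nat) (A : 'I_k -> set T),
    (forall i, measurable (A i)) -> trivIset setT A ->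
    \bigcup_i A i = setT ->
    dirichlet_vector D (fun i (G : pprobability T R) => fine (G (A i)))
      (fun i => fine (alpha (A i))).

End Dirichlet.

Section Empirical.
Context d (T : measurableType d) (R : realType).

(* Based on the observations z 0, ..., z (n - 1). *)
Definition empirical (z : nat -> T) (n : nat) : {measure set T -> \bar R} :=
  mscale (n%:R^-1)%:nng (msum (fun i => \d_(z i)) n).

(* Base measure alpha + n G_n of the posterior law, given z 0, ..., z (n - 1),
   of G ~ DP(alpha). *)
Definition posterior_base (alpha : {measure set T -> \bar R})
    (z : nat -> T) (n : nat) : {measure set T -> \bar R} :=
  measure_add alpha (mscale n%:R%:nng (empirical z n)).

End Empirical.

Section WeakConvergence.
Context (R : realType).

Definition BL1 : set (R -> R) :=
  [set f | (forall u, `|f u| <= 1) /\ (forall u v, `|f u - f v| <= `|u - v|)].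

(* X n w is a random variable under Q n w, the conditional law given the data
   at the sample point w; the bounded Lipschitz distance between its law and L
   tends to 0 in P-probability.  The outer measure P^* only spares a
   measurability side condition: it agrees with P on measurable sets. *)
Definition cond_weak_cvg d d' (W : measurableType d) (S : measurableType d')
    (P : probability W R) (Q : nat -> W -> probability S R)
    (X : nat -> W -> S -> R) (L : probability (measurableTypeR R) R) : Prop :=
  forall eps : R, 0 < eps ->
    (P^*)%mu [set w | eps <
      sup [set `|\int[Q n w]_s f (X n w s) - \int[L]_u f u| | f in BL1]]
    @[n --> \oo] --> 0%E.

(* The library's [normal_prob m s] is parametrised by the standard deviation
   and is not a point mass for s = 0. *)
Definition normal_law (m v : R) : probability (measurableTypeR R) R :=
  if v == 0 then (\d_(m : measurableTypeR R) : probability (measurableTypeR R) R)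
  else normal_prob m (Num.sqrt v).

End WeakConvergence.

Section Wicksell.
Context (R : realType).

(* The observations are squared radii, so z ranges over [0, +oo[.  Whether the
   endpoint x = z is included matters only if F0 has an atom at z, in which
   case the density is unbounded near z either way. *)
Definition wicksell_density (F0 : cumulativeBounded (0 : R) (1 : R)) (z : R)
    : \bar R :=
  (\int[lebesgue_stieltjes_measure F0]_(x in `]z, +oo[)
     ((2 * Num.sqrt (x ^+ 2 - x * z))^-1)%:E)%E.

Definition wicksell_law (F0 : cumulativeBounded (0 : R) (1 : R)) (A : set R)
    : \bar R :=
  (\int[lebesgue_measure]_(z in A `&` `[0%R, +oo[) wicksell_density F0 z)%E.

(* Real-valued, with value 0 when the integral diverges. *)
Definition V (mu : {measure set R -> \bar R}) (x : R) : R :=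
  \int[mu]_(z in `]x, +oo[) (Num.sqrt (z - x))^-1.

End Wicksell.

(* Main.v *)
Require Import Defs.
From HB Require Import structures.
From mathcomp Require Import all_boot all_order all_algebra finmap.
From mathcomp Require Import all_classical all_reals all_analysis.
From mathcomp Require Import measurable_realfun.
From mathcomp Require Import ring lra.

(* Write h(z) = (z - x)^(-1/2) for z > x, L = ln n and v = g0(x).  Given the
   data, V_G - V_n splits into a contribution of large values of h, which is
   negligible by Markov's inequality for the Dirichlet process, and the
   integral of a step function, which under the Dirichlet process is a ratio
   (sum_i c_i Y_i) / (sum_i Y_i) of linear forms in independent Gamma
   variables.  The denominator is replaced by its mean, and the numerator is
   compared with a normal law by Stein's method: a Gamma(a) variable satisfies
   E[(Y - a) phi(Y)] = E[Y phi'(Y)].  The resulting bound is small as soon as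
   sum h(Z_i)^2 / (n L) is close to v, sum h(Z_i)^4 = o((n L)^2) and V_n^2 = o(L).
   Under g0 the variable h(Z)^2 has tail at most |g0|_oo / u, so the last two
   facts follow from Markov's inequality, and the first one from Chebyshev's
   after truncation at a multiple of n.  The truncated mean is asymptotic to
   L g0(x) because averages of g0 near x with respect to du / u converge to
   g0(x): the upper bound comes from Tonelli's theorem applied to the integral
   defining g0, the lower bound from lower semicontinuity from the right. *)

Import Order.TTheory GRing.Theory Num.Theory.
Import numFieldNormedType.Exports.

Set Implicit Arguments.
Unset Strict Implicit.
Unset Printing Implicit Defensive.

Local Open Scope classical_set_scope.
Local Open Scope ring_scope.

(** * Densities *)

(** If g0(x) > 0, then h(Z) has infinite variance and its truncated second moment grows like L v;
    this is where the rate sqrt(n / L) comes from, and why the variance has to be read off a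
    truncated law of large numbers. A Dirichlet process is specified only through finite partitions,
    so the unbounded h is reached through step functions: values are rounded to a grid of mesh 1/n,
    and the remaining tail is handled by a countable union of events, each defined by a step
    function. Stein's method yields, for fixed data, an explicit bound that is uniform over bounded
    Lipschitz f. The supremum then costs nothing, and the probabilistic part reduces to showing that
    the data satisfy three inequalities with high probability. The solution of the Stein equation
    has derivative of order 1/v, so v = 0 is treated apart, by a second moment. The inequalities on
    the data are required to precision [kap ^ 4], while the final bound is linear in [kap]: the
    difference pays for square roots and for Chebyshev's inequality. *)

Section Density.
Import HBNNSimple.
Context d (T : measurableType d) (R : realType).
Local Open Scope ereal_scope.

(** The density is known only through the values of [m] on measurable sets, hence through
    indicators. Simple functions follow by summing over level sets, and the general case by monotone
    convergence along [nnsfun_approx]. *)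
Lemma ge0_integral_density (m mu : {measure set T -> \bar R}) (D : set T)
    (p : T -> R) (f : T -> \bar R) :
  measurable D -> measurable_fun D p -> (forall t, D t -> (0 <= p t)%R) ->
  (forall A, measurable A -> m A = \int[mu]_(t in A `&` D) (p t)%:E) ->
  measurable_fun setT f -> (forall t, 0 <= f t) ->
  \int[m]_t f t = \int[mu]_(t in D) (f t * (p t)%:E).
Proof.
move=> mD mp p0 mE mf f0.
have mp' : measurable_fun D (EFin \o p) by exact/measurable_EFinP.
have p0' t : D t -> 0 <= (p t)%:E by move=> /p0; rewrite lee_fin.
pose g := nnsfun_approx measurableT mf.
have gf t : (g n t)%:E @[n --> \oo] --> f t.
  by apply: cvg_nnsfun_approx => // u _; exact: f0.
have ndg t : {homo (fun n => g n t) : a b / (a <= b)%N >-> (a <= b)%R}.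
  by move=> a b ab; have /lefP := nd_nnsfun_approx measurableT mf ab; exact.
have step n : \int[m]_t (g n t)%:E = \int[mu]_(t in D) ((g n t)%:E * (p t)%:E).
  rewrite integralT_nnsfun sintegralE.
  transitivity (\sum_(r \in range (g n))
      \int[mu]_(t in D) ((r * \1_(g n @^-1` [set r]) t)%:E * (p t)%:E)).
    apply: eq_fsbigr => r /[!inE] -[t _ <-].
    rewrite mE; last exact: measurable_sfunP.
    rewrite setIC integral_mkcondr epatch_indic -ge0_integralZl//=.
    - by apply: eq_integral => s _; rewrite EFinM -muleA; congr (_ * _); rewrite muleC.
    - apply: emeasurable_funM => //; apply/measurable_EFinP.
      by apply: measurable_indic; exact: measurable_sfunP.
    - by move=> s Ds; rewrite mule_ge0 ?p0' ?lee_fin.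
    - by rewrite lee_fin.
  rewrite -ge0_integral_fsum//.
  - apply: eq_integral => t /[!inE] Dt.
    rewrite [in RHS]fimfunE -fsumEFin// [RHS]muleC ge0_mule_fsumr//.
      by apply: eq_fsbigr => r _; rewrite muleC.
    by move=> r; rewrite EFinM nnfun_muleindic_ge0.
  - move=> r; apply: emeasurable_funM => //; apply/measurable_EFinP.
    exact: measurable_funM.
  - by move=> r t Dt; rewrite mule_ge0 ?p0' ?EFinM ?nnfun_muleindic_ge0.
transitivity (limn (fun n => \int[m]_t (g n t)%:E)).
  rewrite -monotone_convergence//.
  - by apply: eq_integral => t _; apply/esym/cvg_lim => //; exact: gf.
  - by move=> n; exact/measurable_EFinP.
  - by move=> n t _; rewrite lee_fin.
  - by move=> t _ a b ab; rewrite lee_fin; exact: ndg.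
under eq_fun do rewrite step.
rewrite -monotone_convergence//.
- apply: eq_integral => t /[!inE] Dt; apply/cvg_lim => //.
  by apply: cvgeMr => //; exact: gf.
- move=> n; apply: emeasurable_funM => //; apply/measurable_EFinP.
  exact: measurable_funTS.
- by move=> n t Dt; rewrite mule_ge0 ?p0' ?lee_fin.
- by move=> t Dt a b ab; rewrite lee_wpmul2r ?p0'// lee_fin; exact: ndg.
Qed.

End Density.

Section DensitySigned.
Context d (T : measurableType d) (R : realType).
Local Open Scope ereal_scope.

Lemma integral_density (m mu : {measure set T -> \bar R}) (D : set T)
    (p : T -> R) (f : T -> \bar R) :
  measurable D -> measurable_fun D p -> (forall t, D t -> (0 <= p t)%R) ->
  (forall A, measurable A -> m A = \int[mu]_(t in A `&` D) (p t)%:E) ->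
  measurable_fun setT f ->
  \int[m]_t f t = \int[mu]_(t in D) (f t * (p t)%:E).
Proof.
move=> mD mp p0 mE mf; rewrite integralE [RHS]integralE.
rewrite (ge0_integral_density mD mp p0 mE)//; last exact: measurable_funepos.
rewrite (ge0_integral_density mD mp p0 mE)//; last exact: measurable_funeneg.
congr (_ - _); apply: eq_integral => t /[!inE] Dt.
  by rewrite !funeposE maxe_pMl ?mul0e// lee_fin p0.
by rewrite !funenegE maxe_pMl ?mul0e ?mulNe// lee_fin p0.
Qed.

End DensitySigned.

(* [measurableTypeR R], which carries the Lebesgue measure, and [R] have the
   same measurable sets but different displays. *)
Section TypeR.
Context (R : realType) (m : {measure set R -> \bar R}).

Definition measure_typeR : set (measurableTypeR R) -> \bar R := m.

Let m0 : measure_typeR set0 = 0%E. Proof. exact: measure0. Qed.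
Let m_ge0 A : (0 <= measure_typeR A)%E. Proof. exact: measure_ge0. Qed.
Let m_sigma : semi_sigma_additive measure_typeR.
Proof. exact: (@measure_semi_sigma_additive _ R R m). Qed.

HB.instance Definition _ := isMeasure.Build _ _ _ measure_typeR
  m0 m_ge0 m_sigma.

Lemma ge0_integral_typeR (f : R -> \bar R) : measurable_fun setT f ->
  (forall y, (0 <= f y)%E) ->
  (\int[measure_typeR]_y f y = \int[m]_y f y)%E.
Proof.
move=> mf f0; have mid : measurable_fun setT (id : R -> measurableTypeR R) by [].
(* The identity is measurable from one display to the other, so the change of display is a
   pushforward. *)
transitivity (\int[pushforward m (id : R -> measurableTypeR R)]_y f y)%E; last first.
  by rewrite (ge0_integral_pushforward mid).

exact: eq_measure_integral.
Qed.

Lemma integral_typeR (f : R -> \bar R) : measurable_fun setT f ->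
  (\int[measure_typeR]_y f y = \int[m]_y f y)%E.
Proof.
move=> mf; rewrite integralE [RHS]integralE !ge0_integral_typeR//.
  exact: measurable_funeneg.
exact: measurable_funepos.
Qed.

Lemma integral_lebesgue_density (D : set R) (p : R -> R) (f : R -> \bar R) :
  measurable D -> measurable_fun D p -> (forall t, D t -> 0 <= p t) ->
  (forall A, measurable A ->
    m A = \int[lebesgue_measure]_(t in A `&` D) (p t)%:E)%E ->
  measurable_fun setT f ->
  (\int[m]_t f t = \int[lebesgue_measure]_(t in D) (f t * (p t)%:E))%E.
Proof.
move=> mD mp p0 mE mf; rewrite -integral_typeR//.
exact: (@integral_density _ (measurableTypeR R) R measure_typeR lebesgue_measure D).
Qed.

End TypeR.

(** * Linear forms in independent variables *)

Section Independence.
Context d (W : measurableType d) (R : realType) (Q : probability W R) (k : nat)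
  (Y : 'I_k -> {RV Q >-> R}).
Hypothesis indY : mutually_independent Q Y.
Local Open Scope ereal_scope.

(** Cylinders in the coordinates other than [j] form a pi-system, and the partial sum is measurable
    for the sigma-algebra they generate. On cylinders the product formula is mutual independence;
    both sides are finite measures of the second event, so they agree on the generated
    sigma-algebra. *)
Lemma independent_linear_others (c : 'I_k -> R) (j : 'I_k) (B C : set R) :
  measurable B -> measurable C ->
  Q (Y j @^-1` B `&` (fun w => \sum_(i | i != j) c i * Y i w)%R @^-1` C)
  = Q (Y j @^-1` B) * Q ((fun w => \sum_(i | i != j) c i * Y i w)%R @^-1` C).
Proof.
move=> mB mC; set N := fun w => _.
pose cyl (A : 'I_k -> set R) := \bigcap_(i in [set i | i != j]) Y i @^-1` A i.
pose G := [set E | exists2 A : 'I_k -> set R,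
  (forall i, measurable (A i)) & E = cyl A].
have mcyl A : (forall i, measurable (A i)) -> measurable (cyl A).
  move=> mA; apply: fin_bigcap_measurable => [|i _]; first exact: finite_finset.
  by rewrite -[X in measurable X]setTI; exact: measurable_funPT.
have Gm : G `<=` measurable by move=> _ [A mA ->]; exact: mcyl.
have GT : G setT.
  exists (fun=> setT) => //; apply/seteqP; split => // w _ i _ //.
have GI : setI_closed G.
  move=> _ _ [A1 mA1 ->] [A2 mA2 ->]; exists (fun i => A1 i `&` A2 i).
    by move=> i; exact: measurableI.
  by rewrite /cyl -bigcapI; apply: eq_bigcapr => i _; rewrite preimage_setI.
have mYj : measurable (Y j @^-1` B).
  by rewrite -[X in measurable X]setTI; exact: measurable_funPT.
have QB : Q (Y j @^-1` B) = (fine (Q (Y j @^-1` B)))%:E.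
  by rewrite fineK// fin_num_measure.
have QB0 : (0 <= fine (Q (Y j @^-1` B)))%R by rewrite fine_ge0.
have key A : (forall i, measurable (A i)) ->
    Q (cyl A `&` Y j @^-1` B) = Q (Y j @^-1` B) * Q (cyl A).
  move=> mA.
  (* Independence is used twice: over all indices with [B] inserted at [j], and over the indices
     other than [j]. *)
  pose A' i := if i == j then B else A i.
  have mA' i : measurable (A' i) by rewrite /A'; case: ifP.
  have e1 := indY [fset i in 'I_k]%fset mA'.
  have e2 := indY [fset i in 'I_k | i != j]%fset mA.
  have -> : cyl A `&` Y j @^-1` B =
      \bigcap_(i in [set` [fset i in 'I_k]%fset]) Y i @^-1` A' i.
    apply/seteqP; split => [w [cw jw] i _|w Aw].
      by rewrite /A'; case: eqVneq => [->//|ij]; exact: cw.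
    split; last by have := Aw j; rewrite /A' eqxx; apply; rewrite /= !inE.
    move=> i /= ij; have := Aw i; rewrite /A' (negbTE ij); apply.
    by rewrite /= !inE.
  have -> : cyl A = \bigcap_(i in [set` [fset i in 'I_k | i != j]%fset]) Y i @^-1` A i.
    apply/seteqP; split => [w cw i /=|w Aw i /= ij].
      by rewrite !inE => ij; exact: cw.
    by apply: Aw; rewrite /= !inE.
  have p1 : perm_eq [fset i in 'I_k]%fset (enum 'I_k).
    by apply: uniq_perm; rewrite ?fset_uniq ?enum_uniq// => i; rewrite !inE mem_enum.
  have p2 : perm_eq [fset i in 'I_k | i != j]%fset [seq i <- enum 'I_k | i != j].
    apply: uniq_perm; first exact: fset_uniq.
      by apply: filter_uniq; exact: enum_uniq.
    move=> i.
    by rewrite mem_filter !inE mem_enum andbT.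
  rewrite e1 e2 (perm_big _ p1) (perm_big _ p2)/= big_filter !big_enum_cond/=.
  rewrite (bigD1 j)//= [in LHS]/A' eqxx; congr (_ * _).
  by apply: eq_bigr => i ij; rewrite /A' (negbTE ij).
have mY i : i != j -> measurable_fun setT (Y i : g_sigma_algebraType G -> R).
  move=> ij _ D mD; rewrite setTI; apply: sub_sigma_algebra.
  exists (fun l => if l == i then D else setT).
    by move=> l; case: ifP.
  apply/seteqP; split => [w Dw l /= lj|w].
    by case: eqVneq => // ->.
  by move=> /(_ i ij); rewrite eqxx.
have mN : measurable_fun setT (N : g_sigma_algebraType G -> R).
  have -> : N = (fun w => \sum_(i <- enum 'I_k)
    (if i != j then c i * Y i w else 0))%R.
    by apply/funext => w; rewrite /N big_mkcond/= big_enum.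
  apply: measurable_sum => i; have [ij|_] := boolP (i != j); last exact: measurable_cst.
  by apply: measurable_funM; [exact: measurable_cst|exact: mY].
have GN : <<s G >> (N @^-1` C).
  by have := mN measurableT C mC; rewrite setTI.
(* Both sides are now written as measures: [Q] restricted to the event on [Y j], and [Q] scaled by
   the probability of that event. *)
have -> : Q (Y j @^-1` B `&` N @^-1` C) = mrestr Q mYj (N @^-1` C).
  by rewrite /mrestr setIC.
have -> : Q (Y j @^-1` B) * Q (N @^-1` C) =
    mscale (NngNum QB0) Q (N @^-1` C) by rewrite /mscale/= -QB.
apply: (g_sigma_algebra_measure_unique G Gm (fun=> setT)) => //.
- by rewrite bigcup_const.
- by move=> _ [A mA ->]; rewrite /= /mrestr /mscale/= -QB; exact: key.
- by move=> n; rewrite /= /mrestr setTI (le_lt_trans (probability_le1 _ _))// ltry.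
Qed.

End Independence.

(** * Improper integrals *)

Lemma fatou_le d (T : measurableType d) (R : realType)
    (mu : {measure set T -> \bar R}) (D : set T) (g : nat -> T -> \bar R)
    (f : T -> \bar R) (K : \bar R) :
  measurable D -> (forall n, measurable_fun D (g n)) ->
  (forall n t, D t -> (0 <= g n t)%E) ->
  (forall t, D t -> (g n t @[n --> \oo] --> f t)%E) ->
  (forall n, (\int[mu]_(t in D) g n t <= K)%E) ->
  (\int[mu]_(t in D) f t <= K)%E.
Proof.
move=> mD mg g0 gf gK.
apply: (@le_trans _ _ (limn_einf (fun n => \int[mu]_(t in D) g n t)%E)).
  apply: le_trans (fatou mu mD mg g0).
  rewrite le_eqVlt; apply/orP; left; apply/eqP; apply: eq_integral => t /[!inE] Dt.
  by have [-> _] := cvg_limn_einf_sup (gf _ Dt).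
rewrite limn_einf_lim; apply: lime_le; first exact: is_cvg_einfs.
apply: nearW => n; apply: le_trans (gK n); apply: ereal_inf_lbound => /=.
by exists n => /=.
Qed.

Section ImproperFTC.
Context (R : realType).
Local Notation mu := (@lebesgue_measure R).

Lemma integral_itv_FTC2 (F f : R -> R) (a b : R) : a < b ->
  (forall y, a <= y <= b -> is_derive y 1 F (f y)) ->
  (forall y, a <= y <= b -> {for y, continuous f}) ->
  (\int[mu]_(y in `[a, b]) (f y)%:E = (F b - F a)%:E)%E.
Proof.
move=> ab dF cf.
have cF y : a <= y <= b -> {for y, continuous F}.
  move=> /dF yF; apply: differentiable_continuous; apply/derivable1_diffP.
  exact: ex_derive.
rewrite EFinB; apply: continuous_FTC2 => //.
- apply: continuous_in_subspaceT => y /[!inE]/=; rewrite in_itv/=.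
  exact: cf.
- split.
  + move=> y; rewrite in_itv/= => /andP[/ltW ay /ltW yb].
    by apply: ex_derive; apply: dF; rewrite ay.
  + by apply: cvg_at_right_filter; apply: cF; rewrite lexx ltW.
  + by apply: cvg_at_left_filter; apply: cF; rewrite lexx ltW.
- move=> y; rewrite in_itv/= => /andP[/ltW ay /ltW yb].
  by rewrite derive1E; apply: derive_val; apply: dF; rewrite ay.
Qed.

Section Exhaustion.
Context (D : set R) (a b : nat -> R) (F f : R -> R).
Hypotheses (mD : measurable D) (ab : forall n, a n < b n)
  (abD : forall n, `[a n, b n] `<=` D)
  (abT : forall y, D y -> \forall n \near \oo, a n <= y <= b n)
  (dF : forall y, D y -> is_derive y 1 F (f y))
  (cf : forall y, D y -> {for y, continuous f})
  (mf : measurable_fun D f).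

(** Truncations of [f] to compact intervals that exhaust [D]. The antiderivative is used only inside
    [D], so it may be singular at the ends. *)
Let g n y := ((EFin \o f) \_ `[a n, b n]) y.

Let int_g n : (\int[mu]_(y in D) g n y = (F (b n) - F (a n))%:E)%E.
Proof.
transitivity (\int[mu]_(y in `[a n, b n]) (f y)%:E)%E.
  by rewrite -integral_mkcondr; congr (integral _ _ _); exact/setIidPr/abD.
apply: integral_itv_FTC2 => //.
- by move=> y aby; apply/dF/(abD (n := n)); rewrite /= in_itv.
- by move=> y aby; apply/cf/(abD (n := n)); rewrite /= in_itv.
Qed.

Let mg n : measurable_fun D (g n).
Proof.
apply/(measurable_restrict _ _ _) => //.
by apply: measurable_funS (_ : measurable_fun D (EFin \o f)) => //; exact/measurable_EFinP.
Qed.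

Let g_cvg y : D y -> (g n y @[n --> \oo] --> (f y)%:E)%E.
Proof.
move=> Dy; apply: cvg_near_cst; near=> n.
rewrite /g patchE ifT// inE/= in_itv/=; near: n; exact: abT.
Unshelve. all: by end_near. Qed.

(** Dominated convergence, with [|f|] itself as the dominating function. *)
Lemma integral_exhaustion_FTC2 (l : R) :
  mu.-integrable D (EFin \o f) ->
  (F (b n) - F (a n)) @[n --> \oo] --> l ->
  (\int[mu]_(y in D) (f y)%:E = l%:E)%E.
Proof.
move=> intf Fl.
have gf : {ae mu, forall y, D y -> g ^~ y @ \oo --> (EFin \o f) y}.
  by apply: aeW => y; exact: g_cvg.
have g_le : {ae mu, forall y n, D y -> (`|g n y| <= (abse \o (EFin \o f)) y)%E}.
  by apply: aeW => y n _; rewrite /g patchE; case: ifP => //= _; rewrite normr0 lee_fin.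
have [_ _ h] := @dominated_convergence _ (measurableTypeR R) R mu D mD g (EFin \o f)
  (abse \o (EFin \o f)) mg (measurable_int _ intf) gf
  (integrable_abse intf) g_le.
have gE : (fun n => \int[mu]_(y in D) g n y)%E = EFin \o (fun n => F (b n) - F (a n)).
  by apply/funext => n /=; rewrite int_g.
have h1 : EFin \o (fun n => F (b n) - F (a n)) @ \oo --> (\int[mu]_(y in D) (f y)%:E)%E.
  by rewrite -gE; exact: h.
apply: (cvg_unique (@ereal_hausdorff R) h1).
by apply: cvg_EFin => //; exact: nearW.
Qed.

(** Fatou's lemma replaces dominated convergence, so that this version can serve to establish
    integrability. *)
Lemma ge0_integral_exhaustion_FTC2 (l : R) : (forall y, D y -> 0 <= f y) ->
  (forall n, F (b n) - F (a n) <= l) ->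
  (\int[mu]_(y in D) (f y)%:E <= l%:E)%E.
Proof.
move=> f0 Fl.
have g0 n y : D y -> (0 <= g n y)%E.
  by move=> Dy; rewrite /g patchE; case: ifP => // _; rewrite lee_fin f0.
apply: (@fatou_le _ (measurableTypeR R) R mu D g (EFin \o f) _ mD mg g0 g_cvg) => n; rewrite int_g lee_fin; exact: Fl.
Qed.

End Exhaustion.
End ImproperFTC.

(** * Gamma laws *)

Section GammaLaw.
Context (R : realType).
Local Notation mu := (@lebesgue_measure R).

(** The constant is [(2b)^b]: write [ln y = ln (2b) + ln (y / (2b))] and bound the last logarithm by
    its argument. Half of the exponential decay of a Gamma density thus absorbs any positive
    power. *)
Lemma powR_le_expR (b : R) : 0 < b ->
  exists2 K : R, 0 < K & forall y : R, 0 < y -> y `^ b <= K * expR (y / 2).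
Proof.
move=> b0; exists (expR (b * ln (2 * b))); first exact: expR_gt0.
move=> y y0; rewrite /powR gt_eqF// -expRD ler_expR.
have -> : ln y = ln (2 * b) + ln (y / (2 * b)).
  by rewrite -lnM ?posrE ?divr_gt0 ?mulr_gt0// mulrCA divff ?mulr1// gt_eqF// mulr_gt0.
rewrite mulrDr lerD2l; apply: le_trans (_ : b * (y / (2 * b)) <= _).
  by rewrite ler_pM2l// ltW// ln_sublinear// divr_gt0// mulr_gt0.
rewrite le_eqVlt; apply/orP; left; apply/eqP; field.
by rewrite gt_eqF.
Qed.

Lemma integrable_expRN_half : mu.-integrable `]0, +oo[ (fun y => (expR (- (y / 2)))%:E).
Proof.
have [K K0 yK] := powR_le_expR (ltr01 : 0 < 1 :> R).
apply/integrableP; split.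
  apply/measurable_EFinP; apply: measurable_funTS; apply: measurableT_comp => //.
  by apply: measurableT_comp => //; exact: measurable_funM.
under eq_integral do rewrite gee0_abs ?lee_fin ?expR_ge0//.
apply: (@le_lt_trans _ _ 2%:E); last exact: ltry.
(* The shifts ensure [1 / (n + 1) <= 1 < n + 2] already for [n = 0]. *)
apply: (@ge0_integral_exhaustion_FTC2 R _ (fun n => n.+1%:R^-1) (fun n => n.+2%:R)
  (fun y => - 2 * expR (- (y / 2)))) => //.
- by move=> n; rewrite (@le_lt_trans _ _ 1) ?invf_le1 ?ltr1n ?ler1n.
- move=> n y /=; rewrite !in_itv/= andbT => /andP[+ _]; apply: lt_le_trans.
  by rewrite invr_gt0.
- move=> y /=; rewrite in_itv/= andbT => y0; near=> n; apply/andP; split.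
    rewrite invf_ple ?posrE// (@le_trans _ _ n%:R) ?ler_nat//.
    by near: n; exact: nbhs_infty_ger.
  rewrite (@le_trans _ _ n%:R) ?ler_nat//; last exact/ltnW.
  by near: n; exact: nbhs_infty_ger.
- by move=> y _; apply: is_derive_eq; rewrite ?scaler0 ?add0r /GRing.scale/=; field.
- move=> y _; apply: continuous_comp; last exact: continuous_expR.
  by apply: continuousN; apply: continuousM => //; exact: cvg_cst.
- apply: measurable_funTS; apply: measurableT_comp => //.
  by apply: measurableT_comp => //; exact: measurable_funM.
- move=> n; have : 0 < expR (- (n.+2%:R / 2)) :> R by exact: expR_gt0.
  have : expR (- (n.+1%:R^-1 / 2)) <= 1 :> R.
    by rewrite -[leRHS]expR0 ler_expR oppr_le0 divr_ge0.
  by lra.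
Unshelve. all: by end_near. Qed.


Variables (G : probability R R) (a : R).
Hypotheses (a_ge0 : 0 <= a) (GE : forall B, measurable B -> G B = gamma_law a B).

Lemma gamma_law0 : a = 0 -> forall B, measurable B -> G B = \d_(0 : R) B.
Proof. by move=> a0 B mB; rewrite GE// /gamma_law a0 eqxx. Qed.

Let p y := y `^ (a - 1) * expR (- y) / gamma_fun a.

Section Positive.
Hypothesis a_gt0 : 0 < a.

Let GEp A : measurable A ->
  G A = (\int[mu]_(y in A `&` `]0%R, +oo[) (p y)%:E)%E.
Proof. by move=> mA; rewrite GE// /gamma_law gt_eqF. Qed.

(** As [0^-1 = 0], a vanishing normalising constant would make the density identically zero, against
    the total mass 1 of [G]. This also excludes a divergent Gamma integral, whose value would be 0
    by convention. *)
Lemma gamma_fun_gt0 : 0 < gamma_fun a.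
Proof.
rewrite lt_neqAle Rintegral_ge0 ?andbT; last first.
  by move=> y _; rewrite mulr_ge0 ?powR_ge0 ?expR_ge0.
apply/eqP => Ga0; have := GEp measurableT; rewrite probability_setT.
rewrite integral0_eq; last by move=> y _; rewrite /p -Ga0 invr0 mulr0.
by move=> /eqP; rewrite onee_eq0.
Qed.

Let p_ge0 y : 0 <= p y.
Proof.
by rewrite /p !mulr_ge0 ?powR_ge0 ?expR_ge0// invr_ge0 ltW// gamma_fun_gt0.
Qed.

Let mp : measurable_fun (`]0, +oo[ : set R) p.
Proof.
apply: measurable_funM => //; apply: measurable_funM.
  by apply: measurable_funTS; exact: measurable_powR.
apply: measurable_funTS; apply: measurableT_comp => //.
Qed.

Lemma integral_gamma_law (f : R -> \bar R) : measurable_fun setT f ->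
  (\int[G]_y f y = \int[mu]_(y in `]0%R, +oo[) (f y * (p y)%:E))%E.
Proof.
by move=> mf; apply: integral_lebesgue_density => //; exact: mp.
Qed.

Let ip : mu.-integrable `]0%R, +oo[ (EFin \o p).
Proof.
apply/integrableP; split; first exact/measurable_EFinP.
under eq_integral do rewrite gee0_abs ?lee_fin ?p_ge0//.
by have := GEp measurableT; rewrite setTI probability_setT => <-; exact: ltry.
Qed.

(** The separate factor [y] turns [y^(a-1)] into [y^a], so that [powR_le_expR] applies with the
    exponent [b + a], which is positive even when [a < 1]. *)
Lemma powR_gamma_le (b : R) : 0 < b ->
  exists2 K : R, 0 < K & forall y : R, 0 < y ->
    y `^ b * p y * y <= K * expR (- (y / 2)).
Proof.
move=> b0; have [K K0 yK] := powR_le_expR (addr_gt0 b0 a_gt0).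
exists (K / gamma_fun a); first by rewrite divr_gt0// gamma_fun_gt0.
move=> y y0; rewrite /p.
have -> : y `^ b * (y `^ (a - 1) * expR (- y) / gamma_fun a) * y =
    y `^ (b + a) * expR (- y) / gamma_fun a.
  rewrite (@powRD _ y b a); last by rewrite (gt_eqF y0) implybT.
  rewrite -(@mulr_powRB1 _ y a) ?ltW//; ring.
rewrite [leRHS]mulrAC ler_pM2r ?invr_gt0 ?gamma_fun_gt0//.
have -> : - y = - (y / 2) - (y / 2) by field.
rewrite expRD mulrA ler_pM2r ?expR_gt0// expRN.
by rewrite ler_pdivrMr ?expR_gt0// yK.
Qed.

Lemma integrable_sqr_gamma_pos : G.-integrable setT (fun y => (y ^+ 2)%:E).
Proof.
have msqr : measurable_fun setT (fun y : R => (y ^+ 2)%:E).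
  by apply/measurable_EFinP; exact: exprn_measurable.
apply/integrableP; split => //.
under eq_integral do rewrite gee0_abs ?lee_fin ?sqr_ge0//.
rewrite integral_gamma_law//.
have [K K0 yK] := powR_gamma_le ltr01.
have iK : mu.-integrable `]0%R, +oo[ (fun y => K%:E * (expR (- (y / 2)))%:E)%E.
  by apply: integrableZl => //; exact: integrable_expRN_half.
apply: le_lt_trans (integrable_lty _ iK); last by [].
apply: ge0_le_integral => //.
- by move=> y _; rewrite -EFinM lee_fin mulr_ge0 ?sqr_ge0.
- by apply/measurable_EFinP; apply: measurable_funM.
- exact: measurable_int iK.
- move=> y; rewrite /= in_itv/= andbT => y0; rewrite -EFinM lee_fin.
  have <- : y `^ 1 * p y * y = y ^+ 2 * p y by rewrite (powRr1 (ltW y0)); ring.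
  exact: yK.
Qed.


Lemma integrable_quadratic_gamma_pos (f : R -> R) (C : R) : measurable_fun setT f ->
  (forall y, `|f y| <= C * (1 + y ^+ 2)) -> G.-integrable setT (EFin \o f).
Proof.
move=> mf fC.
apply: (@le_integrable _ _ R G setT measurableT _ (fun y => C%:E * (1%:E + (y ^+ 2)%:E))%E).
- exact/measurable_EFinP.
- move=> y _ /=; rewrite lee_fin; apply: le_trans (fC y) _; exact: ler_norm.
- apply: integrableZl => //; apply: integrableD => //.
    exact: finite_measure_integrable_cst.
  exact: integrable_sqr_gamma_pos.
Qed.

Let integrable_density (f : R -> R) : measurable_fun setT f ->
  G.-integrable setT (EFin \o f) ->
  mu.-integrable `]0%R, +oo[ (fun y => (f y * p y)%:E).
Proof.
move=> mf /integrableP[_ fi]; apply/integrableP; split.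
  apply/measurable_EFinP; apply: measurable_funM => //.
  exact: measurable_funTS.
move: fi; rewrite integral_gamma_law//; last first.
  by do 2 apply: measurableT_comp => //.
apply: le_lt_trans; rewrite le_eqVlt; apply/orP; left; apply/eqP.
by apply: eq_integral => y _; rewrite /= normrM (ger0_norm (p_ge0 y)).
Qed.

Lemma quadratic_growth_le (b B K t s : R) : 0 <= b -> 0 <= B -> 0 <= K ->
  0 <= t -> t <= 1 + s -> 0 <= s -> t ^+ 2 = s ->
  (t + b) * (B + K * t) <= (B + K + b * B + b * K) * (1 + s).
Proof.
move=> b0 B0 K0 t0 ts s0 tts.
have -> : (t + b) * (B + K * t) = B * t + K * t ^+ 2 + b * B + b * K * t by ring.
rewrite tts.
have h1 : B * t <= B * (1 + s) by rewrite ler_wpM2l.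
have h2 : b * K * t <= b * K * (1 + s) by rewrite ler_wpM2l// mulr_ge0.
have h3 : 0 <= b * B * s by rewrite !mulr_ge0.
by have := mulr_ge0 K0 s0; lra.
Qed.

Section Stein.
Context (phi dphi : R -> R) (K c r : R).
Hypotheses (dphiP : forall u : R, is_derive u 1 phi (dphi u)) (cdphi : continuous dphi)
  (dphi_le : forall u, `|dphi u| <= K).

Lemma derive_le_lipschitz u v : `|phi u - phi v| <= K * `|u - v|.
Proof.
have cphi : continuous phi.
  by move=> w; apply/differentiable_continuous/derivable1_diffP; exact: ex_derive.
wlog uv : u v / v <= u.
  move=> h; have [/h//|/ltW/h] := leP v u; rewrite distrC [leRHS]mulrC.
  by rewrite distrC mulrC [in leRHS]distrC distrC.
move: uv; rewrite le_eqVlt => /predU1P[->|vu]; first by rewrite !subrr normr0 mulr0.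
have [w _ ->] := MVT vu (fun w _ => dphiP w) (continuous_subspaceT cphi).
by rewrite normrM ler_pM2r ?normr_gt0 ?subr_eq0 ?gt_eqF.
Qed.

Let A : R := `|phi 0| + K * `|r|.
Let K' := K * `|c|.

Let K_ge0 : 0 <= K. Proof. exact: le_trans (dphi_le 0). Qed.
Let A_ge0 : 0 <= A. Proof. by rewrite addr_ge0// mulr_ge0. Qed.
Let K'_ge0 : 0 <= K'. Proof. by rewrite mulr_ge0. Qed.

Let phi_le y : `|phi (c * y + r)| <= A + K' * `|y|.
Proof.
have -> : phi (c * y + r) = phi 0 + (phi (c * y + r) - phi 0) by ring.
rewrite (le_trans (ler_normD _ _))// /A /K' -addrA lerD2l.
rewrite (le_trans (derive_le_lipschitz _ _))// subr0 -mulrA -mulrDr.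
by rewrite ler_wpM2l// addrC (le_trans (ler_normD _ _))// normrM addrC.
Qed.

Let cphi : continuous phi.
Proof.
by move=> w; apply/differentiable_continuous/derivable1_diffP; exact: ex_derive.
Qed.

Let c_affine : continuous (fun y : R => c * y + r).
Proof.
by move=> y; apply: continuousD; [apply: continuousM => //|]; exact: cvg_cst.
Qed.

Let mphi : measurable_fun setT (fun y => phi (c * y + r)).
Proof.
by apply: continuous_measurable_fun => y; apply: continuous_comp; [exact: c_affine|exact: cphi].
Qed.

Let mdphi : measurable_fun setT (fun y => dphi (c * y + r)).
Proof.
by apply: continuous_measurable_fun => y; apply: continuous_comp; [exact: c_affine|exact: cdphi].
Qed.

Let u1 y := (y - a) * phi (c * y + r).
Let u2 y := c * y * dphi (c * y + r).

Let mu1 : measurable_fun setT u1.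
Proof. by apply: measurable_funM => //; exact: measurable_funB. Qed.

Let mu2 : measurable_fun setT u2.
Proof. by apply: measurable_funM => //; exact: measurable_funM. Qed.

Let norm_le_sqr (y : R) : `|y| <= 1 + y ^+ 2.
Proof. by rewrite -(real_normK (num_real y)); have := sqr_ge0 (`|y| - 1); nra. Qed.

(** A Lipschitz [phi] grows at most linearly, hence both integrands of Stein's identity grow at most
    quadratically and second moments suffice. *)
Lemma gamma_law_stein_bound y :
  `|u1 y| <= (A + K' + a * A + a * K') * (1 + y ^+ 2) /\
  `|u2 y| <= K' * (1 + y ^+ 2).
Proof.
have y1 := norm_le_sqr y; have y2 : 0 <= y ^+ 2 by exact: sqr_ge0.
have y0 := normr_ge0 y; have p0 := phi_le y; have yy := real_normK (num_real y).
split.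
  rewrite normrM; apply: (@le_trans _ _ ((`|y| + a) * (A + K' * `|y|))).
    by rewrite ler_pM// (le_trans (ler_normB _ _))// (ger0_norm a_ge0).
  exact: quadratic_growth_le.
rewrite /u2 !normrM /K'.
have -> : `|c| * `|y| * `|dphi (c * y + r)| = `|dphi (c * y + r)| * `|c| * `|y| by ring.
by rewrite ler_pM ?mulr_ge0// ler_wpM2r.
Qed.

Let iu1 : G.-integrable setT (EFin \o u1).
Proof.
exact: (integrable_quadratic_gamma_pos mu1 (fun y => (gamma_law_stein_bound y).1)).
Qed.

Let iu2 : G.-integrable setT (EFin \o u2).
Proof.
exact: (integrable_quadratic_gamma_pos mu2 (fun y => (gamma_law_stein_bound y).2)).
Qed.

(** Since [(y p)' = (a - y) p], the function [F = phi(c y + r) y p(y)] has derivative [f]. Stein's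
    identity says that [f] has integral 0, that is, that [F] vanishes at both ends of the
    half-line. *)
Let f y := (u2 y - u1 y) * p y.
Let F y := phi (c * y + r) * (y `^ a * expR (- y) / gamma_fun a).

Let yp (y : R) : 0 < y -> y `^ a * expR (- y) / gamma_fun a = y * p y.
Proof. by move=> y0; rewrite /p -(@mulr_powRB1 _ y a) ?ltW//; ring. Qed.

Let dF (y : R) : 0 < y -> is_derive y 1 F (f y).
Proof.
move=> y0.
have d1 : is_derive y 1 (fun z => phi (c * z + r)) (dphi (c * y + r) * c).
  apply: (@is_derive1_comp _ phi (fun z => c * z + r)).
  by apply: is_derive_eq; rewrite ?scaler0 ?add0r ?addr0 /GRing.scale/= mulr1.
have d2 := is_derive1_powR a y0.
apply: is_derive_eq; rewrite /f /u2 /u1 /p /GRing.scale/=.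
have -> : y `^ a = y * y `^ (a - 1) by rewrite mulr_powRB1// ltW.
rewrite ?scaler0 ?mulr0 ?addr0 ?add0r.
ring.
Qed.

Let cf (y : R) : 0 < y -> {for y, continuous f}.
Proof.
move=> y0; apply: continuousM.
  apply: continuousB; apply: continuousM.
  - by apply: continuousM => //; exact: cvg_cst.
  - by apply: continuous_comp; [exact: c_affine|exact: cdphi].
  - by apply: continuousB => //; exact: cvg_cst.
  - by apply: continuous_comp; [exact: c_affine|exact: cphi].
apply: continuousM; last exact: cvg_cst.
apply: continuousM.
  apply/differentiable_continuous/derivable1_diffP.
  by apply: derivable_powR; rewrite in_itv/= y0.
by apply: continuous_comp; [exact: continuousN|exact: continuous_expR].
Qed.

Let F_small (y : R) : 0 < y -> y <= 1 -> `|F y| <= (A + K') / gamma_fun a * y `^ a.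
Proof.
move=> y0 y1; have G0 := gamma_fun_gt0.
have -> : (A + K') / gamma_fun a * y `^ a = (A + K') * (y `^ a / gamma_fun a) by ring.
rewrite /F normrM ler_pM//.
  by rewrite (le_trans (phi_le y))// lerD2l ler_piMr// gtr0_norm.
rewrite ger0_norm; last first.
  by rewrite !mulr_ge0 ?powR_ge0 ?expR_ge0// invr_ge0 ltW.
rewrite ler_pM2r ?invr_gt0//.
by rewrite ler_piMr ?powR_ge0// -[leRHS]expR0 ler_expR oppr_le0 ltW.
Qed.

Let F_large : exists2 C, 0 < C & forall y : R, 1 <= y -> `|F y| <= C * expR (- (y / 2)).
Proof.
have [C C0 yC] := powR_gamma_le ltr01.
have AK : 0 < A + K' + 1 by apply: ltr_wpDl => //; exact: addr_ge0.
exists ((A + K' + 1) * C); first exact: mulr_gt0.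
move=> y y1; have y0 : 0 < y by exact: lt_le_trans y1.
rewrite /F yp// normrM [X in _ * X]ger0_norm; last by rewrite mulr_ge0// ltW.
apply: (@le_trans _ _ ((A + K' + 1) * y * (y * p y))).
  rewrite ler_wpM2r//; first by rewrite mulr_ge0// ltW.
  rewrite (le_trans (phi_le y))// gtr0_norm//.
  have -> : (A + K' + 1) * y = A * y + (K' * y + y) by ring.
  apply: lerD; first by rewrite ler_peMr.
  by rewrite lerDl ltW.
rewrite -!mulrA ler_wpM2l ?(ltW AK)//.
by have := yC _ y0; rewrite (powRr1 (ltW y0)); apply: le_trans; rewrite le_eqVlt; apply/orP; left; apply/eqP; ring.
Qed.

Let F_cvg : (F n.+2%:R - F n.+1%:R^-1) @[n --> \oo] --> 0.
Proof.
have [C C0 yC] := F_large.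
have h1 : C * expR (- (n.+2%:R / 2)) @[n --> \oo] --> 0.
  rewrite -(mulr0 C); apply: cvgM; first exact: cvg_cst.
  apply: (@cvg_comp _ _ _ (fun n => n.+2%:R / 2) (fun y => expR (- y)) _ (pinfty_nbhs R)).
    apply/cvgryPge => B; near=> n; rewrite ler_pdivlMr//.
    rewrite (@le_trans _ _ n%:R) ?ler_nat//; last exact/ltnW.
    by near: n; exact: nbhs_infty_ger.
  exact: cvgr_expR.
have h2 : (A + K') / gamma_fun a * n.+1%:R^-1 `^ a @[n --> \oo] --> 0.
  rewrite -(mulr0 ((A + K') / gamma_fun a)); apply: cvgM; first exact: cvg_cst.
  apply: (@cvg_comp _ _ _ (fun n => n.+1%:R^-1) (fun y => y `^ a) _ (0^'+)).
    move=> S [e /= e0 eS]; near=> n; apply: eS => /=; last by rewrite invr_gt0.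
    rewrite sub0r normrN; near: n.
    by move: e e0; apply/cvgr0Pnorm_lt; exact: cvg_harmonic.
  exact: powR_cvg0.
have h : C * expR (- (n.+2%:R / 2)) + (A + K') / gamma_fun a * n.+1%:R^-1 `^ a
    @[n --> \oo] --> 0.
  by rewrite -(addr0 0); exact: cvgD.
have b n : `|F n.+2%:R - F n.+1%:R^-1| <=
    C * expR (- (n.+2%:R / 2)) + (A + K') / gamma_fun a * n.+1%:R^-1 `^ a.
  rewrite (le_trans (ler_normB _ _))// lerD//.
    by apply: yC; rewrite ler1n.
  by apply: F_small; rewrite ?invr_gt0// invf_le1// ler1n.
have hN : - (C * expR (- (n.+2%:R / 2)) + (A + K') / gamma_fun a * n.+1%:R^-1 `^ a)
    @[n --> \oo] --> 0.
  by rewrite -[X in _ --> X]oppr0; exact: (cvgN h).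
apply: (squeeze_cvgr _ hN h).
by apply: nearW => n; rewrite -ler_norml; exact: b.
Unshelve. all: by end_near. Qed.

Lemma gamma_law_stein_pos : \int[G]_y u1 y = \int[G]_y u2 y.
Proof.
have i1 := integrable_density mu1 iu1; have i2 := integrable_density mu2 iu2.
have i12 : mu.-integrable `]0%R, +oo[ (EFin \o f).
  apply: eq_integrable (integrableB _ i2 i1) => // y _ /=.
  by rewrite -EFinB /f mulrBl.
have : (\int[mu]_(y in `]0%R, +oo[) (f y)%:E = 0%:E)%E.
  apply: (@integral_exhaustion_FTC2 R _ (fun n => n.+1%:R^-1) (fun n => n.+2%:R) F) => //.
  - by move=> n; rewrite (@le_lt_trans _ _ 1) ?invf_le1 ?ltr1n ?ler1n.
  - move=> n y /=; rewrite !in_itv/= andbT => /andP[+ _]; apply: lt_le_trans.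
    by rewrite invr_gt0.
  - move=> y /=; rewrite in_itv/= andbT => y0; near=> n; apply/andP; split.
      rewrite invf_ple ?posrE// (@le_trans _ _ n%:R) ?ler_nat//.
      by near: n; exact: nbhs_infty_ger.
    rewrite (@le_trans _ _ n%:R) ?ler_nat//; last exact/ltnW.
    by near: n; exact: nbhs_infty_ger.
  - by move=> y /=; rewrite in_itv/= andbT; exact: dF.
  - by move=> y /=; rewrite in_itv/= andbT; exact: cf.
  - by have /integrableP[/measurable_EFinP] := i12.
under eq_integral do rewrite /f mulrBl EFinB.
rewrite integralB// => e.
have m0 : measurable (`]0%R, +oo[%classic : set (measurableTypeR R)) by exact: measurable_itv.
have f1 := integrable_fin_num m0 i1; have f2 := integrable_fin_num m0 i2.
move: e; rewrite -(fineK f1) -(fineK f2) -EFinB => -[] /eqP; rewrite subr_eq0 => /eqP e.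
rewrite /Rintegral !integral_gamma_law; [|exact/measurable_EFinP|exact/measurable_EFinP].
exact/esym.
Unshelve. all: by end_near. Qed.

End Stein.

End Positive.

Lemma integral_gamma_law0 (f : R -> \bar R) : a = 0 -> measurable_fun setT f ->
  (\int[G]_y f y = f 0%R)%E.
Proof.
move=> a0 mf; rewrite (@eq_measure_integral _ R R setT (\d_(0 : R)) G).
  by rewrite integral_dirac// diracT mul1e.
by move=> B mB _; rewrite /= gamma_law0.
Qed.

Lemma integrable_quadratic_gamma (f : R -> R) (C : R) : measurable_fun setT f ->
  (forall y, `|f y| <= C * (1 + y ^+ 2)) -> G.-integrable setT (EFin \o f).
Proof.
move: a_ge0; rewrite le_eqVlt => /predU1P[/esym a0|a_gt0] mf fC.
  apply/integrableP; split; first exact/measurable_EFinP.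
  by rewrite integral_gamma_law0//= ?ltry//; do 2 apply: measurableT_comp => //.
exact: integrable_quadratic_gamma_pos fC.
Qed.

(** For [a = 0] the law is the point mass at 0, where [y - a] and [y] both vanish; for [a > 0] it is
    an integration by parts against the density. *)
Lemma gamma_law_stein (phi dphi : R -> R) (K c r : R) :
  (forall u : R, is_derive u 1 phi (dphi u)) -> continuous dphi ->
  (forall u, `|dphi u| <= K) ->
  \int[G]_y ((y - a) * phi (c * y + r)) = \int[G]_y (c * y * dphi (c * y + r)).
Proof.
move=> dphiP cdphi dphiK.
move: a_ge0; rewrite le_eqVlt => /predU1P[/esym a0|a_gt0]; last first.
  exact: (gamma_law_stein_pos a_gt0 c r dphiP cdphi dphiK).
have cphi : continuous phi.
  by move=> w; apply/differentiable_continuous/derivable1_diffP; exact: ex_derive.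
have c_affine : continuous (fun y : R => c * y + r).
  by move=> y; apply: continuousD; [apply: continuousM => //|]; exact: cvg_cst.
rewrite /Rintegral !integral_gamma_law0//.
- by rewrite a0 subrr mulr0 !mul0r.
- apply/measurable_EFinP/measurable_funM; first exact: measurable_funM.
  by apply: continuous_measurable_fun => y; apply: continuous_comp; [exact: c_affine|exact: cdphi].
- apply/measurable_EFinP/measurable_funM; first exact: measurable_funB.
  by apply: continuous_measurable_fun => y; apply: continuous_comp; [exact: c_affine|exact: cphi].
Qed.

Lemma gamma_law_lt0 : G `]-oo, 0[%classic = 0%E.
Proof.
rewrite GE// /gamma_law; case: ifPn => [_|_].
  by rewrite diracE memNset//= in_itv/= ltxx.
rewrite (_ : _ `&` _ = set0) ?integral_set0//.
by apply/seteqP; split => // y /=; rewrite !in_itv/= andbT => -[]; case: ltgtP.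
Qed.

End GammaLaw.

(** * Linear forms in Gamma variables *)

Definition mfun_of d1 d2 (T1 : measurableType d1) (T2 : measurableType d2)
    (f : T1 -> T2) (mf : measurable_fun setT f) : {mfun T1 >-> T2} :=
  MeasurableFun.Pack (MeasurableFun.Class (isMeasurableFun.Build _ _ _ _ _ mf)).

Lemma Rintegral_sum d (W : measurableType d) (R : realType)
    (mu : {measure set W -> \bar R}) (I : Type) (r : seq I) (P : pred I) (X : I -> W -> R) :
  (forall i, P i -> mu.-integrable setT (EFin \o X i)) ->
  \int[mu]_w (\sum_(i <- r | P i) X i w) = \sum_(i <- r | P i) \int[mu]_w X i w.
Proof.
move=> iX; elim: r => [|i r ih].
  by under eq_Rintegral do rewrite big_nil; rewrite big_nil Rintegral_cst// mul0r.
rewrite big_cons; under eq_Rintegral do rewrite big_cons.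
have [Pi|//] := boolP (P i); rewrite RintegralD ?ih//; first exact: iX.
have := @integrable_sum _ _ _ mu setT measurableT I r P (fun i => EFin \o X i) iX.
by apply: eq_integrable => // w _ /=; rewrite sumEFin.
Qed.

(** * Square-integrable random variables *)

Section SquareIntegrable.
Context d (W : measurableType d) (R : realType) (Q : probability W R).

Definition sq_integrable (X : W -> R) :=
  measurable_fun setT X /\ Q.-integrable setT (fun w => (X w ^+ 2)%:E).

Lemma sq_integrable_cst (c : R) : sq_integrable (fun=> c).
Proof. by split => //; exact: finite_measure_integrable_cst. Qed.

Lemma sq_integrable_le (X Y : W -> R) (A K : R) : measurable_fun setT X ->
  sq_integrable Y -> (forall w, `|X w| <= A + K * `|Y w|) -> sq_integrable X.
Proof.
move=> mX [mY iY] XY; split => //.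
apply: (@le_integrable _ _ _ Q setT measurableT _
  (fun w => ((2 * A ^+ 2)%:E + (2 * K ^+ 2)%:E * (Y w ^+ 2)%:E)%E)).
- by apply/measurable_EFinP; exact: measurable_funX.
- move=> w _ /=; rewrite lee_fin; apply: le_trans (ler_norm _).
  rewrite ger0_norm ?sqr_ge0// -(real_normK (num_real (X w))).
  rewrite -(real_normK (num_real (Y w))).
  have h := XY w; have h0 := normr_ge0 (X w).
  apply: (@le_trans _ _ ((A + K * `|Y w|) ^+ 2)).
    by rewrite ler_sqr// nnegrE// (le_trans h0).
  by have := sqr_ge0 (A - K * `|Y w|); nra.
- apply: integrableD => //; first exact: finite_measure_integrable_cst.
  exact: integrableZl.
Qed.

Lemma sq_integrableZ (X : W -> R) (c : R) :
  sq_integrable X -> sq_integrable (fun w => c * X w).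
Proof.
move=> sX; apply: (@sq_integrable_le _ X 0 `|c|) => //.
  by apply: measurable_funM => //; case: sX.
by move=> w; rewrite add0r normrM.
Qed.

Lemma sq_integrableD (X Y : W -> R) :
  sq_integrable X -> sq_integrable Y -> sq_integrable (fun w => X w + Y w).
Proof.
move=> [mX iX] [mY iY]; split; first exact: measurable_funD.
apply: (@le_integrable _ _ _ Q setT measurableT _
  (fun w => (2%:E * (X w ^+ 2)%:E + 2%:E * (Y w ^+ 2)%:E)%E)).
- by apply/measurable_EFinP; apply: measurable_funX; exact: measurable_funD.
- move=> w _ /=; rewrite lee_fin; apply: le_trans (ler_norm _).
  rewrite ger0_norm ?sqr_ge0//.
  by have := sqr_ge0 (X w - Y w); nra.
- by apply: integrableD => //; exact: integrableZl.
Qed.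

Lemma sq_integrableB (X Y : W -> R) :
  sq_integrable X -> sq_integrable Y -> sq_integrable (fun w => X w - Y w).
Proof.
move=> sX sY.
have -> : (fun w => X w - Y w) = (fun w => X w + (-1) * Y w).
  by apply/funext => w; rewrite mulN1r.
by apply: sq_integrableD => //; exact: sq_integrableZ.
Qed.

Lemma sq_integrable_sum (I : Type) (r : seq I) (P : pred I) (X : I -> W -> R) :
  (forall i, P i -> sq_integrable (X i)) ->
  sq_integrable (fun w => \sum_(i <- r | P i) X i w).
Proof.
move=> sX; elim: r => [|i r ih].
  by under eq_fun do rewrite big_nil; exact: sq_integrable_cst.
under eq_fun do rewrite big_cons.
have [Pi|//] := boolP (P i).
by apply: sq_integrableD => //; exact: sX.
Qed.

Lemma sq_integrableM (X Y : W -> R) : sq_integrable X -> sq_integrable Y ->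
  Q.-integrable setT (EFin \o (fun w => X w * Y w)).
Proof.
move=> [mX iX] [mY iY].
apply: (@le_integrable _ _ _ Q setT measurableT _
  (fun w => ((X w ^+ 2)%:E + (Y w ^+ 2)%:E)%E)).
- by apply/measurable_EFinP; exact: measurable_funM.
- move=> w _ /=; rewrite lee_fin; apply: le_trans (ler_norm _).
  rewrite normrM -(real_normK (num_real (X w))) -(real_normK (num_real (Y w))).
  by have := sqr_ge0 (`|X w| - `|Y w|); nra.
- exact: integrableD.
Qed.

Lemma sq_integrable_integrable (X : W -> R) :
  sq_integrable X -> Q.-integrable setT (EFin \o X).
Proof.
move=> sX; have := sq_integrableM sX (sq_integrable_cst 1).
by under eq_fun do rewrite mulr1.
Qed.

Lemma Rintegral_prob_cst (c : R) : \int[Q]_w c = c.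
Proof. transitivity (c * fine (Q setT)); first exact: Rintegral_cst.
by rewrite probability_setT mulr1. Qed.

Lemma le_Rintegral_sqr (X : W -> R) : sq_integrable X ->
  \int[Q]_w `|X w| <= Num.sqrt (\int[Q]_w (X w ^+ 2)).
Proof.
move=> [mX iX]; set s := \int[Q]_w (X w ^+ 2).
have s0 : 0 <= s by apply: Rintegral_ge0 => w _; exact: sqr_ge0.
have iaX : Q.-integrable setT (EFin \o (fun w => `|X w|)).
  by apply: integrable_norm; exact: sq_integrable_integrable.
(* |X| <= (t + X^2 / t) / 2 for every t > 0 *)
have key t : 0 < t -> \int[Q]_w `|X w| <= (t + s / t) / 2.
  move=> t0.
  have -> : (t + s / t) / 2 = \int[Q]_w (t / 2 + (2 * t)^-1 * X w ^+ 2).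
    rewrite RintegralD//; last 2 first.
    - exact: finite_measure_integrable_cst.
    - exact: (integrableZl measurableT (2 * t)^-1 iX).
    rewrite Rintegral_prob_cst RintegralZl// -/s; field.
    by rewrite gt_eqF.
  apply: le_Rintegral => //.
    exact: (integrableD measurableT (finite_measure_integrable_cst Q (t / 2) measurableT)
      (integrableZl measurableT (2 * t)^-1 iX)).
  move=> w _; rewrite -(real_normK (num_real (X w))).
  have -> : t / 2 + (2 * t)^-1 * `|X w| ^+ 2 =
    `|X w| + (2 * t)^-1 * (t - `|X w|) ^+ 2 by field; rewrite gt_eqF.
  by rewrite lerDl mulr_ge0 ?sqr_ge0// invr_ge0 mulr_ge0// ltW.
(* The choice [t = sqrt s] is optimal; if [s = 0], arbitrarily small [t > 0] are used instead. *)
move: s0; rewrite le_eqVlt => /predU1P[s0|s0]; last first.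
  have q0 : 0 < Num.sqrt s by rewrite sqrtr_gt0.
  apply: (le_trans (key _ q0)).
  rewrite -{2}(sqr_sqrtr (ltW s0)) expr2 mulfK ?gt_eqF//.
  by rewrite le_eqVlt; apply/orP; left; apply/eqP; field.
rewrite -s0 sqrtr0; apply/ler_addgt0Pr => e e0; rewrite add0r.
apply: (le_trans (key _ e0)); rewrite -s0 mul0r addr0 ler_pdivrMr//.
by rewrite ler_peMr ?ler1n// ltW.
Qed.

End SquareIntegrable.

Section IndependentPair.
Context d (W : measurableType d) (R : realType) (Q : probability W R).
Variables (X N : {RV Q >-> R}).
Hypothesis indXN : forall B C : set R, measurable B -> measurable C ->
  Q (X @^-1` B `&` N @^-1` C) = (Q (X @^-1` B) * Q (N @^-1` C))%E.

(** The joint law of the pair agrees with the product of the marginals on rectangles, hence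
    everywhere, and Fubini's theorem applies. *)
Lemma Rintegral_independent (psi : R * R -> R) : measurable_fun setT psi ->
  Q.-integrable setT (EFin \o (fun w => psi (X w, N w))) ->
  (\int[Q]_w (psi (X w, N w))%:E =
   \int[distribution Q N]_r \int[distribution Q X]_y (psi (y, r))%:E)%E.
Proof.
move=> mpsi ipsi.
have mXN : measurable_fun setT (fun w => (X w, N w)).
  exact: measurable_fun_pair.
pose XN := mfun_of mXN.
have eqm B : measurable B ->
    (distribution Q X \x distribution Q N)%E B = distribution Q XN B.
  by move=> mB; apply: product_measure_unique => // B1 C1 mB1 mC1; exact: indXN.
have mpsiE : measurable_fun setT (EFin \o psi) by exact/measurable_EFinP.
have iprod : (distribution Q X \x distribution Q N)%E.-integrable setT (EFin \o psi).
  have : (distribution Q XN).-integrable setT (EFin \o psi).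
    exact: (integrable_pushforward mXN).
  move=> /integrableP[_ h]; apply/integrableP; split => //.
  by rewrite (@eq_measure_integral _ _ _ _ (distribution Q XN))// => B mB _; exact: eqm.
have := integral21_prod_meas1 iprod.
rewrite /fubini_G => ->.
rewrite (@eq_measure_integral _ _ _ _ (distribution Q XN)); last first.
  by move=> B mB _; exact: eqm.
by rewrite integral_distribution.
Qed.

End IndependentPair.

(** * Stein's identity for linear forms in independent Gamma variables *)

Section GammaForms.
Context d (W : measurableType d) (R : realType) (Q : probability W R) (k : nat)
  (Y : 'I_k -> {RV Q >-> R}) (a : 'I_k -> R).
Hypotheses (indY : mutually_independent Q Y) (a_ge0 : forall i, 0 <= a i)
  (YE : forall i B, measurable B -> distribution Q (Y i) B = gamma_law (a i) B).

Lemma sq_integrable_gamma i : sq_integrable Q (Y i).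
Proof.
split => //.
have : (distribution Q (Y i)).-integrable setT (EFin \o (fun y : R => y ^+ 2)).
  apply: (@integrable_quadratic_gamma R (distribution Q (Y i)) (a i) (a_ge0 i) (@YE i) _ 1).
    exact: measurable_funX.
  by move=> y; rewrite mul1r ger0_norm ?sqr_ge0// lerDr.
move=> /integrableP[_ h]; apply/integrableP; split.
  by apply/measurable_EFinP; exact: measurable_funX.
move: h; rewrite ge0_integral_distribution//.
by apply: measurableT_comp => //; apply/measurable_EFinP; exact: measurable_funX.
Qed.

Definition lin (c : 'I_k -> R) (w : W) : R := \sum_i c i * Y i w.
Definition clin (c : 'I_k -> R) (w : W) : R := \sum_i c i * (Y i w - a i).

Lemma sq_integrable_lin c : sq_integrable Q (lin c).
Proof.
by apply: sq_integrable_sum => i _; apply: sq_integrableZ; exact: sq_integrable_gamma.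
Qed.

Lemma clinE c w : clin c w = lin c w - \sum_i c i * a i.
Proof. by rewrite /clin /lin -sumrB; apply: eq_bigr => i _; rewrite mulrBr. Qed.

Lemma sq_integrable_clin c : sq_integrable Q (clin c).
Proof.
have -> : clin c = (fun w => lin c w - \sum_i c i * a i).
  by apply/funext => w; exact: clinE.
by apply: sq_integrableB; [exact: sq_integrable_lin|exact: sq_integrable_cst].
Qed.

Section Stein.
Context (phi dphi : R -> R) (K : R).
Hypotheses (dphiP : forall u : R, is_derive u 1 phi (dphi u)) (cdphi : continuous dphi)
  (dphi_le : forall u, `|dphi u| <= K).

Let mphi : measurable_fun setT phi.
Proof.
apply: continuous_measurable_fun => w.
by apply/differentiable_continuous/derivable1_diffP; exact: ex_derive.
Qed.

Let mdphi : measurable_fun setT dphi.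
Proof. exact: continuous_measurable_fun. Qed.

Lemma sq_integrable_lipschitz (X : W -> R) :
  sq_integrable Q X -> sq_integrable Q (fun w => phi (X w)).
Proof.
move=> sX; apply: (sq_integrable_le (A := `|phi 0|) (K := K) _ sX).
  by apply: measurableT_comp => //; case: sX.
move=> w; have -> : phi (X w) = phi 0 + (phi (X w) - phi 0) by ring.
rewrite (le_trans (ler_normD _ _))// lerD2l.
by rewrite (le_trans (derive_le_lipschitz dphiP dphi_le _ _))// subr0.
Qed.

Lemma sq_integrable_dphi (X : W -> R) :
  measurable_fun setT X -> sq_integrable Q (fun w => dphi (X w)).
Proof.
move=> mX; apply: (sq_integrable_le (A := K) (K := 0) _ (sq_integrable_cst Q 0)).
  exact: measurableT_comp.
by move=> w; rewrite mul0r addr0.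
Qed.

(** The sum [N] of the other coordinates is independent of [Y j], so Fubini's theorem allows it to
    be frozen at a value [r], and the one-variable identity applies with shift [r + t]. The free
    shift [t] later serves to centre the form. *)
Lemma stein_coordinate (c : 'I_k -> R) (t : R) (j : 'I_k) :
  \int[Q]_w ((Y j w - a j) * phi (lin c w + t)) =
  \int[Q]_w (c j * (Y j w * dphi (lin c w + t))).
Proof.
pose N w := \sum_(i | i != j) c i * Y i w.
have sN : sq_integrable Q N.
  by apply: sq_integrable_sum => i _; apply: sq_integrableZ; exact: sq_integrable_gamma.
have mN : measurable_fun setT N by case: sN.
have linE w : lin c w = c j * Y j w + N w by rewrite /lin (bigD1 j).
have ind B C : measurable B -> measurable C ->
    Q (Y j @^-1` B `&` mfun_of mN @^-1` C) = (Q (Y j @^-1` B) * Q (mfun_of mN @^-1` C))%E.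
  exact: (independent_linear_others indY c j).
have slin : sq_integrable Q (fun w => lin c w + t).
  by apply: sq_integrableD; [exact: sq_integrable_lin|exact: sq_integrable_cst].
have mY (f : R -> R) : measurable_fun setT f ->
    measurable_fun setT (fun z : R * R => f (c j * z.1 + (z.2 + t))).
  move=> mf; apply: measurableT_comp => //; apply: measurable_funD.
    by apply: measurable_funM => //; exact: measurable_fst.
  by apply: measurable_funD => //; exact: measurable_snd.
pose psi1 (z : R * R) := (z.1 - a j) * phi (c j * z.1 + (z.2 + t)).
pose psi2 (z : R * R) := c j * z.1 * dphi (c j * z.1 + (z.2 + t)).
have mpsi1 : measurable_fun setT psi1.
  apply: measurable_funM; last exact: mY.
  by apply: measurable_funB => //; exact: measurable_fst.
have mpsi2 : measurable_fun setT psi2.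
  apply: measurable_funM; last exact: mY.
  by apply: measurable_funM => //; exact: measurable_fst.
have i1 : Q.-integrable setT (EFin \o (fun w => psi1 (Y j w, mfun_of mN w))).
  have := sq_integrableM (sq_integrableB (sq_integrable_gamma j) (sq_integrable_cst Q (a j)))
    (sq_integrable_lipschitz slin).
  by apply: eq_integrable => // w _; rewrite /psi1 /= linE addrA.
have i2 : Q.-integrable setT (EFin \o (fun w => psi2 (Y j w, mfun_of mN w))).
  have := sq_integrableM (sq_integrableZ (c j) (sq_integrable_gamma j))
    (sq_integrable_dphi slin.1).
  by apply: eq_integrable => // w _; rewrite /psi2 /= linE addrA.
transitivity (\int[Q]_w psi1 (Y j w, mfun_of mN w)).
  by apply: eq_Rintegral => w _; rewrite /psi1 /= linE addrA.
transitivity (\int[Q]_w psi2 (Y j w, mfun_of mN w)); last first.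
  by apply: eq_Rintegral => w _; rewrite /psi2 /= linE addrA mulrA.
rewrite /Rintegral (Rintegral_independent ind mpsi1 i1) (Rintegral_independent ind mpsi2 i2).
congr fine; apply: eq_integral => r _.
have iq (f : R -> R) (C : R) : measurable_fun setT f ->
    (forall y, `|f y| <= C * (1 + y ^+ 2)) ->
    (\int[distribution Q (Y j)]_y (f y)%:E)%E = (\int[distribution Q (Y j)]_y f y)%:E.
  move=> mf fC; rewrite /Rintegral fineK//.
  apply: integrable_fin_num => //.
  exact: (integrable_quadratic_gamma (a_ge0 j) (@YE j) mf fC).
have [h1 h2] := (fun y => gamma_law_stein_bound (a_ge0 j) (c j) (r + t) dphiP dphi_le y,
  fun y => gamma_law_stein_bound (a_ge0 j) (c j) (r + t) dphiP dphi_le y).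
rewrite (iq (fun y => psi1 (y, r)) _ _ (fun y => (h1 y).1)); last first.
  by apply: (measurableT_comp mpsi1); exact: measurable_fun_pair.
rewrite (iq (fun y => psi2 (y, r)) _ _ (fun y => (h2 y).2)); last first.
  by apply: (measurableT_comp mpsi2); exact: measurable_fun_pair.
congr EFin.
exact: (gamma_law_stein (a_ge0 j) (@YE j) (c j) (r + t) dphiP cdphi dphi_le).
Qed.

End Stein.

(** Stein's identity with [phi = 1]. *)
Lemma Rintegral_gamma j : \int[Q]_w Y j w = a j.
Proof.
have d0 (u : R) : is_derive u 1 (fun=> 1 : R) 0 by exact: is_derive_cst.
have c0 : continuous ((fun=> 0) : R -> R) by move=> u; exact: cvg_cst.
have b0 (u : R) : `|0 : R| <= 0 by rewrite normr0.
have := stein_coordinate d0 c0 b0 (fun=> 0) 0 j.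
under eq_Rintegral do rewrite mulr1.
under [X in _ = X -> _]eq_Rintegral do rewrite mul0r.
rewrite Rintegral_prob_cst RintegralB//; last 2 first.
- by apply: sq_integrable_integrable; exact: sq_integrable_gamma.
- exact: finite_measure_integrable_cst.
by rewrite Rintegral_prob_cst => /eqP; rewrite subr_eq0 => /eqP.
Qed.

Lemma Rintegral_lin c : \int[Q]_w lin c w = \sum_i c i * a i.
Proof.
rewrite Rintegral_sum.
  apply: eq_bigr => i _; rewrite RintegralZl ?Rintegral_gamma//.
  by apply: sq_integrable_integrable; exact: sq_integrable_gamma.
move=> i _; apply: sq_integrable_integrable.
by apply: sq_integrableZ; exact: sq_integrable_gamma.
Qed.

(* The Stein kernel of the centred Gamma(a, 1) law is the variable itself *)
Lemma stein_clin (phi dphi : R -> R) (K : R) (c : 'I_k -> R) :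
  (forall u : R, is_derive u 1 phi (dphi u)) -> continuous dphi ->
  (forall u, `|dphi u| <= K) ->
  \int[Q]_w (clin c w * phi (clin c w)) =
  \int[Q]_w (lin (fun i => c i ^+ 2) w * dphi (clin c w)).
Proof.
move=> dphiP cdphi dphi_le.
have sphi := sq_integrable_lipschitz dphiP dphi_le (sq_integrable_clin c).
have sdphi := sq_integrable_dphi cdphi dphi_le (sq_integrable_clin c).1.
transitivity (\int[Q]_w (\sum_i c i * ((Y i w - a i) * phi (clin c w)))).
  by apply: eq_Rintegral => w _; rewrite [X in X * _]/clin mulr_suml; apply: eq_bigr => i _; rewrite mulrA.
transitivity (\int[Q]_w (\sum_i c i ^+ 2 * (Y i w * dphi (clin c w)))); last first.
  by apply: eq_Rintegral => w _; rewrite /lin mulr_suml; apply: eq_bigr => i _; rewrite mulrA.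
have i1 i : Q.-integrable setT (EFin \o (fun w => (Y i w - a i) * phi (clin c w))).
  apply: sq_integrableM => //; apply: sq_integrableB; last exact: sq_integrable_cst.
  exact: sq_integrable_gamma.
have i2 i : Q.-integrable setT (EFin \o (fun w => Y i w * dphi (clin c w))).
  by apply: sq_integrableM => //; exact: sq_integrable_gamma.
rewrite !Rintegral_sum; last 2 first.
- by move=> i _; exact: (integrableZl measurableT (c i ^+ 2) (i2 i)).
- by move=> i _; exact: (integrableZl measurableT (c i) (i1 i)).
apply: eq_bigr => i _; rewrite !RintegralZl//.
have := stein_coordinate dphiP cdphi dphi_le c (- \sum_i c i * a i) i.
under eq_Rintegral do rewrite -clinE.
under [X in _ = X -> _]eq_Rintegral do rewrite -clinE.
by rewrite RintegralZl// => ->; rewrite expr2 mulrA.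
Qed.

(** Stein's identity with [phi] the identity: the right-hand side becomes the mean of the Stein
    kernel. *)
Lemma variance_clin c : \int[Q]_w (clin c w ^+ 2) = \sum_i c i ^+ 2 * a i.
Proof.
have d0 (u : R) : is_derive u 1 id (1 : R) by exact: is_derive_id.
have c0 : continuous ((fun=> 1) : R -> R) by move=> u; exact: cvg_cst.
have b0 (u : R) : `|1 : R| <= 1 by rewrite normr1.
have := stein_clin c d0 c0 b0.
under eq_Rintegral do rewrite -expr2.
by move=> ->; rewrite -Rintegral_lin; apply: eq_Rintegral => w _; rewrite mulr1.
Qed.

Lemma mean_abs_clin c : \int[Q]_w `|clin c w| <= Num.sqrt (\sum_i c i ^+ 2 * a i).
Proof. by rewrite -variance_clin; apply: le_Rintegral_sqr; exact: sq_integrable_clin. Qed.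

(* For a solution phi of the Stein equation v phi' - u phi = h - N(0, v) h, the
   left-hand side is the distance of the law of [clin c] to N(0, v). *)
Lemma stein_discrepancy (phi dphi : R -> R) (K v : R) (c : 'I_k -> R) :
  (forall u : R, is_derive u 1 phi (dphi u)) -> continuous dphi ->
  (forall u, `|dphi u| <= K) ->
  `|\int[Q]_w (v * dphi (clin c w) - clin c w * phi (clin c w))| <=
  K * (`|v - \sum_i c i ^+ 2 * a i| + Num.sqrt (\sum_i c i ^+ 4 * a i)).
Proof.
move=> dphiP cdphi dphi_le.
have sphi := sq_integrable_lipschitz dphiP dphi_le (sq_integrable_clin c).
have sdphi := sq_integrable_dphi cdphi dphi_le (sq_integrable_clin c).1.
have slin := sq_integrable_lin (fun i => c i ^+ 2).
have i1 := sq_integrableM (sq_integrable_clin c) sphi.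
have i2 := sq_integrableM slin sdphi.
have i3 := sq_integrable_integrable sdphi.
have i3' : Q.-integrable setT (EFin \o (fun w => v * dphi (clin c w))).
  exact: (integrableZl measurableT v i3).
have K0 : 0 <= K by exact: le_trans (dphi_le 0).
rewrite RintegralB// (stein_clin c dphiP cdphi dphi_le) -RintegralB//.
have -> : \int[Q]_w (v * dphi (clin c w) - lin (fun i => c i ^+ 2) w * dphi (clin c w)) =
    \int[Q]_w ((v - lin (fun i => c i ^+ 2) w) * dphi (clin c w)).
  by apply: eq_Rintegral => w _; rewrite mulrBl.
have sv := sq_integrableB (sq_integrable_cst Q v) slin.
have i4 := sq_integrableM sv sdphi.
apply: (le_trans (le_normr_Rintegral _ i4)) => //.
have sc := sq_integrable_clin (fun i => c i ^+ 2).
have isc : Q.-integrable setT (EFin \o (fun w => `|clin (fun i => c i ^+ 2) w|)).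
  by apply: integrable_norm; exact: sq_integrable_integrable.
set e := `|v - \sum_i c i ^+ 2 * a i|.
have isum : Q.-integrable setT (EFin \o (fun w => e + `|clin (fun i => c i ^+ 2) w|)).
  exact: (integrableD measurableT (finite_measure_integrable_cst Q e measurableT) isc).
apply: (@le_trans _ _ (\int[Q]_w (K * (e + `|clin (fun i => c i ^+ 2) w|)))).
  apply: le_Rintegral => //.
  - exact: (integrable_norm i4).
  - exact: (integrableZl measurableT K isum).
  - move=> w _; rewrite normrM mulrC ler_pM//.
    (* The random kernel is split into its mean and a centred form with coefficients [c i ^ 2],
       whose variance is the sum of the [c i ^ 4 * a i]. *)
    have -> : v - lin (fun i => c i ^+ 2) w =
        (v - \sum_i c i ^+ 2 * a i) - clin (fun i => c i ^+ 2) w by rewrite clinE; ring.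
    exact: ler_normB.
rewrite RintegralZl// ler_wpM2l// RintegralD//; last exact: finite_measure_integrable_cst.
rewrite Rintegral_prob_cst lerD2l (le_trans (mean_abs_clin _))//.
rewrite le_eqVlt; apply/orP; left; apply/eqP; congr Num.sqrt.
by apply: eq_bigr => i _; rewrite -exprM.
Qed.

(** A Gamma variable is nonnegative only almost surely, while the tail bound for ratios dominates
    pointwise and therefore works with absolute values. *)
Lemma Rintegral_norm_gamma j : \int[Q]_w `|Y j w| = a j.
Proof.
rewrite -[RHS]Rintegral_gamma /Rintegral; congr fine.
have mYj : measurable_fun setT (EFin \o Y j) by exact/measurable_EFinP.
apply: ae_eq_integral => //.
  by apply/measurable_EFinP; apply: measurableT_comp.
exists (Y j @^-1` `]-oo, 0[); split.
- by rewrite -[X in measurable X]setTI; exact: measurable_funPT.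
- exact: (gamma_law_lt0 (@YE j)).
- move=> w /= h; rewrite in_itv/= ltNge; apply/negP => Y0.
  by apply: h => _; rewrite ger0_norm.
Qed.

End GammaForms.

(** * The Stein equation of the normal law *)

Section NormalStein.
Context (R : realType) (sigma : R) (h : R -> R).
Hypotheses (sigma_gt0 : 0 < sigma) (ch : continuous h) (h_le1 : forall u, `|h u| <= 1).
Local Notation mu := (@lebesgue_measure R).

Let p : R -> R := normal_pdf 0 sigma.

Let pE u : p u = normal_peak sigma * expR (- (u ^+ 2 / (2 * sigma ^+ 2))).
Proof.
rewrite /p normal_pdfE ?gt_eqF// /normal_fun subr0; congr (_ * expR _).
by rewrite mulNr -mulr_natl.
Qed.

Let p_gt0 u : 0 < p u.
Proof. by rewrite pE mulr_gt0 ?expR_gt0// normal_peak_gt0// gt_eqF. Qed.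

Let p_ge0 u : 0 <= p u. Proof. exact: ltW. Qed.

Let cp : continuous p.
Proof. by apply: continuous_normal_pdf; rewrite gt_eqF. Qed.

Let mp : measurable_fun setT p. Proof. exact: measurable_normal_pdf. Qed.

Let dp (u : R) : is_derive u 1 p (- (u / sigma ^+ 2) * p u).
Proof.
have -> : p = (fun u => normal_peak sigma * expR (- (u ^+ 2 / (2 * sigma ^+ 2)))).
  by apply/funext => v; exact: pE.
apply: is_derive_eq; rewrite ?scaler0 ?addr0 ?add0r /GRing.scale/= ?mulr1 ?mulr0 ?addr0 ?add0r ?expr1.
by field; rewrite gt_eqF.
Qed.

Let c := \int[normal_prob 0 sigma]_u h u.

Let hc u := h u - c.

Let mh : measurable_fun setT h. Proof. exact: continuous_measurable_fun. Qed.

Let hint (g : R -> R) (C : R) : measurable_fun setT g -> (forall u, `|g u| <= C) ->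
  mu.-integrable setT (fun u => (g u * p u)%:E).
Proof.
move=> mg gC.
apply: (@le_integrable _ _ _ mu setT measurableT _ (fun u => C%:E * (p u)%:E)%E).
- by apply/measurable_EFinP; exact: measurable_funM.
- move=> u _ /=; rewrite lee_fin !normrM ler_pM//.
  exact: le_trans (ler_norm _).
- by apply: integrableZl => //; exact: integrable_normal_pdf.
Qed.

Lemma Rintegral_normal (g : R -> R) : measurable_fun setT g ->
  \int[normal_prob 0 sigma]_u g u = \int[mu]_u (g u * p u).
Proof.
move=> mg; rewrite /Rintegral; congr fine.
apply: (@integral_density _ (measurableTypeR R) R (normal_prob 0 sigma) mu setT p) => //.
- by move=> A mA; rewrite setIT.
- exact/measurable_EFinP.
Qed.

Let norm_c : `|c| <= 1.
Proof.
have ih : (normal_prob 0 sigma).-integrable setT (EFin \o h).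
  apply: (@le_integrable _ _ _ _ setT measurableT _ (cst 1%:E)).
  - exact/measurable_EFinP.
  - by move=> u _ /=; rewrite lee_fin normr1 h_le1.
  - exact: finite_measure_integrable_cst.
apply: (le_trans (le_normr_Rintegral _ ih)) => //.
apply: (@le_trans _ _ (\int[normal_prob 0 sigma]_u 1)).
  apply: le_Rintegral => //; first exact: (integrable_norm ih).
  exact: finite_measure_integrable_cst.
by rewrite (Rintegral_prob_cst (normal_prob 0 sigma)).
Qed.

Let mhc : measurable_fun setT hc. Proof. exact: measurable_funB. Qed.

Let hc_le u : `|hc u| <= 2.
Proof. by rewrite (le_trans (ler_normB _ _))// -[2]/(1 + 1) lerD. Qed.

Let f u := hc u * p u.

Let if_ : mu.-integrable setT (EFin \o f). Proof. exact: (hint mhc hc_le). Qed.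

Let int_f : \int[mu]_u f u = 0.
Proof.
rewrite /f -Rintegral_normal// /hc RintegralB//.
- by rewrite (Rintegral_prob_cst (normal_prob 0 sigma)) subrr.
- apply: (@le_integrable _ _ _ _ setT measurableT _ (cst 1%:E)).
  + exact/measurable_EFinP.
  + by move=> u _ /=; rewrite lee_fin normr1 h_le1.
  + exact: finite_measure_integrable_cst.
- exact: finite_measure_integrable_cst.
Qed.

Let cf : continuous f.
Proof.
move=> u; apply: continuousM; last exact: cp.
by apply: continuousB; [exact: ch|exact: cst_continuous].
Qed.

(** Antiderivative of [(h - c) p], where [c] is the normal mean of [h]. Because the total integral
    vanishes, [F] is also minus the right tail integral, so that each side of 0 can be estimated by
    its own tail. *)
Let F w := \int[mu]_(u in `]-oo, w]) f u.

Let dF (w : R) : is_derive w 1 F (f w).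
Proof.
have w1 : w < w + 1 by rewrite ltrDl.
have i1 : mu.-integrable [set` Interval -oo%O (BRight (w + 1))] (EFin \o f).
  exact: integrableS if_.
have [d1 d2] : derivable F w 1 /\ (F^`())%classic w = f w.
  apply: (continuous_FTC1 w1 i1); last exact: cf.
  by rewrite ltNyr.
by apply: DeriveDef; [exact: d1|rewrite -derive1E].
Qed.

Let F_compl w : F w = - \int[mu]_(u in `]w, +oo[) f u.
Proof.
have e : `]-oo, w] `|` `]w, +oo[ = [set: R].
  by apply/seteqP; split => // u _ /=; rewrite !in_itv/= andbT; have [|] := leP u w; [left|right].
apply/eqP; rewrite -addr_eq0 -Rintegral_setU//=.
- by rewrite e int_f.
- by rewrite e.
- apply/disj_setPRL => u /=; rewrite !in_itv/= andbT => wu.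
  by apply/negP; rewrite -ltNge.
Qed.

(** Mills' ratio: [w <= u] on the tail, and [u p(u)] has the antiderivative [- sigma^2 p]. *)
Let tail_pos w : 0 <= w -> (w%:E * \int[mu]_(u in `]w, +oo[) (p u)%:E <= (sigma ^+ 2 * p w)%:E)%E.
Proof.
move=> w0.
apply: (@le_trans _ _ (\int[mu]_(u in `[w, +oo[) (u * p u)%:E)%E).
  rewrite -ge0_integralZl//.
  - apply: (@le_trans _ _ (\int[mu]_(u in `]w, +oo[) (u * p u)%:E)%E).
      apply: ge0_le_integral => //.
      + by move=> u _; rewrite -EFinM lee_fin mulr_ge0.
      + apply/measurable_EFinP; apply: measurable_funTS.
        exact: measurable_funM.
      + apply/measurable_EFinP; apply: measurable_funTS.
        exact: measurable_funM.
      + move=> u /=; rewrite in_itv/= andbT => wu.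
        by rewrite -EFinM lee_fin ler_wpM2r// ltW.
    apply: ge0_subset_integral => //.
    + apply/measurable_EFinP; apply: measurable_funTS.
      exact: measurable_funM.
    + move=> u /=; rewrite in_itv/= andbT => wu.
      by rewrite lee_fin mulr_ge0// (le_trans w0).
    + by apply: subset_itvr; rewrite bnd_simp.
  - by apply/measurable_EFinP; exact: measurable_funTS.
  - by move=> u _; rewrite lee_fin.
apply: (@ge0_integral_exhaustion_FTC2 R _ (fun=> w) (fun n => w + n.+1%:R)
  (fun u => - sigma ^+ 2 * p u)) => //.
- by move=> n; rewrite ltrDl.
- by move=> n; apply: subset_itvl.
- move=> u /=; rewrite in_itv/= andbT => wu; near=> n; rewrite wu/=.
  rewrite -lerBlDl (@le_trans _ _ n%:R) ?ler_nat//.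
  by near: n; exact: nbhs_infty_ger.
- move=> u _; have := dp u => dpu; apply: is_derive_eq.
  by rewrite /GRing.scale/=; field; rewrite gt_eqF.
- by move=> u _; apply: continuousM => //; exact: cp.
- by apply: measurable_funTS; exact: measurable_funM.
- move=> u /=; rewrite in_itv/= andbT => wu.
  by rewrite mulr_ge0// (le_trans w0).
- move=> n; rewrite !mulNr opprK addrC lerBlDr lerDl.
  by rewrite mulr_ge0// sqr_ge0.
Unshelve. all: by end_near. Qed.

Let tail_neg w : w <= 0 -> ((- w)%:E * \int[mu]_(u in `]-oo, w]) (p u)%:E <= (sigma ^+ 2 * p w)%:E)%E.
Proof.
move=> w0.
apply: (@le_trans _ _ (\int[mu]_(u in `]-oo, w]) (- u * p u)%:E)%E).
  rewrite -ge0_integralZl//.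
  - apply: ge0_le_integral => //.
    + by move=> u _; rewrite -EFinM lee_fin mulr_ge0// oppr_ge0.
    + apply/measurable_EFinP; apply: measurable_funTS.
      exact: measurable_funM.
    + apply/measurable_EFinP; apply: measurable_funTS.
      by apply: measurable_funM.
    + move=> u /=; rewrite in_itv/= => wu.
      by rewrite -EFinM lee_fin ler_wpM2r// lerN2.
  - by apply/measurable_EFinP; exact: measurable_funTS.
  - by move=> u _; rewrite lee_fin.
  - by rewrite lee_fin oppr_ge0.
apply: (@ge0_integral_exhaustion_FTC2 R _ (fun n => w - n.+1%:R) (fun=> w)
  (fun u => sigma ^+ 2 * p u)) => //.
- by move=> n; rewrite ltrBlDr ltrDl.
- by move=> n; apply: subset_itvr.
- move=> u /=; rewrite in_itv/= => uw; near=> n; rewrite uw andbT.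
  rewrite lerBlDr -lerBlDl (@le_trans _ _ n%:R) ?ler_nat//.
  by near: n; exact: nbhs_infty_ger.
- move=> u _; have := dp u => dpu; apply: is_derive_eq.
  by rewrite /GRing.scale/=; field; rewrite gt_eqF.
- move=> u _; apply: continuousM; last exact: cp.
  exact: continuousN.
- by apply: measurable_funTS; apply: measurable_funM.
- move=> u /=; rewrite in_itv/= => uw.
  by rewrite mulr_ge0// oppr_ge0 (le_trans uw).
- move=> n; rewrite lerBlDr lerDl.
  by rewrite mulr_ge0// sqr_ge0.
Unshelve. all: by end_near. Qed.

Let int_f_le (D : set R) (v C : R) : measurable (D : set (measurableTypeR R)) -> 0 <= v ->
  (v%:E * \int[mu]_(u in D) (p u)%:E <= C%:E)%E ->
  v * `|\int[mu]_(u in D) f u| <= 2 * C.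
Proof.
move=> mD v0 vC.
have ip : mu.-integrable D (EFin \o p).
  by apply: (@integrableS _ _ _ mu setT) => //; exact: integrable_normal_pdf.
have ifD : mu.-integrable D (EFin \o f) by apply: integrableS if_.
have pf := integrable_fin_num mD ip.
have h1 : v * \int[mu]_(u in D) p u <= C.
  by move: vC; rewrite -[X in (_ * X <= _)%E](fineK pf) -EFinM lee_fin.
apply: (@le_trans _ _ (v * (2 * \int[mu]_(u in D) p u))); last by rewrite mulrCA ler_pM2l.
rewrite ler_wpM2l// (le_trans (le_normr_Rintegral mD ifD))// -RintegralZl//.
apply: le_Rintegral => //.
- exact: (integrable_norm ifD).
- exact: (integrableZl mD 2 ip).
- by move=> u _; rewrite /f normrM (ger0_norm (p_ge0 u)) ler_wpM2r.
Qed.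

(** The classical solution of the Stein equation. Its derivative is defined by solving that equation
    for it, which leaves only the quotient rule to check. *)
Let phi w := F w / (sigma ^+ 2 * p w).
Let dphi w := (hc w + w * phi w) / sigma ^+ 2.

Let norm_phi w : `|w * phi w| <= 2.
Proof.
have sp : 0 < sigma ^+ 2 * p w by rewrite mulr_gt0// exprn_gt0.
rewrite /phi mulrA normrM normfV (gtr0_norm sp) ler_pdivrMr// normrM.
have [w0|w0] := leP 0 w.
  rewrite ger0_norm// F_compl normrN; apply: int_f_le => //.
  exact: tail_pos.
rewrite ltr0_norm//; apply: int_f_le => //; first by rewrite oppr_ge0 ltW.
by apply: tail_neg; exact: ltW.
Qed.

Let dphiP (w : R) : is_derive w 1 phi (dphi w).
Proof.
have pw0 := lt0r_neq0 (p_gt0 w).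
have sn0 : sigma != 0 by rewrite gt_eqF.
have ds : is_derive w 1 (fun w => sigma ^+ 2 * p w) (- (w * p w)).
  have := dp w => dpw; apply: is_derive_eq.
  by rewrite /GRing.scale/=; field.
have sp : sigma ^+ 2 * p w != 0 by rewrite mulf_neq0// expf_neq0.
have dV := is_deriveV (f := fun w => sigma ^+ 2 * p w) sp ds.
have dFw := dF w.
apply: is_derive_eq; rewrite /dphi /phi /f /GRing.scale/=.
move: (F w) (hc w) (p w) pw0 => x y z z0.
by field; rewrite sn0 z0.
Qed.

(** The constant 4 is [2 + 2]: [h] minus its mean is at most 2 in absolute value, and so is
    [u phi(u)] by Mills' ratio on both tails. *)
Lemma normal_stein_solution : exists phi dphi : R -> R,
  [/\ forall u : R, is_derive u 1 phi (dphi u), continuous dphi,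
      forall u, `|dphi u| <= 4 / sigma ^+ 2 &
      forall u, sigma ^+ 2 * dphi u - u * phi u = h u - \int[normal_prob 0 sigma]_u h u].
Proof.
have sn0 : sigma != 0 by rewrite gt_eqF.
exists phi, dphi; split.
- exact: dphiP.
- have cphi : continuous phi.
    move=> w; have := dphiP w => dw.
    by apply/differentiable_continuous/derivable1_diffP; exact: ex_derive.
  move=> w; apply: (@continuousM R R (fun w => hc w + w * phi w) (fun=> (sigma ^+ 2)^-1));
    last exact: cst_continuous.
  apply: continuousD; last by apply: continuousM => //; exact: cphi.
  by apply: continuousB; [exact: ch|exact: cst_continuous].
- move=> u; rewrite /dphi normrM normfV (ger0_norm (sqr_ge0 sigma)).
  rewrite ler_pM2r ?invr_gt0 ?exprn_gt0// (le_trans (ler_normD _ _))//.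
  by rewrite -[4]/(2 + 2)%:R natrD lerD.
- move=> u; rewrite /dphi /hc -/c; move: (phi u) (h u) c => x y z.
  by field.
Qed.

End NormalStein.

(** * Ratios of Gamma forms *)

(** The identity [x^-1 = x (x^2)^-1] holds at 0 too because [0^-1 = 0], and it reduces inversion to
    a power function of a nonnegative argument. *)
Lemma measurable_invr (R : realType) : measurable_fun setT (@GRing.inv R).
Proof.
have -> : @GRing.inv R = (fun x => x * (x ^+ 2) `^ (-1)).
  apply/funext => x; rewrite powR_inv1 ?sqr_ge0//.
  by have [->|x0] := eqVneq x 0; [rewrite invr0 mul0r|field].
apply: measurable_funM => //.
by apply: (measurableT_comp (measurable_powR (-1))); exact: measurable_funX.
Qed.

(** * Bounded Lipschitz test functions *)

Section BoundedLipschitz.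
Context (R : realType) (f : R -> R).
Hypothesis fBL : BL1 f.

Lemma BL1_continuous : continuous f.
Proof.
move=> u; apply/cvgrPdist_lt => e e0; near=> v.
by apply: le_lt_trans (fBL.2 _ _) _; near: v; exact: cvgr_dist_lt.
Unshelve. all: by end_near. Qed.

Lemma BL1_measurable : measurable_fun setT f.
Proof. by apply: continuous_measurable_fun; exact: BL1_continuous. Qed.

Context d (W : measurableType d) (Q : probability W R).

Lemma BL1_integrable (X : W -> R) : measurable_fun setT X ->
  Q.-integrable setT (EFin \o (fun w => f (X w))).
Proof.
move=> mX; apply: (@le_integrable _ _ _ _ setT measurableT _ (cst 1%:E)).
- by apply/measurable_EFinP; apply: measurableT_comp => //; exact: BL1_measurable.
- by move=> w _ /=; rewrite lee_fin normr1; exact: fBL.1.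
- exact: finite_measure_integrable_cst.
Qed.

Lemma BL1_distance (X X' D : W -> R) : measurable_fun setT X -> measurable_fun setT X' ->
  Q.-integrable setT (EFin \o D) -> (forall w, `|f (X w) - f (X' w)| <= D w) ->
  `|\int[Q]_w f (X w) - \int[Q]_w f (X' w)| <= \int[Q]_w D w.
Proof.
move=> mX mX' iD XD.
have i1 := BL1_integrable mX; have i2 := BL1_integrable mX'.
have iB : Q.-integrable setT (EFin \o (fun w => f (X w) - f (X' w))).
  exact: (integrableB measurableT i1 i2).
rewrite -RintegralB// (le_trans (le_normr_Rintegral _ iB))//.
by apply: le_Rintegral => //; exact: (integrable_norm iB).
Qed.

End BoundedLipschitz.

Lemma le_measure_Rintegral d (W : measurableType d) (R : realType)
    (Q : {measure set W -> \bar R}) (E : set W) (D : W -> R) : measurable E ->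
  Q.-integrable setT (EFin \o D) -> (forall w, 0 <= D w) -> (forall w, E w -> 1 <= D w) ->
  (Q E <= (\int[Q]_w D w)%:E)%E.
Proof.
move=> mE iD D0 ED; rewrite /Rintegral fineK; last exact: integrable_fin_num.
rewrite -[X in (Q X <= _)%E]setIT -integral_indic//.
apply: ge0_le_integral => //.
- by apply/measurable_EFinP.
- exact: measurable_int iD.
- move=> w _ /=; rewrite lee_fin indicE; case: (boolP (w \in E)) => [/[!inE] Ew|_] //.
  exact: ED.
Qed.

Section GammaSlutsky.
Context d (W : measurableType d) (R : realType) (Q : probability W R) (k : nat)
  (Y : 'I_k -> {RV Q >-> R}) (a : 'I_k -> R).
Hypotheses (indY : mutually_independent Q Y) (a_ge0 : forall i, 0 <= a i)
  (YE : forall i B, measurable B -> distribution Q (Y i) B = gamma_law (a i) B).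
Let A := \sum_i a i.
Hypothesis A_gt0 : 0 < A.
Let S := lin Y (fun=> 1).

Let sS : sq_integrable Q (fun w => S w - A).
Proof.
apply: sq_integrableB; last exact: sq_integrable_cst.
exact: (sq_integrable_lin a_ge0 YE).
Qed.

Let SE w : S w - A = clin Y a (fun=> 1) w.
Proof. by rewrite clinE /A; congr (_ - _); apply: eq_bigr => i _; rewrite mul1r. Qed.

Lemma variance_total : \int[Q]_w ((S w - A) ^+ 2) = A.
Proof.
transitivity (\int[Q]_w (clin Y a (fun=> 1) w ^+ 2)).
  by apply: eq_Rintegral => w _; rewrite SE.
rewrite (variance_clin indY a_ge0 YE).
by apply: eq_bigr => i _; rewrite expr1n mul1r.
Qed.

Section Numerator.
Context (c : 'I_k -> R) (r : R).
(** [dd] are the coefficients of the form obtained when the denominator [S] is frozen at its mean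
    [A]; [b] is the mean of that form. *)
Let kap := r / A.
Let dd i := kap * c i.
Let b := \sum_i dd i * a i.
Let V2 := \sum_i dd i ^+ 2 * a i.
Let V4 := \sum_i dd i ^+ 4 * a i.

Let mlin c' : measurable_fun setT (lin Y c').
Proof. by have [] := sq_integrable_lin a_ge0 YE c'. Qed.

Let mX : measurable_fun setT (fun w => r * (lin Y c w / S w)).
Proof.
apply: measurable_funM => //; apply: measurable_funM; first exact: mlin.
apply: measurableT_comp; last exact: mlin.
exact: measurable_invr.
Qed.

Let sclin : sq_integrable Q (clin Y a dd).
Proof. exact: (sq_integrable_clin a_ge0 YE). Qed.

(** If [|S - A| >= eta A], the difference is at most 2, and Chebyshev's inequality with variance [A]
    gives [2 / (eta^2 A)]. Otherwise [S >= A / 2], and the exact error is [lin dd (A - S) / S + b]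
    with [|(A - S) / S| <= 2 eta]. *)
Lemma gamma_ratio_replace (f : R -> R) (eta : R) : BL1 f -> 0 < eta -> eta <= 1 / 2 ->
  `|\int[Q]_w f (r * (lin Y c w / S w)) - \int[Q]_w f (clin Y a dd w)| <=
  2 / (eta ^+ 2 * A) + 2 * eta * (Num.sqrt V2 + `|b|) + `|b|.
Proof.
move=> fBL eta0 eta12.
have [mcl icl] := sclin.
have iS := sS.2.
have iac : Q.-integrable setT (EFin \o (fun w => `|clin Y a dd w|)).
  by apply: integrable_norm; exact: sq_integrable_integrable.
set B0 := 2 * eta * `|b| + `|b|.
pose D w := 2 / (eta * A) ^+ 2 * (S w - A) ^+ 2 + (2 * eta * `|clin Y a dd w| + B0).
have iD1 : Q.-integrable setT (EFin \o (fun w => 2 / (eta * A) ^+ 2 * (S w - A) ^+ 2)).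
  exact: (integrableZl measurableT _ iS).
have iD2 : Q.-integrable setT (EFin \o (fun w => 2 * eta * `|clin Y a dd w|)).
  exact: (integrableZl measurableT _ iac).
have iD3 : Q.-integrable setT (EFin \o (fun w => 2 * eta * `|clin Y a dd w| + B0)).
  exact: (integrableD measurableT iD2 (finite_measure_integrable_cst Q B0 measurableT)).
have iD : Q.-integrable setT (EFin \o D) by exact: (integrableD measurableT iD1 iD3).
have eA : 0 < eta * A by rewrite mulr_gt0.
have h w : `|f (r * (lin Y c w / S w)) - f (clin Y a dd w)| <= D w.
  have D2 : 0 <= 2 * eta * `|clin Y a dd w| + B0.
    by rewrite !addr_ge0// ?mulr_ge0// ltW.
  have D1 : 0 <= 2 / (eta * A) ^+ 2 * (S w - A) ^+ 2.
    by rewrite mulr_ge0 ?sqr_ge0// divr_ge0// sqr_ge0.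
  have [far|close] := leP (eta * A) `|S w - A|.
    apply: (@le_trans _ _ 2).
      rewrite (le_trans (ler_normB _ _))// -[2]/(1 + 1) lerD//; exact: fBL.1.
    apply: (@le_trans _ _ (2 / (eta * A) ^+ 2 * (S w - A) ^+ 2)); last by rewrite lerDl.
    rewrite -mulrA ler_peMr// mulrC ler_pdivlMr ?exprn_gt0// mul1r.
    by rewrite -(real_normK (num_real (S w - A))) ler_sqr// nnegrE// ltW.
  apply: (le_trans (fBL.2 _ _)).
  apply: (@le_trans _ _ (2 * eta * `|clin Y a dd w| + B0)); last by rewrite lerDr.
  have Spos : A / 2 <= S w.
    have := ler_normlW (ltW close).
    move: close; rewrite ltr_norml => /andP[+ _].
    have : eta * A <= 1 / 2 * A by rewrite ler_pM2r.
    by lra.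
  have S0 : 0 < S w by apply: lt_le_trans Spos; rewrite divr_gt0.
  have linE : lin Y dd w = clin Y a dd w + b by rewrite clinE -/b subrK.
  have linE' : lin Y dd w = kap * lin Y c w.
    by rewrite /lin mulr_sumr; apply: eq_bigr => i _; rewrite mulrA.
  have -> : r * (lin Y c w / S w) - clin Y a dd w = lin Y dd w * ((A - S w) / S w) + b.
    have -> : clin Y a dd w = lin Y dd w - b by rewrite linE addrK.
    rewrite linE' /kap; field.
    by rewrite (gt_eqF A_gt0) (gt_eqF S0).
  have q : `|(A - S w) / S w| <= 2 * eta.
    rewrite normrM normfV (gtr0_norm S0) ler_pdivrMr// distrC.
    rewrite (le_trans (ltW close))//.
    have := ler_wpM2l (ltW eta0) Spos; lra.
  rewrite (le_trans (ler_normD _ _))// /B0 addrA lerD2r normrM.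
  rewrite (le_trans (ler_wpM2l _ q))// mulrC -mulrDr ler_wpM2l ?mulr_ge0 ?(ltW eta0)//.
  by rewrite linE ler_normD.
apply: (le_trans (BL1_distance fBL mX mcl iD h)).
rewrite /D RintegralD// RintegralZl// variance_total RintegralD//; last first.
  exact: finite_measure_integrable_cst.
rewrite RintegralZl// Rintegral_prob_cst /B0 addrA mulrDr !addrA lerD2r lerD2r lerD//.
  by rewrite le_eqVlt; apply/orP; left; apply/eqP; field; rewrite (gt_eqF A_gt0) (gt_eqF eta0).
rewrite ler_wpM2l ?mulr_ge0 ?(ltW eta0)//.
exact: (mean_abs_clin indY a_ge0 YE).
Qed.

(** Stein's bound is of order [1 / v]. For [v = 0] the limit is a point mass, and the mean absolute
    value of the form bounds the distance. *)
Lemma gamma_clt (f : R -> R) (v : R) : BL1 f -> 0 <= v ->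
  `|\int[Q]_w f (clin Y a dd w) - \int[normal_law 0 v]_u f u| <=
  if v == 0 then Num.sqrt V2 else 4 / v * (`|v - V2| + Num.sqrt V4).
Proof.
move=> fBL v0; have [mcl icl] := sclin; case: ifPn => vz.
  have -> : \int[normal_law 0 v]_u f u = \int[Q]_w f 0.
    rewrite /normal_law vz Rintegral_prob_cst /Rintegral.
    rewrite (@integral_dirac _ (measurableTypeR R))//; last first.
      by apply/measurable_EFinP; exact: (BL1_measurable fBL).
    by rewrite diracT mul1e.
  have iac : Q.-integrable setT (EFin \o (fun w => `|clin Y a dd w|)).
    by apply: integrable_norm; exact: sq_integrable_integrable.
  apply: (@le_trans _ _ (\int[Q]_w `|clin Y a dd w|)).
    apply: (BL1_distance (X' := fun=> 0) fBL mcl _ iac) => // w.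
    by rewrite (le_trans (fBL.2 _ _))// subr0.
  exact: (mean_abs_clin indY a_ge0 YE).
have vpos : 0 < v by rewrite lt_neqAle eq_sym vz.
have s0 : 0 < Num.sqrt v by rewrite sqrtr_gt0.
have [phi [dphi [h1 h2 h3 h4]]] := normal_stein_solution s0 (BL1_continuous fBL) fBL.1.
rewrite /normal_law (negbTE vz) sqr_sqrtr// in h3 h4 *.
have ifc := @BL1_integrable R f fBL _ _ Q _ mcl.
have -> : \int[Q]_w f (clin Y a dd w) - \int[normal_prob 0 (Num.sqrt v)]_u f u =
    \int[Q]_w (v * dphi (clin Y a dd w) - clin Y a dd w * phi (clin Y a dd w)).
  transitivity (\int[Q]_w (f (clin Y a dd w) - \int[normal_prob 0 (Num.sqrt v)]_u f u)).
    rewrite RintegralB//; last exact: finite_measure_integrable_cst.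
    by rewrite Rintegral_prob_cst.
  by apply: eq_Rintegral => w _; rewrite h4.
exact: (stein_discrepancy indY a_ge0 YE _ _ h1 h2 h3).
Qed.

End Numerator.

(** A ratio above [2 lam / A] forces [|S - A| >= A / 2], where Chebyshev's inequality gives [4 / A],
    or a numerator of at least [lam], where Markov's inequality applies. *)
Lemma gamma_ratio_tail (c : 'I_k -> R) (lam : R) : (forall i, 0 <= c i) -> 0 < lam ->
  (Q [set w | (2 * lam / A < lin Y c w / S w)%R] <=
   (4 / A + (\sum_i c i * a i) / lam)%:E)%E.
Proof.
move=> c0 lam0.
have mlin c' : measurable_fun setT (lin Y c') by have [] := sq_integrable_lin a_ge0 YE c'.
pose T w := \sum_i c i * `|Y i w|.
have iY i : Q.-integrable setT (EFin \o (fun w => `|Y i w|)).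
  by apply: integrable_norm; apply: sq_integrable_integrable; exact: (sq_integrable_gamma a_ge0 YE).
have icY i : Q.-integrable setT (EFin \o (fun w => c i * `|Y i w|)).
  exact: (integrableZl measurableT _ (iY i)).
have iT : Q.-integrable setT (EFin \o T).
  have := @integrable_sum _ _ _ Q setT measurableT _ (index_enum 'I_k) xpredT
    (fun i => EFin \o (fun w => c i * `|Y i w|)) (fun i _ => icY i).
  by apply: eq_integrable => // w _ /=; rewrite sumEFin.
have iS := sS.2.
pose D w := 4 / A ^+ 2 * (S w - A) ^+ 2 + lam^-1 * T w.
have iD1 : Q.-integrable setT (EFin \o (fun w => 4 / A ^+ 2 * (S w - A) ^+ 2)).
  exact: (integrableZl measurableT _ iS).
have iD2 : Q.-integrable setT (EFin \o (fun w => lam^-1 * T w)).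
  exact: (integrableZl measurableT _ iT).
have iD : Q.-integrable setT (EFin \o D) by exact: (integrableD measurableT iD1 iD2).
set E := [set w | _].
have mE : measurable E.
  rewrite -[E]setTI; apply: measurable_fun_ltr => //.
  apply: measurable_funM; first exact: mlin.
  by apply: measurableT_comp; [exact: measurable_invr|exact: mlin].
have -> : 4 / A + (\sum_i c i * a i) / lam = \int[Q]_w D w.
  rewrite RintegralD// !RintegralZl// variance_total Rintegral_sum//.
  congr (_ + _); first by field; rewrite (gt_eqF A_gt0).
  rewrite mulrC; congr (_ * _); apply: eq_bigr => i _.
  by rewrite RintegralZl// (Rintegral_norm_gamma indY a_ge0 YE).
have T0 w : 0 <= T w by apply: sumr_ge0 => i _; rewrite mulr_ge0.
have D0 w : 0 <= D w.
  rewrite addr_ge0// mulr_ge0 ?sqr_ge0// ?invr_ge0 ?(ltW lam0)//.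
  by rewrite divr_ge0// sqr_ge0.
apply: le_measure_Rintegral => // w Ew; rewrite /D.
have [far|close] := leP (A / 2) `|S w - A|.
  apply: (@le_trans _ _ (4 / A ^+ 2 * (S w - A) ^+ 2)); last first.
    by rewrite lerDl mulr_ge0// invr_ge0 ltW.
  rewrite mulrAC ler_pdivlMr ?exprn_gt0// mul1r.
  rewrite -(real_normK (num_real (S w - A))).
  have : (A / 2) ^+ 2 <= `|S w - A| ^+ 2 by rewrite ler_sqr// nnegrE// divr_ge0// ltW.
  by rewrite exprMn; lra.
have Spos : A / 2 <= S w by move: close; rewrite ltr_norml => /andP[+ _]; lra.
have S0 : 0 < S w by apply: lt_le_trans Spos; rewrite divr_gt0.
apply: (@le_trans _ _ (lam^-1 * T w)); last first.
  by rewrite lerDr mulr_ge0 ?sqr_ge0// divr_ge0// sqr_ge0.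
rewrite mulrC ler_pdivlMr// mul1r.
have LT : lin Y c w <= T w by apply: ler_sum => i _; rewrite ler_wpM2l// ler_norm.
apply: le_trans LT; move: Ew; rewrite /E/= ltr_pdivlMr// => /ltW; apply: le_trans.
have e : lam = 2 * lam / A * (A / 2) by field; rewrite (gt_eqF A_gt0).
rewrite [leLHS]e.
by rewrite ler_wpM2l// divr_ge0 ?mulr_ge0 ?(ltW lam0)// ltW.
Qed.

End GammaSlutsky.

(** * Integrals of step functions under the Dirichlet process *)

Section StepFunctions.
Context (R : realType).

(** A step function is encoded as [c (psi t)], where [psi] labels the cells of a finite partition by
    [0, ..., k - 1]; functions with different values [c] can then share one partition. *)
Lemma Rintegral_step (m : {finite_measure set R -> \bar R}) (psi : R -> nat) (k : nat)
    (c : nat -> R) :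
  (forall j, measurable (psi @^-1` [set j])) -> (forall t, (psi t < k)%N) ->
  \int[m]_t c (psi t) = \sum_(j < k) c j * fine (m (psi @^-1` [set (j : nat)])).
Proof.
move=> mpsi psik.
have iind (j : 'I_k) : m.-integrable setT (EFin \o \1_(psi @^-1` [set (j : nat)])).
  exact: integrable_indic.
transitivity (\int[m]_t (\sum_(j < k) c j * \1_(psi @^-1` [set (j : nat)]) t)).
  apply: eq_Rintegral => t _.
  rewrite (bigD1 (Ordinal (psik t)))//= indicE mem_set// mulr1.
  rewrite big1 ?addr0// => j jt; rewrite indicE memNset ?mulr0//= => e.
  by move: jt; rewrite -val_eqE /= e eqxx.
rewrite Rintegral_sum; last first.
  by move=> j _; exact: (integrableZl measurableT (c j) (iind j)).
apply: eq_bigr => j _; rewrite RintegralZl//; congr (_ * _).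
by rewrite /Rintegral integral_indic// setIT.
Qed.

Lemma measurable_pprobability_ev (B : set R) : measurable B ->
  measurable_fun setT (fun G : pprobability R R => fine (G B)).
Proof.
move=> mB; apply: (measurableT_comp (fine_measurable measurableT)).
have mid : measurable_fun setT (@id (pprobability R R)) by exact: measurable_id.
exact: (measurable_kernel (kprobability mid) B mB).
Qed.

Lemma measurable_pprobability_step (psi : R -> nat) (k : nat) (c : nat -> R) :
  (forall j, measurable (psi @^-1` [set j])) -> (forall t, (psi t < k)%N) ->
  measurable_fun setT (fun G : pprobability R R => \int[G : probability R R]_t c (psi t)).
Proof.
move=> mpsi psik; under eq_fun do rewrite (Rintegral_step _ c mpsi psik).
apply: measurable_sum => j; apply: measurable_funM => //.
exact: measurable_pprobability_ev.
Qed.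

End StepFunctions.

Section DirichletStep.
Context (R : realType) (base : {measure set R -> \bar R})
  (D : probability (pprobability R R) R) (psi : R -> nat) (k : nat).
Hypotheses (HD : dirichlet_process base D)
  (mpsi : forall j, measurable (psi @^-1` [set j])) (psik : forall t, (psi t < k)%N).
Let a (i : 'I_k) := fine (base (psi @^-1` [set (i : nat)])).

(** The cells of [psi] form a finite measurable partition, and integrating a step function is linear
    in the vector of cell masses; normalising the Gamma variables makes the integral a quotient of
    two linear forms. The Gamma variables come before [c], so they serve all step functions on the
    partition. *)
Lemma dirichlet_step_law :
  exists d' (W : measurableType d') (Q : probability W R) (Y : 'I_k -> {RV Q >-> R}),
  [/\ mutually_independent Q Y,
      (forall i B, measurable B -> distribution Q (Y i) B = gamma_law (a i) B) &
      forall (c : nat -> R) (C : set R), measurable C ->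
        D [set G : pprobability R R | C (\int[G : probability R R]_t c (psi t))] =
        Q [set w | C (lin Y (fun i => c i) w / lin Y (fun=> 1) w)]].
Proof.
have triv : trivIset setT (fun i : 'I_k => psi @^-1` [set (i : nat)]).
  apply/trivIsetP => i j _ _ ij; apply/seteqP; split => // t [/= ti tj].
  by move: ij; rewrite -val_eqE /= -ti -tj eqxx.
have cover : \bigcup_(i : 'I_k) (psi @^-1` [set (i : nat)]) = setT.
  by apply/seteqP; split => // t _; exists (Ordinal (psik t)).
have [d' [W [Q [Y [indY YE law]]]]] := HD (fun i => mpsi i) triv cover.
exists d', W, Q, Y; split => // c C mC.
pose B : set (k.-tuple R) := [set t | C (\sum_(i < k) c i * tnth t i)].
have mB : measurable B.
  rewrite -[B]setTI.
  have mg : measurable_fun setT (fun t : k.-tuple R => \sum_(i < k) c i * tnth t i).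
    by apply: measurable_sum => i; apply: measurable_funM => //; exact: measurable_tnth.
  exact: mg.
have := law B mB.
have -> : [set G : pprobability R R | B [tuple fine (G (psi @^-1` [set (i : nat)])) | i < k]] =
    [set G : pprobability R R | C (\int[G : probability R R]_t c (psi t))].
  apply/seteqP; split => G; rewrite /B /= (Rintegral_step _ _ mpsi psik);
  by under eq_bigr do rewrite tnth_mktuple.
have -> : [set w | B [tuple Y i w / \sum_(j < k) Y j w | i < k]] =
    [set w | C (lin Y (fun i => c i) w / lin Y (fun=> 1) w)].
  have e w : \sum_(i < k) c i * tnth [tuple Y i w / \sum_(j < k) Y j w | i < k] i =
      lin Y (fun i => c i) w / lin Y (fun=> 1) w.
    rewrite /lin mulr_suml.
    have -> : \sum_i 1 * Y i w = \sum_i Y i w by apply: eq_bigr => i _; rewrite mul1r.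
    by apply: eq_bigr => i _; rewrite tnth_mktuple mulrA.
  by apply/seteqP; split => w; rewrite /B /= e.
exact.
Qed.

Let A := \sum_i a i.
Hypothesis A_gt0 : 0 < A.

Let a_ge0 i : 0 <= a i. Proof. exact: fine_ge0. Qed.

Lemma dirichlet_step_tail (c : nat -> R) (lam : R) : (forall j, 0 <= c j) -> 0 < lam ->
  (D [set G : pprobability R R | (2 * lam / A < \int[G : probability R R]_t c (psi t))%R] <=
   (4 / A + (\sum_(i < k) c i * a i) / lam)%:E)%E.
Proof.
move=> c0 lam0; have [d' [W [Q [Y [indY YE law]]]]] := dirichlet_step_law.
have mC : measurable [set u : R | 2 * lam / A < u].
  by rewrite -set_itvoy; exact: measurable_itv.
have -> := law c _ mC.
exact: (gamma_ratio_tail indY a_ge0 YE A_gt0 (fun i => c0 i) lam0).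
Qed.

Lemma dirichlet_step_clt (c : nat -> R) (r eta v b V2 V4 : R) (f : R -> R) : BL1 f ->
  0 < eta -> eta <= 1 / 2 -> 0 <= v ->
  b = \sum_(i < k) r / A * c i * a i ->
  V2 = \sum_(i < k) (r / A * c i) ^+ 2 * a i ->
  V4 = \sum_(i < k) (r / A * c i) ^+ 4 * a i ->
  `|\int[D]_G f (r * \int[G : probability R R]_t c (psi t)) - \int[normal_law 0 v]_u f u| <=
  2 / (eta ^+ 2 * A) + 2 * eta * (Num.sqrt V2 + `|b|) + `|b| +
  (if v == 0 then Num.sqrt V2 else 4 / v * (`|v - V2| + Num.sqrt V4)).
Proof.
move=> fBL eta0 eta12 v0 -> -> ->.
have [d' [W [Q [Y [indY YE law]]]]] := dirichlet_step_law.
have mlin c' : measurable_fun setT (lin Y c').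
  by have [] := sq_integrable_lin a_ge0 YE c'.
have mratio : measurable_fun setT (fun w => lin Y (fun i => c i) w / lin Y (fun=> 1) w).
  apply: measurable_funM; first exact: mlin.
  by apply: measurableT_comp; [exact: measurable_invr|exact: mlin].
have mint := measurable_pprobability_step c mpsi psik.
pose g u := f (r * u).
have mg : measurable_fun setT g.
  by apply: (measurableT_comp (BL1_measurable fBL)); exact: measurable_funM.
have e : \int[D]_G f (r * \int[G : probability R R]_t c (psi t)) =
    \int[Q]_w f (r * (lin Y (fun i => c i) w / lin Y (fun=> 1) w)).
  rewrite /Rintegral; congr fine.
  transitivity (\int[distribution D (mfun_of mint)]_u (g u)%:E)%E.
    rewrite integral_distribution//; first exact/measurable_EFinP.
    exact: (@BL1_integrable R f fBL _ _ D _ (measurable_funM (@measurable_cst _ _ _ _ setT r) mint)).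
  transitivity (\int[distribution Q (mfun_of mratio)]_u (g u)%:E)%E.
    by apply: eq_measure_integral => C mC _; exact: (law c C mC).
  rewrite integral_distribution//; first exact/measurable_EFinP.
  exact: (@BL1_integrable R f fBL _ _ Q _ (measurable_funM (@measurable_cst _ _ _ _ setT r) mratio)).
rewrite e.
have h1 := gamma_ratio_replace indY a_ge0 YE A_gt0 (fun i : 'I_k => c i) r fBL eta0 eta12.
have h2 := gamma_clt indY a_ge0 YE (fun i : 'I_k => c i) r fBL v0.
set X1 := \int[Q]_w _; set X3 := \int[normal_law 0 v]_u f u.
apply: le_trans (ler_distD _ _ _) _; last apply: lerD.
- exact: h1.
- exact: h2.
Qed.

End DirichletStep.

(** * The posterior law *)

Lemma integrable_step (R : realType) (m : {finite_measure set R -> \bar R})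
    (psi : R -> nat) (k : nat) (c : nat -> R) :
  (forall j, measurable (psi @^-1` [set j])) -> (forall t, (psi t < k)%N) ->
  m.-integrable setT (EFin \o (fun t => c (psi t))).
Proof.
move=> mpsi psik.
have iind (j : 'I_k) : m.-integrable setT
    (EFin \o (fun t => c j * \1_(psi @^-1` [set (j : nat)]) t)).
  have ij : m.-integrable setT (EFin \o \1_(psi @^-1` [set (j : nat)])).
    exact: integrable_indic.
  exact: (integrableZl measurableT (c j) ij).
have := @integrable_sum _ _ _ m setT measurableT _ (index_enum 'I_k) xpredT
    (fun j => EFin \o (fun t => c j * \1_(psi @^-1` [set (j : nat)]) t)) (fun j _ => iind j).
apply: eq_integrable => // t _ /=; rewrite sumEFin; congr EFin.
rewrite (bigD1 (Ordinal (psik t)))//= indicE mem_set// mulr1.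
rewrite big1 ?addr0// => j jt; rewrite indicE memNset ?mulr0//= => e.
by move: jt; rewrite -val_eqE /= e eqxx.
Qed.

Section PosteriorBase.
Context (R : realType) (alpha : {finite_measure set R -> \bar R}) (z : nat -> R) (n : nat).
Hypothesis n_gt0 : (0 < n)%N.
Let base := posterior_base alpha z n.

Lemma posterior_baseE B : base B = (alpha B + \sum_(i < n) \d_(z i) B)%E.
Proof.
transitivity (alpha B + n%:R%:E * (n%:R^-1%:E * \sum_(i < n) \d_(z i) B))%E.
  exact: measure_addE.
by rewrite muleA -EFinM divff ?mul1e// pnatr_eq0 -lt0n.
Qed.

(** Bias, variance and fourth moment of the Gamma forms are sums over cells weighted by the base
    measure; this converts them into a prior integral and a sum over the data. *)
Lemma sum_posterior_base (psi : R -> nat) (k : nat) (g : nat -> R) :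
  (forall j, measurable (psi @^-1` [set j])) -> (forall t, (psi t < k)%N) ->
  \sum_(j < k) g j * fine (base (psi @^-1` [set (j : nat)])) =
  \int[alpha]_t g (psi t) + \sum_(i < n) g (psi (z i)).
Proof.
move=> mpsi psik; rewrite (Rintegral_step alpha g mpsi psik).
have -> : \sum_(i < n) g (psi (z i)) =
    \sum_(j < k) g j * \sum_(i < n) (psi (z i) == j)%:R.
  under [RHS]eq_bigr do rewrite mulr_sumr.
  rewrite exchange_big/=; apply: eq_bigr => i _.
  rewrite (bigD1 (Ordinal (psik (z i))))//= eqxx mulr1 big1 ?addr0// => j jt.
  rewrite (_ : (psi (z i) == j) = false) ?mulr0//.
  by apply/negbTE; apply: contra jt => /eqP e; rewrite -val_eqE /= e.
rewrite -big_split/=; apply: eq_bigr => j _; rewrite -mulrDr; congr (_ * _).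
rewrite posterior_baseE.
have -> : (\sum_(i < n) \d_(z i) (psi @^-1` [set (j : nat)]))%E =
    (\sum_(i < n) (psi (z i) == j)%:R)%:E :> \bar R.
  rewrite -sumEFin; apply: eq_bigr => i _; rewrite diracE; congr (_%:R%:E).
  by congr nat_of_bool; apply/idP/eqP => [/set_mem//|e]; apply: mem_set.
by rewrite fineD// fin_num_measure.
Qed.

Lemma total_posterior_base (psi : R -> nat) (k : nat) :
  (forall j, measurable (psi @^-1` [set j])) -> (forall t, (psi t < k)%N) ->
  \sum_(j < k) fine (base (psi @^-1` [set (j : nat)])) = fine (alpha setT) + n%:R.
Proof.
move=> mpsi psik.
have := sum_posterior_base (fun=> 1) mpsi psik.
under eq_bigr do rewrite mul1r.
by move=> ->; rewrite Rintegral_cst// mul1r sumr_const card_ord.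
Qed.

End PosteriorBase.

(** * The inverse square root and its rounding to a grid *)

Section InverseSqrt.
Context (R : realType) (x : R).

Definition isqrt (t : R) : R := (Num.sqrt (t - x))^-1.

Lemma isqrt_ge0 t : 0 <= isqrt t.
Proof. by rewrite invr_ge0 sqrtr_ge0. Qed.

Lemma isqrt0 t : t <= x -> isqrt t = 0.
Proof. by move=> tx; rewrite /isqrt ler0_sqrtr ?invr0// subr_le0. Qed.

Lemma measurable_isqrt : measurable_fun setT isqrt.
Proof.
apply: (measurableT_comp (@measurable_invr R)).
apply: measurableT_comp; first by apply: continuous_measurable_fun; exact: sqrt_continuous.
exact: measurable_funB.
Qed.

Lemma integral_isqrt (mu : {measure set R -> \bar R}) :
  (\int[mu]_(t in `]x, +oo[) (isqrt t)%:E = \int[mu]_t (isqrt t)%:E)%E.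
Proof.
rewrite integral_mkcond; apply: eq_integral => t _; rewrite patchE.
case: ifPn => // /negP h; rewrite isqrt0// leNgt; apply/negP => xt; apply: h.
by rewrite inE/= in_itv/= xt.
Qed.

Lemma VE (mu : {measure set R -> \bar R}) : V mu x = fine (\int[mu]_t (isqrt t)%:E)%E.
Proof. by rewrite /V /Rintegral integral_isqrt. Qed.

Lemma V_empirical (z : nat -> R) (n : nat) :
  V (empirical R z n) x = n%:R^-1 * \sum_(i < n) isqrt (z i).
Proof.
have mi : measurable_fun setT (EFin \o isqrt).
  by apply/measurable_EFinP; exact: measurable_isqrt.
have i0 t : setT t -> (0 <= (EFin \o isqrt) t)%E by move=> _; rewrite lee_fin isqrt_ge0.
have e (i : nat) : (\int[\d_(z i)]_t (isqrt t)%:E = (isqrt (z i))%:E)%E.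
  by rewrite (@integral_dirac _ R)// diracT mul1e.
rewrite VE /empirical ge0_integral_mscale//= ge0_integral_measure_sum//.
by rewrite (eq_bigr (fun i : 'I_n => (isqrt (z i))%:E)) ?sumEFin -?EFinM// => i _; exact: e.
Qed.

Lemma measurable_V : measurable_fun setT (fun G : pprobability R R => V (G : probability R R) x).
Proof.
under eq_fun do rewrite VE.
apply: (measurableT_comp (fine_measurable measurableT)).
have mid : measurable_fun setT (@id (pprobability R R)) by exact: measurable_id.
apply: (@measurable_fun_integral_kernel _ _ _ _ R (kprobability mid)).
- by move=> U mU; exact: (measurable_kernel (kprobability mid) U mU).
- by move=> t; rewrite lee_fin isqrt_ge0.
- by apply/measurable_EFinP; exact: measurable_isqrt.
Qed.

(* [level t / N] rounds [isqrt t] down; taking [lo < 0] imposes no lower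
   cut-off. *)
Definition level (N lo hi : R) (t : R) : nat :=
  Num.truncn (N * if (lo < isqrt t) && (isqrt t <= hi) then isqrt t else 0).

Context (N : R).
Hypothesis N_gt0 : 0 < N.

Lemma measurable_level lo hi j : measurable (level N lo hi @^-1` [set j]).
Proof.
pose g t := N * if (lo < isqrt t) && (isqrt t <= hi) then isqrt t else 0.
have mg : measurable_fun setT g.
  apply: measurable_funM => //; apply: measurable_fun_ifT => //; last exact: measurable_isqrt.
  apply: measurable_and.
    by apply: measurable_fun_ltr => //; exact: measurable_isqrt.
  by apply: measurable_fun_ler => //; exact: measurable_isqrt.
have g0 t : 0 <= g t.
  by rewrite mulr_ge0 ?(ltW N_gt0)//; case: ifP => // _; exact: isqrt_ge0.
have -> : level N lo hi @^-1` [set j] = g @^-1` `[j%:R, j.+1%:R[.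
  by apply/seteqP; split => t /=; rewrite in_itv/= -truncn_eq// => /eqP.
by rewrite -[X in measurable X]setTI; exact: mg.
Qed.

Lemma level_lt lo hi t : 0 <= hi -> (level N lo hi t < (Num.truncn (N * hi)).+1)%N.
Proof.
move=> hi0; rewrite ltnS; apply: le_truncn; rewrite ler_wpM2l ?(ltW N_gt0)//.
by case: ifP => // /andP[].
Qed.

Lemma level_le lo hi t : (level N lo hi t)%:R / N <= isqrt t.
Proof.
rewrite ler_pdivrMr//; apply: (@le_trans _ _ (N * if (lo < isqrt t) && (isqrt t <= hi) then isqrt t else 0)).
  rewrite /level truncn_le mulr_ge0 ?(ltW N_gt0)//.
  by case: ifP => // _; exact: isqrt_ge0.
rewrite mulrC ler_wpM2r ?(ltW N_gt0)//.
by case: ifP => // _; exact: isqrt_ge0.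
Qed.

Lemma level_gt lo hi t : lo < isqrt t <= hi -> isqrt t <= (level N lo hi t)%:R / N + N^-1.
Proof.
move=> h; rewrite -[X in _ + X]mul1r -mulrDl natr1 ler_pdivlMr// /level h mulrC ltW//.
exact: truncnS_gt.
Qed.

Lemma level0 lo hi t : isqrt t <= lo -> level N lo hi t = 0%N.
Proof. by move=> h; rewrite /level ltNge h/= mulr0 truncn0. Qed.

Lemma level_ub lo hi t : 0 <= hi -> (level N lo hi t)%:R / N <= hi.
Proof.
move=> hi0; rewrite ler_pdivrMr//; apply: (@le_trans _ _ (N * if (lo < isqrt t) && (isqrt t <= hi) then isqrt t else 0)).
  rewrite /level truncn_le mulr_ge0 ?(ltW N_gt0)//.
  by case: ifP => // _; exact: isqrt_ge0.
rewrite mulrC ler_wpM2r ?(ltW N_gt0)//.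
by case: ifP => // /andP[].
Qed.

Lemma le_level lo hi hi' t : hi <= hi' -> (level N lo hi t <= level N lo hi' t)%N.
Proof.
move=> hh; apply: le_truncn; rewrite ler_wpM2l ?(ltW N_gt0)//.
case: ifPn => [/andP[-> h]|_]; first by rewrite (le_trans h hh).
by case: ifP => // _; exact: isqrt_ge0.
Qed.

End InverseSqrt.

(** * Contribution of large values under the posterior *)

Section PosteriorTail.
Context (R : realType) (alpha : {finite_measure set R -> \bar R}) (z : nat -> R) (n : nat)
  (x : R) (D : probability (pprobability R R) R).
Hypotheses (n_gt0 : (0 < n)%N) (HD : dirichlet_process (posterior_base alpha z n) D)
  (alpha_int : (\int[alpha]_t (isqrt x t)%:E < +oo)%E).
Let A := fine (alpha setT) + n%:R.
Let C := \int[alpha]_t isqrt x t.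

Let A_gt0 : 0 < A.
Proof. by rewrite ltr_wpDl ?ltr0n// fine_ge0. Qed.

Let isqrt_int : alpha.-integrable setT (EFin \o isqrt x).
Proof.
apply/integrableP; split; first by apply/measurable_EFinP; exact: measurable_isqrt.
by under eq_integral do rewrite gee0_abs ?lee_fin ?isqrt_ge0//.
Qed.

Lemma Rintegral_level_le (N lo hi : R) : 0 < N -> 0 <= hi ->
  \int[alpha]_t ((level x N lo hi t)%:R / N) <= C.
Proof.
move=> N0 hi0; apply: le_Rintegral => //.
- exact: (integrable_step alpha (fun j => j%:R / N) (measurable_level x N0 lo hi)
    (fun t => level_lt x N0 lo t hi0)).
- by move=> t _; exact: level_le.
Qed.

(** No observation exceeds [M], so in the tail above [M] all data fall in level 0 and the bound
    involves only [alpha]. The tail is cut at each integer [l] so that it remains a step function;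
    the exceptional events increase with [l], hence their union obeys the same bound. *)
Lemma posterior_tail (N M lam : R) : 0 < N -> 0 <= M -> 0 < lam ->
  (forall i, (i < n)%N -> isqrt x (z i) <= M) ->
  exists2 B : set (pprobability R R),
    measurable B /\ (D B <= (4 / A + C / lam)%:E)%E &
    forall G, ~ B G ->
      let I := \int[G : probability R R]_t ((level x N (-1) M t)%:R / N) in
      I <= V (G : probability R R) x <= I + (2 * lam / A + N^-1).
Proof.
move=> N0 M0 lam0 zM.
pose phi (l : nat) := level x N M l%:R.
have mphi l := measurable_level x N0 M l%:R.
have phik l t : (phi l t < (Num.truncn (N * l%:R)).+1)%N by exact: level_lt.
have mpsi := measurable_level x N0 (-1) M.
have psik t : (level x N (-1) M t < (Num.truncn (N * M)).+1)%N by exact: level_lt.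
pose c (j : nat) : R := j%:R / N.
have c0 j : 0 <= c j by rewrite divr_ge0// ltW.
pose Bl (l : nat) := [set G : pprobability R R |
  (2 * lam / A < \int[G : probability R R]_t c (phi l t))%R].
have mBl l : measurable (Bl l).
  rewrite -[Bl l]setTI; apply: measurable_fun_ltr => //.
  exact: (measurable_pprobability_step c (mphi l) (phik l)).
have BlD l : (D (Bl l) <= (4 / A + C / lam)%:E)%E.
  have AE := total_posterior_base alpha z n_gt0 (mphi l) (phik l).
  have := dirichlet_step_tail HD (mphi l) (phik l) _ c0 lam0.
  rewrite AE -/A => /(_ A_gt0) h; apply: le_trans h _.
  rewrite lee_fin lerD2l ler_pM2r ?invr_gt0//.
  rewrite (sum_posterior_base alpha z n_gt0 c (mphi l) (phik l)) big1 ?addr0.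
    exact: Rintegral_level_le.
  by move=> i _; rewrite /phi level0 ?zM// /c mul0r.
have Bl_ndecr : nondecreasing_seq Bl.
  move=> l l' ll'; apply/subsetPset => G /lt_le_trans; apply.
  apply: le_Rintegral => //.
  - exact: (integrable_step G c (mphi l) (phik l)).
  - exact: (integrable_step G c (mphi l') (phik l')).
  - move=> t _; rewrite /c ler_pM2r ?invr_gt0// ler_nat.
    by apply: le_level => //; rewrite ler_nat.
exists (\bigcup_l Bl l).
  split; first exact: bigcupT_measurable.
  have cD : D (Bl l) @[l --> \oo] --> D (\bigcup_l Bl l).
    exact: (nondecreasing_cvg_mu mBl (bigcupT_measurable Bl mBl) Bl_ndecr).
  rewrite -(cvg_lim _ cD)//; apply: lime_le; first by apply/cvg_ex; eexists; exact: cD.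
  exact: nearW.
move=> G nB /=; set I := \int[_]_t _.
have ipsi : (G : probability R R).-integrable setT (EFin \o (fun t => c (level x N (-1) M t))).
  exact: integrable_step.
have iphi l : (G : probability R R).-integrable setT (EFin \o (fun t => c (phi l t))).
  exact: (integrable_step G c (mphi l) (phik l)).
have misq : measurable_fun setT (fun t => (isqrt x t)%:E).
  by apply/measurable_EFinP; exact: measurable_isqrt.
(* Fatou's lemma along these truncations gives the upper bound together with the finiteness of the
   integral, without which [V] would take its default value 0. *)
pose g (l : nat) t := if isqrt x t <= l%:R then isqrt x t else 0.
have g0 l t : 0 <= g l t by rewrite /g; case: ifP => // _; exact: isqrt_ge0.
have mg l : measurable_fun setT (g l).
  apply: measurable_fun_ifT => //; last exact: measurable_isqrt.
  by apply: measurable_fun_ler => //; exact: measurable_isqrt.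
have ub : (\int[G : probability R R]_t (isqrt x t)%:E <= (I + (2 * lam / A + N^-1))%:E)%E.
  apply: (@fatou_le _ _ _ _ _ (fun l t => (g l t)%:E)) => //.
  - by move=> l; apply/measurable_EFinP.
  - by move=> l t _; rewrite lee_fin.
  - move=> t _; apply: cvg_near_cst; near=> l; congr EFin; rewrite /g ifT//.
    by near: l; exact: nbhs_infty_ger.
  move=> l.
  (* Up to [M] the first rounding is accurate within [N^-1], above [M] the second one is; the
     remaining summand is nonnegative. *)
  pose h t := c (level x N (-1) M t) + (c (phi l t) + N^-1).
  have i2 : (G : probability R R).-integrable setT (EFin \o (fun t => c (phi l t) + N^-1)).
    exact: (integrableD measurableT (iphi l) (finite_measure_integrable_cst G N^-1 measurableT)).
  have ih : (G : probability R R).-integrable setT (EFin \o h).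
    exact: (integrableD measurableT ipsi i2).
  apply: (@le_trans _ _ (\int[G : probability R R]_t (h t)%:E)%E).
    apply: ge0_le_integral => //.
    - by move=> t _; rewrite lee_fin.
    - by apply/measurable_EFinP.
    - exact: measurable_int ih.
    move=> t _; rewrite lee_fin /h /g; case: ifPn => [tl|_]; last first.
      by rewrite !addr_ge0// invr_ge0 ltW.
    have [tM|Mt] := leP (isqrt x t) M.
      apply: (@le_trans _ _ (c (level x N (-1) M t) + N^-1)).
        by apply: level_gt => //; rewrite tM andbT (lt_le_trans _ (isqrt_ge0 x t))// ltrN10.
      by rewrite lerD2l lerDr.
    apply: (@le_trans _ _ (c (phi l t) + N^-1)); last by rewrite lerDr.
    by apply: level_gt => //; rewrite Mt.
  rewrite -[leLHS]fineK; last exact: integrable_fin_num.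
  rewrite lee_fin -/(Rintegral _ _ _) /h RintegralD// lerD2l RintegralD//; last first.
    exact: finite_measure_integrable_cst.
  rewrite Rintegral_prob_cst lerD2r leNgt; apply/negP => Bl_G; apply: nB.
  by exists l.
have lb : (I%:E <= \int[G : probability R R]_t (isqrt x t)%:E)%E.
  rewrite /I /Rintegral fineK; last exact: integrable_fin_num.
  apply: ge0_le_integral => //.
  - by move=> t _; rewrite lee_fin; exact: c0.
  - exact: measurable_int ipsi.
  - by move=> t _; rewrite lee_fin; exact: level_le.
rewrite VE; move: lb ub; case: (\int[_]_t _)%E => [r| |]//=.
by rewrite !lee_fin => -> ->.
Unshelve. all: by end_near. Qed.

End PosteriorTail.

(** * Distance of the posterior to the normal law, for fixed data *)

Section PosteriorDistance.
Context (R : realType) (alpha : {finite_measure set R -> \bar R}) (z : nat -> R) (n : nat)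
  (x : R) (D : probability (pprobability R R) R).
Hypotheses (n_gt0 : (0 < n)%N) (HD : dirichlet_process (posterior_base alpha z n) D)
  (alpha_int : (\int[alpha]_t (isqrt x t)%:E < +oo)%E).
Let C := \int[alpha]_t isqrt x t.
Let a0 := fine (alpha setT).
Let N : R := n%:R.
Let A := a0 + N.
Let h i := isqrt x (z i).
Let m := N^-1 * \sum_(i < n) h i.
Context (L v kap : R).
(** With [r = sqrt (N / L)] the normalising factor, [r / N = 1 / M]: [M] is the scale on which the
    values of [isqrt] enter the normalised form, and also the cut-off of the step function. *)
Let M := Num.sqrt N * Num.sqrt L.
(** The fourth power leaves room for two losses: square roots turn [delta] into [kap ^ 2], and
    [1 / A <= delta] must beat the factor [1 / kap ^ 2] from Chebyshev's inequality. *)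
Let delta := kap ^+ 4.
Hypotheses (L_gt0 : 0 < L) (v_ge0 : 0 <= v) (kap_gt0 : 0 < kap) (kap_le : kap <= 1 / 2).
Hypotheses (H2 : `|(\sum_(i < n) h i ^+ 2) / (N * L) - v| <= delta)
  (H4 : \sum_(i < n) h i ^+ 4 <= delta * (N * L) ^+ 2)
  (Hm : (m + 1) ^+ 2 <= delta * L)
  (HM : M^-1 <= delta)
  (HA : 1 - (N / A) ^+ 2 <= delta)
  (HN : N^-1 <= delta).
Let s t : R := (level x N (-1) M t)%:R / N.

Let N_gt0 : 0 < N. Proof. by rewrite ltr0n. Qed.
Let N_ge1 : 1 <= N. Proof. by rewrite ler1n. Qed.
Let a0_ge0 : 0 <= a0. Proof. exact: fine_ge0. Qed.
Let A_gt0 : 0 < A. Proof. by rewrite ltr_wpDl. Qed.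
Let M_gt0 : 0 < M. Proof. by rewrite mulr_gt0// sqrtr_gt0. Qed.
Let delta_gt0 : 0 < delta. Proof. exact: exprn_gt0. Qed.
Let delta_le1 : delta <= 1.
Proof. by apply: exprn_ile1; rewrite ?(ltW kap_gt0)// (le_trans kap_le)//; lra. Qed.
Let M2 : M ^+ 2 = N * L.
Proof. by rewrite /M exprMn !sqr_sqrtr// ltW. Qed.
Let h_ge0 i : 0 <= h i. Proof. exact: isqrt_ge0. Qed.
Let m_ge0 : 0 <= m.
Proof. by rewrite mulr_ge0 ?invr_ge0 ?(ltW N_gt0)//; apply: sumr_ge0. Qed.
Let s_ge0 t : 0 <= s t. Proof. by rewrite divr_ge0// ltW. Qed.
Let s_le t : s t <= isqrt x t. Proof. exact: level_le. Qed.
Let s_leM t : s t <= M. Proof. exact: level_ub (ltW M_gt0). Qed.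
Let C_ge0 : 0 <= C.
Proof. by apply: Rintegral_ge0 => t _; exact: isqrt_ge0. Qed.

(** A single term of the sum in [H4] is at most [delta M^4], and [delta <= 1]. *)
Let h_leM i : (i < n)%N -> h i <= M.
Proof.
move=> i_n; rewrite -(@ler_pXn2r _ 4)// ?nnegrE ?(ltW M_gt0)//.
apply: le_trans (_ : \sum_(i < n) h i ^+ 4 <= _).
  rewrite (bigD1 (Ordinal i_n))//= lerDl; apply: sumr_ge0 => j _; exact: exprn_ge0.
rewrite (le_trans H4)// -M2 -exprM ler_piMl// exprn_ge0// ltW//.
Qed.

Let s_ge i : (i < n)%N -> h i - s (z i) <= N^-1.
Proof.
move=> i_n; rewrite lerBlDl; apply: level_gt => //; rewrite [isqrt _ _ <= _]h_leM// andbT.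
by rewrite (lt_le_trans _ (isqrt_ge0 _ _))// ltrN10.
Qed.

Let mpsi := measurable_level x N_gt0 (-1) M.
Let k := (Num.truncn (N * M)).+1.
Let psik t : (level x N (-1) M t < k)%N. Proof. exact: level_lt (ltW M_gt0). Qed.

Let Rintegral_step_le (g : nat -> R) (K1 K2 : R) :
  (forall t, `|g (level x N (-1) M t)| <= K1 * isqrt x t + K2) ->
  `|\int[alpha]_t g (level x N (-1) M t)| <= K1 * C + K2 * a0.
Proof.
move=> gK; have ig := integrable_step alpha g mpsi psik.
have iC : alpha.-integrable setT (EFin \o isqrt x).
  apply/integrableP; split; first by apply/measurable_EFinP; exact: measurable_isqrt.
  by under eq_integral do rewrite gee0_abs ?lee_fin ?isqrt_ge0//.
have iK1 : alpha.-integrable setT (EFin \o (fun t => K1 * isqrt x t)).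
  exact: (integrableZl measurableT _ iC).
have iK2 : alpha.-integrable setT (EFin \o (fun=> K2)) by exact: finite_measure_integrable_cst.
apply: le_trans (le_normr_Rintegral _ ig) _ => //.
have -> : K1 * C + K2 * a0 = \int[alpha]_t (K1 * isqrt x t + K2).
  by rewrite RintegralD// RintegralZl// Rintegral_cst.
apply: le_Rintegral => //; first exact: integrable_norm ig.
exact: (integrableD measurableT iK1 iK2).
Qed.

(** The levels are centred at the empirical value [m]; since [G] has mass 1, the integral of the
    centred function is that of [s] minus [m]. *)
Let c (j : nat) : R := j%:R / N - m.
Let r := Num.sqrt N / Num.sqrt L.

Let sum_step (e : nat) (g := fun j : nat => c j ^+ e) :
  \sum_(i < k) (r / A * c i) ^+ e * fine (posterior_base alpha z n
     (level x N (-1) M @^-1` [set (i : nat)])) =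
  (r / A) ^+ e * (\int[alpha]_t (s t - m) ^+ e + \sum_(i < n) (s (z i) - m) ^+ e).
Proof.
have := sum_posterior_base alpha z n_gt0 g mpsi psik.
rewrite /g /c -/s => <-; rewrite mulr_sumr; apply: eq_bigr => i _.
by rewrite exprMn mulrA.
Qed.

Let rN : r / N = M^-1.
Proof.
have eN : N = Num.sqrt N ^+ 2 by rewrite sqr_sqrtr// ltW.
have : 0 < Num.sqrt N by rewrite sqrtr_gt0.
have : 0 < Num.sqrt L by rewrite sqrtr_gt0.
rewrite /r /M [in X in _ / X = _]eN; move: (Num.sqrt N) (Num.sqrt L) => p q q0 p0.
by field; rewrite (gt_eqF p0) (gt_eqF q0).
Qed.

Let w := N / A.
Let w_ge0 : 0 <= w. Proof. by rewrite divr_ge0// ltW. Qed.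
Let w_le1 : w <= 1. Proof. by rewrite ler_pdivrMr// mul1r lerDr. Qed.
Let rA : r / A = M^-1 * w.
Proof. by rewrite -rN /w; field; rewrite (gt_eqF A_gt0) (gt_eqF N_gt0). Qed.

Let b := \sum_(i < k) r / A * c i * fine (posterior_base alpha z n
     (level x N (-1) M @^-1` [set (i : nat)])).
Let V2 := \sum_(i < k) (r / A * c i) ^+ 2 * fine (posterior_base alpha z n
     (level x N (-1) M @^-1` [set (i : nat)])).
Let V4 := \sum_(i < k) (r / A * c i) ^+ 4 * fine (posterior_base alpha z n
     (level x N (-1) M @^-1` [set (i : nat)])).

Let sum_h : \sum_(i < n) h i = N * m.
Proof. by rewrite mulrA divff ?mul1r// gt_eqF. Qed.

Let m_le : m <= kap ^+ 2 * Num.sqrt L.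
Proof.
rewrite -(@ler_pXn2r _ 2)// ?nnegrE//; last by rewrite mulr_ge0// ?sqrtr_ge0// sqr_ge0.
rewrite [leRHS]exprMn sqr_sqrtr ?(ltW L_gt0)// -exprM.
by apply: le_trans Hm; rewrite ler_sqr ?nnegrE ?addr_ge0// lerDl.
Qed.

Let Mm_le : M^-1 * m <= kap ^+ 2.
Proof.
rewrite mulrC ler_pdivrMr// (le_trans m_le)// ler_wpM2l ?sqr_ge0// /M ler_peMl ?sqrtr_ge0//.
by rewrite -[leLHS]sqrtr1 ler_sqrt.
Qed.

Let delta_le_sqr : delta <= kap ^+ 2.
Proof.
rewrite /delta (exprD kap 2 2) ler_piMr ?sqr_ge0//; apply: exprn_ile1; first exact: ltW.
by rewrite (le_trans kap_le)//; lra.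
Qed.

(** Over the data, centring at [m] leaves only the rounding errors, [n] terms of size at most
    [1 / n]; the prior contributes at most [C + m a0]. The sum is then multiplied by [w / M] with
    [w <= 1]. *)
Let b_le : `|b| <= (1 + C + a0) * kap ^+ 2.
Proof.
have -> : b = \sum_(i < k) (r / A * c i) ^+ 1 * fine (posterior_base alpha z n
     (level x N (-1) M @^-1` [set (i : nat)])) by [].
rewrite sum_step !expr1 rA normrM normrM.
have -> : \sum_(i < n) (s (z i) - m) ^+ 1 = - \sum_(i < n) (h i - s (z i)).
  under eq_bigr do rewrite expr1.
  rewrite !sumrB opprB sumr_const card_ord -[X in _ - X]mulr_natl.
  by congr (_ - _); rewrite -sum_h.
have h1 : `|\int[alpha]_t (s t - m) ^+ 1| <= 1 * C + m * a0.
  apply: (@Rintegral_step_le (fun j => c j ^+ 1)) => t; rewrite expr1 mul1r.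
  rewrite (le_trans (ler_normB _ _))// (ger0_norm m_ge0) lerD2r ger0_norm; first exact: s_le.
  exact: s_ge0.
have h2 : `|- \sum_(i < n) (h i - s (z i))| <= 1.
  rewrite normrN ger0_norm; last by apply: sumr_ge0 => i _; rewrite subr_ge0.
  apply: (@le_trans _ _ (\sum_(i < n) N^-1)); first by apply: ler_sum => i _; exact: s_ge.
  by rewrite sumr_const card_ord -[leLHS]mulr_natl divff// gt_eqF.
rewrite (ger0_norm w_ge0) ger0_norm ?invr_ge0 ?(ltW M_gt0)//.
apply: (@le_trans _ _ (M^-1 * 1 * (1 * C + m * a0 + 1))).
  have Mi : 0 <= M^-1 by rewrite invr_ge0 ltW.
  apply: ler_pM => //; first exact: mulr_ge0.
    exact: ler_wpM2l.
  exact: le_trans (ler_normD _ _) (lerD h1 h2).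
have := ler_wpM2r a0_ge0 Mm_le.
have := ler_wpM2r C_ge0 (le_trans HM delta_le_sqr).
have := le_trans HM delta_le_sqr.
lra.
Qed.

(** As [M^2 = N L], [H2] is the claim for squares without centring or rounding. These two cost at
    most [3 N (m + 1)^2], which [Hm] absorbs; in the prior part [s^2 <= M isqrt] gives [M C]; and
    passing from [N] to [A] costs the factor [w^2], controlled by [HA]. *)
Let V2_le : `|v - V2| <= (v + 4 + C + a0) * delta.
Proof.
have -> : V2 = w ^+ 2 * (M^-1 ^+ 2 *
    (\int[alpha]_t (s t - m) ^+ 2 + \sum_(i < n) (s (z i) - m) ^+ 2)).
  by rewrite /V2 sum_step rA exprMn; ring.
have mM : M^-1 ^+ 2 * (m + 1) ^+ 2 <= delta / N.
  rewrite exprVn M2 mulrC ler_pdivrMr ?mulr_gt0//.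
  by apply: (le_trans Hm); rewrite [leRHS](_ : _ = delta * L)//; field; rewrite gt_eqF.
have mM' : M^-1 ^+ 2 * m ^+ 2 <= delta.
  apply: (@le_trans _ _ (delta / N)); last by rewrite ler_pdivrMr// ler_peMr// ltW.
  apply: le_trans mM; rewrite ler_wpM2l ?sqr_ge0// ler_sqr ?nnegrE ?addr_ge0// lerDl//.
have h1 : `|\int[alpha]_t (s t - m) ^+ 2| <= M * C + m ^+ 2 * a0.
  apply: (@Rintegral_step_le (fun j => c j ^+ 2)) => t.
  rewrite ger0_norm ?sqr_ge0// -/(s t).
  have := mulr_ge0 (s_ge0 t) m_ge0.
  have := ler_pM (s_ge0 t) (s_ge0 t) (s_leM t) (s_le t).
  by rewrite /c -/(s t); move: (s t) => u; rewrite sqrrB; lra.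
have h2 : `|\sum_(i < n) (s (z i) - m) ^+ 2 - \sum_(i < n) h i ^+ 2| <= 3 * N * (m + 1) ^+ 2.
  rewrite -sumrB; apply: le_trans (ler_norm_sum _ _ _) _.
  apply: (@le_trans _ _ (\sum_(i < n) (2 * (m + 1) * h i + (m + 1) ^+ 2))).
    apply: ler_sum => i _.
    have Ni : N^-1 <= 1 by rewrite invf_le1.
    have e1 := s_ge (ltn_ord i); have e0 : s (z i) <= h i by exact: s_le.
    have := h_ge0 i; have := m_ge0; move: (s (z i)) (h i) e0 e1 => u y e0 e1 q1 q2.
    (* The rounded and centred value is [y] minus the increment [y - u + m], which lies in
       [[0, m + 1]]. *)
    rewrite (_ : _ - _ = (y - u + m) ^+ 2 - 2 * y * (y - u + m)); last by ring.
    have e2 : 0 <= y - u + m by lra.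
    have e3 : y - u + m <= m + 1 by lra.
    rewrite (le_trans (ler_normB _ _))// ger0_norm ?sqr_ge0// ger0_norm ?mulr_ge0//.
    have e4 : y * (y - u + m) <= y * (m + 1) by exact: ler_wpM2l.
    have e5 : (y - u + m) ^+ 2 <= (m + 1) ^+ 2.
      by apply: lerXn2r => //; rewrite nnegrE// addr_ge0.
    by move: ((y - u + m) ^+ 2) ((m + 1) ^+ 2) e5 => p p' e5; lra.
  rewrite big_split/= -mulr_sumr sum_h sumr_const card_ord -[X in _ + X]mulr_natl -/N.
  have -> : 2 * (m + 1) * (N * m) + N * (m + 1) ^+ 2 =
     3 * N * (m + 1) ^+ 2 - 2 * (N * (m + 1)) by ring.
  by rewrite gerBl !mulr_ge0 ?addr_ge0 ?(ltW N_gt0).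
have E : `|M^-1 ^+ 2 * (\int[alpha]_t (s t - m) ^+ 2 + \sum_(i < n) (s (z i) - m) ^+ 2) - v|
    <= (4 + C + a0) * delta.
  move: h1 h2; set I := \int[_]_t _; set S1 := \sum_(i < n) (s _ - m) ^+ 2.
  move: H2; rewrite -M2 -exprVn [_ * M^-1 ^+ 2]mulrC; set S2 := \sum_(i < n) _ ^+ 2.
  move=> k1 k2 k3.
  rewrite (_ : _ - v = (M^-1 ^+ 2 * S2 - v) + M^-1 ^+ 2 * I + M^-1 ^+ 2 * (S1 - S2)); last by ring.
  rewrite (le_trans (ler_normD _ _))// (_ : (4 + C + a0) * delta = (delta + (C + a0) * delta) + 3 * delta); last by ring.
  apply: lerD.
    rewrite (le_trans (ler_normD _ _))// lerD// normrM ger0_norm ?sqr_ge0//.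
    apply: le_trans (ler_wpM2l (sqr_ge0 _) k2) _.
    have := ler_wpM2r a0_ge0 mM'; have := ler_wpM2r C_ge0 HM.
    have : M^-1 ^+ 2 * (M * C) = M^-1 * C by field; rewrite gt_eqF.
    lra.
  rewrite normrM ger0_norm ?sqr_ge0//; apply: le_trans (ler_wpM2l (sqr_ge0 _) k3) _.
  rewrite mulrCA -[3 * N]mulrC -mulrA [leLHS]mulrCA ler_wpM2l//.
  by rewrite -ler_pdivlMl// [_^-1 * _]mulrC.
move: E; move: (M^-1 ^+ 2 * _) => u E.
have w2 : 0 <= 1 - w ^+ 2 by rewrite subr_ge0; exact: exprn_ile1.
have w2' : 0 <= w ^+ 2 by exact: sqr_ge0.
have HA' : 1 - w ^+ 2 <= delta := HA.
move: (w ^+ 2) w2 w2' HA' => q w2 w2' HA'.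
rewrite (_ : v - q * u = (1 - q) * v - q * (u - v)); last by ring.
rewrite (le_trans (ler_normB _ _))// !normrM (ger0_norm w2) (ger0_norm w2') (ger0_norm v_ge0).
have e1 := ler_wpM2r v_ge0 HA'.
have e2 : q * `|u - v| <= 1 * ((4 + C + a0) * delta).
  by apply: ler_pM => //; rewrite -subr_ge0.
by move: e1 e2; move: ((1 - q) * v) (q * `|u - v|) delta => ? ? ?; lra.
Qed.

(** For nonnegative numbers [(s - m)^4 <= s^4 + m^4]. The data part is then [H4] plus [N m^4]; in
    the prior part [s^4 <= M^3 isqrt], so that division by [M^4] leaves [C / M] besides a term in
    [m^4]. *)
Let V4_le : V4 <= (2 + C + a0) * delta.
Proof.
rewrite /V4 sum_step rA exprMn.
have pow4 t : (s t - m) ^+ 4 <= s t ^+ 4 + m ^+ 4.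
  have := s_ge0 t; move: (s t) m_ge0 => u.
  have gen (p q : R) : 0 <= q -> q <= p -> (p - q) ^+ 4 <= p ^+ 4 + q ^+ 4.
    move=> q0 qp; apply: (@le_trans _ _ (p ^+ 4)); last by rewrite lerDl exprn_ge0.
    by rewrite ler_pXn2r ?nnegrE ?subr_ge0// ?gerBl// (le_trans q0).
  move=> m0 u0; have [um|/ltW mu] := leP u m; last exact: gen.
  by rewrite (_ : (u - m) ^+ 4 = (m - u) ^+ 4); [rewrite [leRHS]addrC; exact: gen|ring].
have h1 : \int[alpha]_t (s t - m) ^+ 4 <= M ^+ 3 * C + m ^+ 4 * a0.
  apply: le_trans (ler_norm _) _.
  apply: (@Rintegral_step_le (fun j => c j ^+ 4)) => t.
  rewrite /c -/(s t) ger0_norm ?(exprn_even_ge0 _ _)//.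
  rewrite (le_trans (pow4 t))// lerD2r exprSr.
  apply: ler_pM => //; first exact: exprn_ge0.
  by rewrite ler_pXn2r ?nnegrE// ltW.
have h2 : \sum_(i < n) (s (z i) - m) ^+ 4 <= delta * (N * L) ^+ 2 + N * m ^+ 4.
  apply: le_trans (_ : \sum_(i < n) (h i ^+ 4 + m ^+ 4) <= _).
    apply: ler_sum => i _; apply: (le_trans (pow4 _)); rewrite lerD2r.
    by rewrite ler_pXn2r ?nnegrE//; exact: s_le.
  by rewrite big_split/= sumr_const card_ord -[X in _ + X]mulr_natl lerD2r.
have w4 : w ^+ 4 <= 1 by exact: exprn_ile1.
have Mi : 0 <= M^-1 by rewrite invr_ge0 ltW.
have mM' : M^-1 ^+ 4 * (N * m ^+ 4) <= delta.
  have q : m ^+ 4 <= (delta * L) ^+ 2.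
    rewrite -[4%N]/(2 * 2)%N exprM; apply: lerXn2r.
    - by rewrite nnegrE sqr_ge0.
    - by rewrite nnegrE; exact: mulr_ge0 (ltW delta_gt0) (ltW L_gt0).
    by apply: le_trans Hm; rewrite ler_sqr ?nnegrE ?addr_ge0// lerDl.
  apply: le_trans (ler_wpM2l (exprn_ge0 4 Mi) (ler_wpM2l (ltW N_gt0) q)) _.
  have -> : M^-1 ^+ 4 * (N * (delta * L) ^+ 2) = delta * (delta / N).
    rewrite exprVn -[4%N]/(2 * 2)%N exprM M2; field.
    by rewrite (gt_eqF L_gt0) (gt_eqF N_gt0).
  rewrite ler_piMr ?(ltW delta_gt0)// ler_pdivrMr// mul1r.
  exact: le_trans delta_le1 N_ge1.
have mM'' : M^-1 ^+ 4 * m ^+ 4 <= delta.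
  apply: le_trans mM'; rewrite ler_wpM2l ?exprn_ge0// ler_peMl ?exprn_ge0//.
apply: (@le_trans _ _ (M^-1 ^+ 4 * 1 *
   (M ^+ 3 * C + m ^+ 4 * a0 + (delta * (N * L) ^+ 2 + N * m ^+ 4)))).
  apply: ler_pM.
  - by rewrite mulr_ge0 ?exprn_ge0.
  - rewrite addr_ge0//; first by apply: Rintegral_ge0 => t _; exact: exprn_even_ge0.
    by apply: sumr_ge0 => i _; exact: exprn_even_ge0.
  - by rewrite ler_wpM2l ?exprn_ge0.
  - exact: lerD.
have := ler_wpM2r a0_ge0 mM''; have := ler_wpM2r C_ge0 HM.
have : M^-1 ^+ 4 * (M ^+ 3 * C) = M^-1 * C by field; rewrite gt_eqF.
have : M^-1 ^+ 4 * (delta * (N * L) ^+ 2) = delta.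
  by rewrite -M2; field; rewrite gt_eqF.
move: mM'; rewrite mulr1 !mulrDr; move: delta => d.
lra.
Qed.

Let K0 := 4 + C + a0 + 2 * v.

Let K0_ge : 4 <= K0. Proof. by rewrite /K0; have := v_ge0; have := C_ge0; have := a0_ge0; lra. Qed.

Let kap_sqr_le : kap ^+ 2 <= kap.
Proof. by rewrite expr2 ler_piMr ?(ltW kap_gt0)// (le_trans kap_le)//; lra. Qed.

Let posterior_discretize f : BL1 f ->
  `|\int[D]_G f (r * (V (G : probability R R) x - m)) -
    \int[D]_G f (r * \int[G : probability R R]_t c (level x N (-1) M t))| <=
  (11 + 2 * C) * kap.
Proof.
(* The tail threshold [lam = sqrt M] balances the term [C / lam] in the probability of the
   exceptional set against the displacement [2 r lam / A], at most [2 lam / M]: both are of order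
   [M^(-1/2)], which is at most [kap ^ 2]. *)
move=> fBL; pose q := Num.sqrt M.
have q0 : 0 < q by rewrite sqrtr_gt0.
have q2 : q ^+ 2 = M by rewrite sqr_sqrtr// ltW.
have qi : q^-1 <= kap ^+ 2.
  rewrite -(@ler_pXn2r _ 2)// ?nnegrE ?invr_ge0 ?sqr_ge0 ?(ltW q0)//.
  by rewrite exprVn q2 -exprM.
have [B [mB DB] BV] := posterior_tail n_gt0 HD alpha_int N_gt0 (ltW M_gt0) q0 h_leM.
have r0 : 0 <= r by rewrite divr_ge0 ?sqrtr_ge0.
pose tau := r * (2 * q / A + N^-1).
have tau_le : tau <= 2 * kap ^+ 2 + delta.
  rewrite /tau mulrDr lerD//; last by rewrite rN.
  have -> : r * (2 * q / A) = 2 * (q^-1 * w).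
    rewrite [LHS](_ : _ = 2 * q * (r / A)); last by field; rewrite gt_eqF.
    by rewrite rA -q2; field; rewrite gt_eqF.
  rewrite ler_wpM2l// (le_trans _ qi)// ler_piMr// invr_ge0 ltW//.
have tau0 : 0 <= tau by rewrite mulr_ge0// addr_ge0 ?invr_ge0 ?divr_ge0 ?mulr_ge0 ?ltW.
have mV : measurable_fun setT (fun G : pprobability R R => r * (V (G : probability R R) x - m)).
  by apply: measurable_funM => //; apply: measurable_funB => //; exact: measurable_V.
have mI : measurable_fun setT (fun G : pprobability R R =>
    r * \int[G : probability R R]_t c (level x N (-1) M t)).
  by apply: measurable_funM => //; exact: (measurable_pprobability_step c mpsi psik).
have iB : D.-integrable setT (EFin \o (fun G => 2 * \1_B G)).
  have iB1 : D.-integrable setT (EFin \o \1_B) by exact: integrable_indic.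
  exact: (integrableZl measurableT 2 iB1).
have itau : D.-integrable setT (EFin \o (fun=> tau)) by exact: finite_measure_integrable_cst.
have iD : D.-integrable setT (EFin \o (fun G => 2 * \1_B G + tau)).
  exact: (integrableD measurableT iB itau).
have cE (G : probability R R) :
    \int[G]_t c (level x N (-1) M t) = \int[G]_t s t - m.
  have ints : G.-integrable setT (EFin \o s) by exact: (integrable_step G (fun j => j%:R / N) mpsi psik).
  rewrite /c RintegralB//; last exact: finite_measure_integrable_cst.
  by rewrite Rintegral_prob_cst.
apply: le_trans (BL1_distance fBL mV mI iD _) _.
  move=> G; rewrite indicE; have [GB|GB] := boolP (G \in B).
    rewrite mulr1 (le_trans (ler_normB _ _))// (@le_trans _ _ 2) ?lerDl//.
    by rewrite -[2]/(1 + 1) lerD//; exact: fBL.1.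
  rewrite mulr0 add0r (le_trans (fBL.2 _ _))// cE -mulrBr normrM (ger0_norm r0) ler_wpM2l//.
  have /andP[IV VI] := BV G (fun b => negP GB (mem_set b)).
  rewrite opprB addrA subrK ger0_norm ?subr_ge0// lerBlDl.
  exact: VI.
rewrite RintegralD// RintegralZl//; last exact: integrable_indic.
rewrite Rintegral_prob_cst {1}/Rintegral integral_indic// setIT.
have DB' : fine (D B) <= 4 / A + C / q.
  by rewrite -lee_fin fineK ?fin_num_measure.
have A4 : 4 / A <= 4 * delta.
  rewrite ler_wpM2l// (le_trans _ HN)// lef_pV2 ?posrE// lerDr//.
have Cq : C / q <= C * kap ^+ 2 by rewrite ler_wpM2l.
have D2 : 2 * fine (D B) <= 2 * (4 / A + C / q) by rewrite ler_wpM2l.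
apply: le_trans (lerD D2 tau_le) _.
have := ler_wpM2l C_ge0 kap_sqr_le.
have := delta_le_sqr; have := kap_sqr_le; move: A4 Cq.
generalize (kap ^+ 2) delta (4 / A) (C / q) => *.
lra.
Qed.

(** The bound is uniform in [f] and linear in [kap], as needed for a supremum over [BL1]. For
    [v = 0] the convention [0^-1 = 0] makes [K0 / v] vanish, so one expression covers both cases. *)
Lemma posterior_distance f : BL1 f ->
  `|\int[D]_G f (r * (V (G : probability R R) x - V (empirical R z n) x)) -
    \int[normal_law 0 v]_u f u| <= (13 + 8 * K0 + 8 * (K0 / v)) * kap.
Proof.
move=> fBL; rewrite V_empirical -/h -/N -/m.
apply: le_trans (ler_distD (\int[D]_G f (r * \int[G : probability R R]_t c (level x N (-1) M t))) _ _) _.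
have h1 := posterior_discretize fBL.
have AE := total_posterior_base alpha z n_gt0 mpsi psik.
have h2 := @dirichlet_step_clt _ _ _ _ _ HD mpsi psik.
rewrite AE in h2.
(* The denominator is frozen with tolerance [eta = kap]; the Chebyshev term [2 / (kap^2 A)] is then
   at most [2 kap], because [1 / A <= kap ^ 4]. *)
have {h2} := h2 A_gt0 c r kap v b V2 V4 f fBL kap_gt0 kap_le v_ge0 erefl erefl erefl.
move: h1; set E1 := `|_ - _| => h1; set E2 := `|_ - _| => h2.
have kap_le1 : kap <= 1 by rewrite (le_trans kap_le)//; lra.
have K0_ge0 : 0 <= K0 by apply: le_trans K0_ge.
have sqrt_le (V' K : R) : 0 <= K -> V' <= K ^+ 2 -> Num.sqrt V' <= K.
  by move=> K1 /ler_wsqrtr; rewrite sqrtr_sqr ger0_norm.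
have sqrt_le_delta (V' : R) : V' <= K0 * delta -> Num.sqrt V' <= K0 * kap.
  move=> hV; apply: (@le_trans _ _ (K0 * kap ^+ 2)); last by rewrite ler_wpM2l.
  apply: sqrt_le; first by rewrite mulr_ge0// sqr_ge0.
  apply: (le_trans hV); rewrite [leRHS]exprMn -exprM ler_wpM2r ?(ltW delta_gt0)//.
  by rewrite expr2 ler_peMl//; apply: le_trans K0_ge; lra.
have e1 : 2 / (kap ^+ 2 * A) <= 2 * kap.
  rewrite ler_wpM2l// invfM mulrC ler_pdivrMr ?exprn_gt0//.
  apply: (@le_trans _ _ delta).
    by rewrite (le_trans _ HN)// lef_pV2 ?posrE// lerDr.
  rewrite -exprS /delta exprSr ler_piMr// exprn_ge0// ltW//.
have e2 : `|b| <= K0 * kap ^+ 2.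
  apply: (le_trans b_le); rewrite ler_wpM2r ?sqr_ge0// /K0.
  by have := v_ge0; lra.
have e3 : K0 * kap ^+ 2 <= K0 * kap by rewrite ler_wpM2l.
have e4 : K0 * kap <= K0 by rewrite ler_piMr.
have V2K : `|v - V2| <= K0 * delta.
  apply: (le_trans V2_le); rewrite ler_wpM2r ?(ltW delta_gt0)// /K0.
  by have := v_ge0; lra.
have e5 : Num.sqrt V2 <= K0.
  apply: sqrt_le => //; apply: (@le_trans _ _ K0); last first.
    by rewrite expr2 ler_peMl//; apply: le_trans K0_ge; lra.
  move: V2_le; rewrite distrC ler_norml => /andP[_].
  have : (v + 4 + C + a0) * delta <= (v + 4 + C + a0) * 1.
    rewrite ler_wpM2l// !addr_ge0//.
  rewrite /K0; generalize delta V2 => *; lra.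
have e6 : Num.sqrt V4 <= K0 * kap.
  apply: sqrt_le_delta; apply: (le_trans V4_le).
  rewrite ler_wpM2r ?(ltW delta_gt0)// /K0.
  by have := v_ge0; lra.
have e7 : `|v - V2| <= K0 * kap.
  apply: (le_trans V2K); rewrite ler_wpM2l//.
  exact: le_trans delta_le_sqr kap_sqr_le.
have e8 : (if v == 0 then Num.sqrt V2 else 4 / v * (`|v - V2| + Num.sqrt V4)) <=
    K0 * kap + 8 * (K0 / v) * kap.
  case: ifPn => v0.
    rewrite (eqP v0) invr0 mulr0 mulr0 mul0r addr0; apply: sqrt_le_delta.
    by move: V2K; rewrite (eqP v0) sub0r normrN; exact/le_trans/ler_norm.
  apply: (@le_trans _ _ (4 / v * (K0 * kap + K0 * kap))).
    by rewrite ler_wpM2l ?divr_ge0// lerD.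
  have -> : 4 / v * (K0 * kap + K0 * kap) = 8 * (K0 / v) * kap by field.
  by rewrite lerDr mulr_ge0// ltW.
have e9 : kap * (Num.sqrt V2 + `|b|) <= kap * (K0 + K0).
  by rewrite ler_wpM2l ?(ltW kap_gt0)// lerD// (le_trans e2)// (le_trans e3).
have e10 : C * kap <= K0 * kap.
  by rewrite ler_wpM2r ?(ltW kap_gt0)// /K0; have := v_ge0; have := a0_ge0; lra.
apply: le_trans (_ : (11 + 2 * C) * kap + (2 * kap + 2 * (kap * (K0 + K0)) + K0 * kap +
    (K0 * kap + 8 * (K0 / v) * kap)) <= _).
  apply: lerD h1 (le_trans h2 _); apply: lerD e8.
  apply: lerD; last exact: le_trans e2 e3.
  by apply: lerD e1 _; rewrite -mulrA ler_wpM2l.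
by move: e10; generalize (K0 / v) C K0 => *; lra.
Qed.

End PosteriorDistance.

(** * The Wicksell density *)

Section OpenIntervalFTC.
Context (R : realType).

(** Differentiability is asked only inside the open interval, for antiderivatives such as
    [sqrt (y - z)] that are singular at an end; accordingly the increments of [F] are bounded
    strictly inside. *)
Lemma ge0_integral_itvoo_FTC2 (F f : R -> R) (a b l : R) : a < b ->
  (forall y, a < y < b -> is_derive y 1 F (f y)) ->
  (forall y, a < y < b -> {for y, continuous f}) ->
  (forall y, a < y < b -> 0 <= f y) ->
  (forall s t, a < s -> s < t -> t < b -> F t - F s <= l) ->
  (\int[lebesgue_measure]_(y in `]a, b[) (f y)%:E <= l%:E)%E.
Proof.
(* [e n] is at most a third of the length, so the shrunk intervals never degenerate. *)
move=> ab dF cf f0 Fl; pose e (n : nat) : R := (b - a) / (n%:R + 3).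
have ba : 0 < b - a by rewrite subr_gt0.
have n3 (n : nat) : 0 < n%:R + 3 :> R by rewrite ltr_wpDl.
have e0 n : 0 < e n by rewrite divr_gt0.
have e3 n : 3 * e n <= b - a.
  rewrite /e mulrCA ler_piMr ?(ltW ba)// ler_pdivrMr// mul1r lerDr//.
have abe n : a + e n < b - e n by have := e0 n; have := e3 n; lra.
have inD y : `]a, b[%classic y -> a < y < b by rewrite /= in_itv.
apply: (@ge0_integral_exhaustion_FTC2 R `]a, b[ (fun n => a + e n) (fun n => b - e n) F f) => //.
- by move=> n y /=; rewrite !in_itv/= => /andP[h1 h2]; have := e0 n; lra.
- move=> y /inD/andP[ay yb].
  have c0 : e n @[n --> \oo] --> 0.
    rewrite -[X in _ --> X](mulr0 (b - a)); apply: cvgMr.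
    apply/gtr0_cvgV0; first exact: nearW.
    apply/cvgryPge => K; near=> n; apply: (@le_trans _ _ n%:R); last by rewrite lerDl.
    by near: n; exact: nbhs_infty_ger.
  near=> n.
  have h1 : e n < y - a.
    by near: n; apply: (cvgr_lt _ c0); rewrite subr_gt0.
  have h2 : e n < b - y.
    by near: n; apply: (cvgr_lt _ c0); rewrite subr_gt0.
  by apply/andP; split; lra.
- apply: open_continuous_measurable_fun; first exact: interval_open.
  by move=> y /[!inE] /inD; exact: cf.
- by move=> n; apply: Fl => //; rewrite ?ltrDl// gtrDl oppr_lt0.
Unshelve. all: by end_near. Qed.

End OpenIntervalFTC.

Lemma is_derive_ln_shift (R : realType) (x z : R) : 0 < z - x ->
  is_derive z 1 (fun u : R => ln (u - x)) (z - x)^-1.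
Proof.
move=> zx; have d1 := is_derive1_ln zx.
have d2 : is_derive z 1 (fun u : R => u - x) 1.
  by apply: is_derive_eq; rewrite subr0.
by have := @is_derive1_comp _ (@ln R) (fun u : R => u - x) z _ _ d1 d2; rewrite mulr1.
Qed.

Lemma is_derive_sqrt_rshift (R : realType) (y z : R) : 0 < y - z ->
  is_derive z 1 (fun u : R => Num.sqrt (y - u)) (- (2 * Num.sqrt (y - z))^-1).
Proof.
move=> yz; have d1 := is_derive1_sqrt yz.
have d2 : is_derive z 1 (fun u : R => y - u) (- 1).
  by apply: is_derive_eq; rewrite add0r mul1r.
by have := @is_derive1_comp _ Num.sqrt (fun u : R => y - u) z _ _ d1 d2; rewrite mulrN1.
Qed.

Section WicksellDensity.
Context (R : realType) (F0 : cumulativeBounded (0 : R) (1 : R)).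
Local Notation mu := (@lebesgue_measure R).
Local Notation nu := (lebesgue_stieltjes_measure F0).

(** The integrand of the density as a function of the pair, extended by 0, so that Tonelli's theorem
    can exchange the integrals in [z] and [y]. *)
Definition wicksell_kernel (zy : R * R) : R :=
  if zy.1 < zy.2 then (2 * Num.sqrt (zy.2 ^+ 2 - zy.2 * zy.1))^-1 else 0.

Lemma wicksell_kernel_ge0 zy : 0 <= wicksell_kernel zy.
Proof. by rewrite /wicksell_kernel; case: ifP => // _; rewrite invr_ge0 mulr_ge0// sqrtr_ge0. Qed.

Lemma measurable_wicksell_kernel : measurable_fun setT wicksell_kernel.
Proof.
apply: measurable_fun_ifT => //; first by apply: measurable_fun_ltr.
apply: (measurableT_comp (@measurable_invr R)); apply: measurable_funM => //.
apply: measurableT_comp; first by apply: continuous_measurable_fun; exact: sqrt_continuous.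
apply: measurable_funB; first exact: measurable_funX.
exact: measurable_funM.
Qed.

Lemma wicksell_densityE z :
  wicksell_density F0 z = (\int[nu]_y (wicksell_kernel (z, y))%:E)%E.
Proof.
rewrite /wicksell_density integral_mkcond; apply: eq_integral => y _; rewrite patchE.
rewrite /wicksell_kernel /=; case: ifPn => [|/negP h]; last case: ifP => // zy.
  by rewrite inE/= in_itv/= andbT => ->.
by exfalso; apply: h; rewrite inE/= in_itv/= zy.
Qed.

Lemma measurable_wicksell_density : measurable_fun setT (wicksell_density F0).
Proof.
have := @measurable_fun_fubini_tonelli_F _ _ (measurableTypeR R) (measurableTypeR R) R
  nu (EFin \o wicksell_kernel).
rewrite /fubini_F => h.
have -> : wicksell_density F0 = (fun z => \int[nu]_y (wicksell_kernel (z, y))%:E)%E.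
  by apply/funext => z; exact: wicksell_densityE.
apply: h; last by move=> zy; rewrite /= lee_fin wicksell_kernel_ge0.
exact: (measurable_EFinP _ _).2 measurable_wicksell_kernel.
Qed.

Lemma wicksell_density_ge0 z : (0 <= wicksell_density F0 z)%E.
Proof. by rewrite wicksell_densityE; apply: integral_ge0 => y _; rewrite lee_fin wicksell_kernel_ge0. Qed.

(* With [p = y - x] and [u = z - x]:
   [1 / (u sqrt (p - u)) <= 1 / (u sqrt p) + 1 / (p sqrt (p - u))]. *)
Lemma wicksell_kernel_log_average (x T y : R) : 0 <= x -> 1 < T ->
  (\int[mu]_(z in `](x + T^-1)%R, (x + 1)%R[) (wicksell_kernel (z, y) / (z - x))%:E <=
   ((ln T + 2) * wicksell_kernel (x, y))%:E)%E.
Proof.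
move=> x0 T1; have T0 : 0 < T by apply: lt_trans T1.
have Ti : 0 < T^-1 by rewrite invr_gt0.
have [yx|xy] := leP y (x + T^-1).
  rewrite integral0_eq; last first.
    move=> z /=; rewrite in_itv/= => /andP[xz _].
    by rewrite /wicksell_kernel/= ifF ?mul0r//; apply/negbTE; rewrite -leNgt ltW// (le_lt_trans yx).
  rewrite lee_fin mulr_ge0 ?wicksell_kernel_ge0// addr_ge0// ln_ge0// ltW//.
have y0 : 0 < y by apply: le_lt_trans xy; rewrite addr_ge0// ltW.
have p0 : 0 < y - x by rewrite subr_gt0 (le_lt_trans _ xy)// lerDl ltW.
pose p := y - x; pose c := (2 * Num.sqrt y)^-1.
have c0 : 0 < c by rewrite invr_gt0 mulr_gt0// sqrtr_gt0.
have kE z : z < y -> wicksell_kernel (z, y) = c / Num.sqrt (y - z).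
  move=> zy; rewrite /wicksell_kernel/= zy /c -invfM -mulrA -sqrtrM ?(ltW y0)//.
  by rewrite mulrBr expr2.
have sp0 : 0 < Num.sqrt p by rewrite sqrtr_gt0.
(* The kernel vanishes for [z >= y], so its majorant [f] is integrated only up to [y]. *)
pose b := Num.min (x + 1) y.
have ab : x + T^-1 < b by rewrite /b lt_min xy ltrD2l invf_lt1// T1.
pose F (z : R) := c * (ln (z - x) / Num.sqrt p - 2 * Num.sqrt (y - z) / p).
pose f (z : R) := c * ((z - x)^-1 / Num.sqrt p + (Num.sqrt (y - z))^-1 / p).
have mf : measurable_fun setT f.
  apply: measurable_funM => //; apply: measurable_funD; apply: measurable_funM => //.
    by apply: (measurableT_comp (@measurable_invr R)); exact: measurable_funB.
  apply: (measurableT_comp (@measurable_invr R)); apply: measurableT_comp.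
    by apply: continuous_measurable_fun; exact: sqrt_continuous.
  exact: measurable_funB.
have inD (z : R) : x + T^-1 < z < b -> [/\ 0 < z - x, z - x < 1 & 0 < y - z].
  move=> /andP[]; rewrite lt_min => z1 /andP[z2 z3].
  by split; [rewrite subr_gt0; apply: lt_trans z1; rewrite ltrDl|rewrite ltrBlDl|rewrite subr_gt0].
have f0 z : 0 < z - x -> 0 <= f z.
  move=> z0; rewrite /f mulr_ge0 ?(ltW c0)// addr_ge0// divr_ge0 ?invr_ge0 ?(ltW p0) ?sqrtr_ge0//.
  exact: ltW.
have le1 : (\int[mu]_(z in `](x + T^-1)%R, (x + 1)%R[) (wicksell_kernel (z, y) / (z - x))%:E <=
    \int[mu]_(z in `](x + T^-1)%R, b[) (f z)%:E)%E.
  rewrite integral_mkcond [leRHS]integral_mkcond; apply: ge0_le_integral => //.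
  - move=> z _; rewrite patchE; case: ifPn => // /[!inE]/=; rewrite in_itv/= => /andP[xz _].
    by rewrite lee_fin divr_ge0 ?wicksell_kernel_ge0// subr_ge0 ltW// (lt_trans _ xz)// ltrDl.
  - have mg : measurable_fun setT (fun z => wicksell_kernel (z, y) / (z - x)).
      apply: measurable_funM.
        by apply: (measurableT_comp measurable_wicksell_kernel); exact: measurable_fun_pair.
      by apply: (measurableT_comp (@measurable_invr R)); exact: measurable_funB.
    have mgE := (measurable_EFinP _ _).2 mg.
    exact: ((measurable_restrictT _ (measurable_itv _)).1 (measurable_funTS mgE)).
  - have mfE := (measurable_EFinP _ _).2 mf.
    exact: ((measurable_restrictT _ (measurable_itv _)).1 (measurable_funTS mfE)).
  move=> z _; rewrite !patchE; case: ifPn => [|_]; last first.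
    by case: ifPn => // /[!inE]/=; rewrite in_itv/= => /inD[z0 z1 yz]; rewrite lee_fin f0.
  rewrite inE/= in_itv/= => /andP[xz zx].
  have [zy|yz] := ltP z y; last first.
    rewrite [X in (X%:E <= _)%E](_ : _ = 0); last first.
      by rewrite /wicksell_kernel/= ltNge yz/= mul0r.
    by case: ifPn => // /[!inE]/=; rewrite in_itv/= => /inD[z0 z1 yz']; rewrite lee_fin f0.
  have zb : x + T^-1 < z < b by rewrite xz /b lt_min zx zy.
  rewrite ifT; last by rewrite inE/= in_itv.
  have [z0 z1 yz] := inD _ zb.
  rewrite lee_fin kE// /f -mulrA ler_pM2l//.
  have s0 : 0 < Num.sqrt (y - z) by rewrite sqrtr_gt0.
  have sp : Num.sqrt (y - z) <= Num.sqrt p by rewrite ler_wsqrtr// /p lerD2l lerN2 -subr_ge0 ltW.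
  have pE : p = Num.sqrt p ^+ 2 by rewrite sqr_sqrtr// ltW.
  have zE : z - x = Num.sqrt p ^+ 2 - Num.sqrt (y - z) ^+ 2.
    by rewrite -pE sqr_sqrtr ?ltW// /p; ring.
  have z0' := z0; rewrite zE in z0'.
  rewrite -subr_ge0 zE; have -> : (Num.sqrt (y - z))^-1 / p = (Num.sqrt (y - z))^-1 / Num.sqrt p ^+ 2 by rewrite -pE.
  move: z0' s0 sp0 sp.
  move: (Num.sqrt (y - z)) (Num.sqrt p) => a q a0 s0 q0 aq.
  rewrite (_ : _ - _ = (q - a) / (q ^+ 2 * (q ^+ 2 - a ^+ 2))).
    by rewrite divr_ge0 ?subr_ge0// mulr_ge0 ?sqr_ge0 ?ltW.
  by field; rewrite !gt_eqF.
apply: (le_trans le1).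
apply: (@ge0_integral_itvoo_FTC2 R F f) => //.
- move=> z /inD[z0 z1 yz].
  have d1 := is_derive_ln_shift z0; have d2 := is_derive_sqrt_rshift yz.
  apply: is_derive_eq; rewrite /f /GRing.scale/= ?mulr0 ?add0r ?addr0.
  have : Num.sqrt (y - z) != 0 by rewrite gt_eqF// sqrtr_gt0.
  have : Num.sqrt p != 0 by rewrite gt_eqF.
  have : p != 0 by rewrite gt_eqF.
  have : z - x != 0 by rewrite gt_eqF.
  generalize (Num.sqrt (y - z)) (Num.sqrt p) p (z - x) => a1 a2 a3 a4 h1 h2 h3 h4.
  by field; rewrite h1 h2 h3 h4.
- move=> z /inD[z0 z1 yz].
  apply: cvgMr; apply: cvgD; apply: cvgMl.
    apply: cvgV; first by rewrite gt_eqF.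
    by apply: cvgB; [exact: cvg_id|exact: cvg_cst].
  apply: cvgV; first by rewrite gt_eqF// sqrtr_gt0.
  apply: (@cvg_comp _ _ _ (fun w : R => y - w) Num.sqrt _ (nbhs (y - z))).
    by apply: cvgB; [exact: cvg_cst|exact: cvg_id].
  exact: sqrt_continuous.
- by move=> z /inD[z0 _ _]; exact: f0.
move=> s t xs st tb.
have [s0 _ ys] := inD s (introT andP (conj xs (lt_trans st tb))).
have [t0 t1 yt] := inD t (introT andP (conj (lt_trans xs st) tb)).
have -> : wicksell_kernel (x, y) = c / Num.sqrt p by apply: kE; rewrite -subr_gt0.
have lnt : ln (t - x) <= 0 by apply: ln_le0; rewrite ltW.
have lns : - ln (s - x) <= ln T.
  by rewrite -lnV ?posrE// ler_ln ?posrE ?invr_gt0// invf_ple ?posrE// lerBrDl ltW.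
have sy : Num.sqrt (y - s) <= Num.sqrt p.
  by rewrite ler_wsqrtr// /p lerD2l lerN2 -subr_ge0 ltW.
have pE : p = Num.sqrt p ^+ 2 by rewrite sqr_sqrtr// ltW.
have yt0 := sqrtr_ge0 (y - t).
rewrite /F [_ / p](_ : _ = 2 * Num.sqrt (y - t) / Num.sqrt p / Num.sqrt p); last first.
  by rewrite {1}pE; field; rewrite gt_eqF.
rewrite [2 * Num.sqrt (y - s) / p](_ : _ = 2 * Num.sqrt (y - s) / Num.sqrt p / Num.sqrt p); last first.
  by rewrite {1}pE; field; rewrite gt_eqF.
(* The increment of [F] is compared with [(ln T + 2) c / sqrt p]: the logarithm accounts for at most
   [ln T], the square root for at most 2. *)
rewrite -subr_ge0 (_ : _ - _ = c / Num.sqrt p * ((ln T + ln (s - x)) - ln (t - x) +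
  2 * (1 - Num.sqrt (y - s) / Num.sqrt p) + 2 * (Num.sqrt (y - t) / Num.sqrt p))); last first.
  by field; rewrite gt_eqF.
rewrite mulr_ge0 ?divr_ge0 ?(ltW c0) ?(ltW sp0)//.
have q1 : Num.sqrt (y - s) / Num.sqrt p <= 1 by rewrite ler_pdivrMr// mul1r.
have q2 : 0 <= Num.sqrt (y - t) / Num.sqrt p by rewrite divr_ge0// ltW.
by move: q1 q2 lns lnt; generalize (Num.sqrt (y - s) / Num.sqrt p) (Num.sqrt (y - t) / Num.sqrt p) => *; lra.
Qed.

(** The kernel bound is integrated against [F0] by Tonelli's theorem. The factor of [ln T] is
    [g0(x)] itself rather than the supremum of the density; this is what identifies the limiting
    variance. *)
Lemma wicksell_density_log_average (x T : R) : 0 <= x -> 1 < T ->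
  (\int[mu]_(z in `](x + T^-1)%R, (x + 1)%R[) (wicksell_density F0 z * ((z - x)^-1)%:E) <=
   (ln T + 2)%:E * wicksell_density F0 x)%E.
Proof.
move=> x0 T1.
pose I := `](x + T^-1)%R, (x + 1)%R[%classic.
have mI : measurable I by exact: measurable_itv.
pose q z := if (x + T^-1 < z) && (z < x + 1) then (z - x)^-1 else 0.
have q0 z : 0 <= q z.
  rewrite /q; case: ifP => // /andP[xz _]; rewrite invr_ge0 subr_ge0 ltW//.
  by rewrite (lt_trans _ xz)// ltrDl invr_gt0 (lt_trans _ T1).
have mq : measurable_fun setT q.
  apply: measurable_fun_ifT => //.
    by apply: measurable_and; exact: measurable_fun_ltr.
  by apply: (measurableT_comp (@measurable_invr R)); exact: measurable_funB.
have qE z : (z \in I) = (x + T^-1 < z) && (z < x + 1).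
  by apply/idP/idP => [/set_mem|h]; rewrite /I/= ?in_itv//=; apply: mem_set; rewrite /= in_itv.
pose k (zy : R * R) := wicksell_kernel zy * q zy.1.
have mk : measurable_fun setT k.
  by apply: measurable_funM; [exact: measurable_wicksell_kernel|exact: measurableT_comp].
have k0 zy : 0 <= k zy by rewrite mulr_ge0// wicksell_kernel_ge0.
have mkz z : measurable_fun setT (fun y => (wicksell_kernel (z, y))%:E).
  apply/measurable_EFinP; apply: (measurableT_comp measurable_wicksell_kernel).
  exact: measurable_fun_pair.
have -> : (\int[mu]_(z in I) (wicksell_density F0 z * ((z - x)^-1)%:E) =
    \int[mu]_z \int[nu]_y (k (z, y))%:E)%E.
  rewrite integral_mkcond; apply: eq_integral => z _.
  rewrite patchE wicksell_densityE /k /= qE; have := q0 z; rewrite /q; case: ifPn => _ qz.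
    under [RHS]eq_integral do rewrite EFinM.
    rewrite ge0_integralZr//; first exact: mkz.
    by move=> y _; rewrite lee_fin wicksell_kernel_ge0.
  by rewrite integral0_eq// => y _; rewrite mulr0.
have := @fubini_tonelli _ _ (measurableTypeR R) (measurableTypeR R) R mu nu (EFin \o k).
move=> /= ->; last 2 first.
- exact: (measurable_EFinP _ _).2 mk.
- by move=> zy; rewrite lee_fin.
rewrite wicksell_densityE -ge0_integralZl//; last 3 first.
- exact: mkz.
- by move=> y _; rewrite lee_fin wicksell_kernel_ge0.
- by rewrite lee_fin addr_ge0// ln_ge0// ltW.
apply: ge0_le_integral => //.
- by move=> y _; apply: integral_ge0 => z _; rewrite lee_fin.
- have := @measurable_fun_fubini_tonelli_G _ _ (measurableTypeR R) (measurableTypeR R) R mu (EFin \o k).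
  apply; last by move=> zy; rewrite /= lee_fin.
  exact: (measurable_EFinP _ _).2 mk.
- exact: measurable_funeM (mkz x).
move=> y _; rewrite -EFinM; apply: le_trans (wicksell_kernel_log_average y x0 T1).
rewrite le_eqVlt; apply/orP; left; apply/eqP.
rewrite [RHS]integral_mkcond; apply: eq_integral => z _.
by rewrite patchE /k /q /= qE; case: ifPn => _; rewrite ?mulr0.
Qed.

(** For fixed [y] the kernel [k(z, y)] increases in [z] up to [y]. If [g0(z_n) < v] for points with
    [x <= z_n < x + 1/(n+1)], then [k(x, y) <= k(z_n, y)] for all [y > x + 1/(n+1)], and Fatou's
    lemma yields [g0(x) <= v]. *)
Lemma wicksell_density_lsc (x v : R) : 0 <= x -> (v%:E < wicksell_density F0 x)%E ->
  exists2 del : R, 0 < del &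
    forall z, x <= z < x + del -> (v%:E <= wicksell_density F0 z)%E.
Proof.
move=> x0 vx; apply: contrapT => nex.
pose g (n : nat) y := if x + n.+1%:R^-1 < y then wicksell_kernel (x, y) else 0.
have mk z : measurable_fun setT (fun y => wicksell_kernel (z, y)).
  apply: (measurableT_comp measurable_wicksell_kernel); exact: measurable_fun_pair.
have g0 n y : 0 <= g n y by rewrite /g; case: ifP => // _; exact: wicksell_kernel_ge0.
have mg n : measurable_fun setT (fun y => (g n y)%:E).
  by apply/measurable_EFinP; apply: measurable_fun_ifT => //; exact: measurable_fun_ltr.
have mkE z := (measurable_EFinP _ _).2 (mk z).
suff : (wicksell_density F0 x <= v%:E)%E by rewrite leNgt vx.
rewrite wicksell_densityE.
apply: (@fatou_le _ (measurableTypeR R) _ _ _ (fun n y => (g n y)%:E)) => //.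
- by move=> n y _; rewrite lee_fin.
- move=> y _; have [xy|yx] := ltP x y; last first.
    apply: cvg_near_cst; apply: nearW => n; rewrite /g /wicksell_kernel/= [x < y]ltNge yx/=.
    by case: ifP.
  have yx0 : 0 < y - x by rewrite subr_gt0.
  apply: cvg_near_cst; near=> n; rewrite /g ifT// -ltrBrDl.
  by near: n; exact: (near_infty_natSinv_lt (PosNum yx0)).
move=> n.
have [z [/andP[xz zx] zv]] : exists z, x <= z < x + n.+1%:R^-1 /\ (wicksell_density F0 z < v%:E)%E.
  apply: contrapT => nz; apply: nex; exists n.+1%:R^-1; first by rewrite invr_gt0.
  move=> z hz; rewrite leNgt; apply/negP => zv; apply: nz; by exists z.
apply: le_trans (ltW zv); rewrite wicksell_densityE; apply: ge0_le_integral => //.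
- by move=> y _; rewrite lee_fin.
- exact: mg.
- exact: mkE.
move=> y _; rewrite lee_fin /g; case: ifPn => [xy|_]; last exact: wicksell_kernel_ge0.
have zy : z < y by exact: lt_trans xy.
have xy' : x < y by exact: le_lt_trans zy.
have y0 : 0 < y by exact: le_lt_trans xy'.
have pos u : u < y -> 0 < y ^+ 2 - y * u by move=> uy; rewrite expr2 -mulrBr mulr_gt0// subr_gt0.
rewrite /wicksell_kernel/= zy xy' lef_pV2 ?posrE ?mulr_gt0 ?sqrtr_gt0 ?pos//.
by rewrite ler_pM2l// ler_wsqrtr// lerD2l lerN2 ler_pM2l.
Unshelve. all: by end_near. Qed.

End WicksellDensity.

(** * Moments of the Wicksell law *)

Section WicksellLaw.
Context (R : realType) (F0 : cumulativeBounded (0 : R) (1 : R)) (x B : R)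
  (m : probability R R).
Hypotheses (x_ge0 : 0 <= x) (B_gt0 : 0 < B)
  (m_law : forall A, measurable A -> m A = wicksell_law F0 A)
  (g_le : forall z, 0 <= z -> (wicksell_density F0 z <= B%:E)%E).
Local Notation mu := (@lebesgue_measure R).
Local Notation g := (wicksell_density F0).

Let g_fin z : 0 <= z -> g z \is a fin_num.
Proof.
move=> z0; rewrite ge0_fin_numE ?wicksell_density_ge0//.
by apply: le_lt_trans (g_le z0) _; rewrite ltry.
Qed.

Let mg : measurable_fun setT g := measurable_wicksell_density F0.

Lemma integral_wicksell_law (f : R -> R) : measurable_fun setT f -> (forall z, 0 <= f z) ->
  (\int[m]_z (f z)%:E = \int[mu]_(z in `[0%R, +oo[) ((f z)%:E * g z))%E.
Proof.
move=> mf f0.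
have mD : measurable (`[0%R, +oo[ : set R) by exact: measurable_itv.
have D0 z : `[0, +oo[%classic z -> 0 <= z by rewrite /= in_itv/= andbT.
rewrite (@integral_lebesgue_density R m `[0%R, +oo[ (fun z => fine (g z)))//.
- by apply: eq_integral => z /[!inE] /D0 z0; rewrite fineK// g_fin.
- apply: (measurableT_comp (fine_measurable measurableT)).
  by apply: measurable_funTS; exact: mg.
- by move=> z _; rewrite fine_ge0// wicksell_density_ge0.
- move=> A mA; transitivity (wicksell_law F0 A); first exact: m_law.
  apply: eq_integral => z.
  by rewrite inE => -[_ /D0 z0]; rewrite fineK// g_fin.
- exact/measurable_EFinP.
Qed.

(** Outside []a, x + 1[] the function is at most 1 and contributes at most the total mass; hence the
    [+ 1] in the moment bounds. *)
Lemma integral_wicksell_law_le (f f1 : R -> R) (a K : R) : x <= a ->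
  measurable_fun setT f -> measurable_fun setT f1 -> (forall z, 0 <= f z) ->
  (forall z, a < z < x + 1 -> 0 <= f1 z) ->
  (forall z, f z <= if (a < z) && (z < x + 1) then f1 z else 1) ->
  (\int[mu]_(z in `]a, (x + 1)%R[) ((f1 z)%:E * g z) <= K%:E)%E ->
  (\int[m]_z (f z)%:E <= (K + 1)%:E)%E.
Proof.
move=> xa mf mf1 f0 f10 ff1 fK.
pose f2 z := if (a < z) && (z < x + 1) then f1 z else 0.
have f20 z : 0 <= f2 z by rewrite /f2; case: ifP => // /f10.
have mf2 : measurable_fun setT f2.
  by apply: measurable_fun_ifT => //; apply: measurable_and; exact: measurable_fun_ltr.
apply: (@le_trans _ _ (\int[m]_z (f2 z + 1)%:E)%E).
  apply: ge0_le_integral => //.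
  - by move=> z _; rewrite lee_fin.
  - exact/measurable_EFinP.
  - by apply/measurable_EFinP; exact: measurable_funD.
  - move=> z _; rewrite lee_fin (le_trans (ff1 z))// /f2; case: ifP => _.
      by rewrite lerDl.
    by rewrite add0r.
under eq_integral do rewrite EFinD.
rewrite ge0_integralD//; last 2 first.
- by move=> z _; rewrite lee_fin.
- exact/measurable_EFinP.
rewrite [X in (_ + X)%E](_ : _ = 1%:E) ?EFinD ?leeD2r//; last first.
  by rewrite (integral_cst m measurableT 1%:E) mul1e; exact: probability_setT.
rewrite integral_wicksell_law//; apply: le_trans fK.
rewrite integral_mkcond [leRHS]integral_mkcond le_eqVlt; apply/orP; left; apply/eqP.
apply: eq_integral => z _; rewrite !patchE /f2.
have qE : (z \in `]a, (x + 1)%R[%classic) = (a < z) && (z < x + 1).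
  by apply/idP/idP => [/set_mem|h]; rewrite /= ?in_itv//=; apply: mem_set; rewrite /= in_itv.
rewrite qE; case: ifPn => [_|]; case: ifPn => h //; rewrite ?mul0e//.
move/negP; case; rewrite inE/= in_itv/= andbT.
by move: h => /andP[az _]; rewrite (le_trans x_ge0)// (le_trans xa)// ltW.
Qed.

Lemma integral_wicksell_bounded_density (f1 : R -> R) (a K : R) : x <= a ->
  measurable_fun setT f1 -> (forall z, a < z < x + 1 -> 0 <= f1 z) ->
  (\int[mu]_(z in `]a, (x + 1)%R[) (f1 z)%:E <= K%:E)%E ->
  (\int[mu]_(z in `]a, (x + 1)%R[) ((f1 z)%:E * g z) <= (B * K)%:E)%E.
Proof.
move=> xa mf1 f10 fK.
have mf1E := (measurable_EFinP setT _).2 mf1.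
apply: (@le_trans _ _ (\int[mu]_(z in `]a, (x + 1)%R[) (B%:E * (f1 z)%:E))%E).
  apply: ge0_le_integral => //.
  - by move=> z /=; rewrite in_itv/= => /f10 z0; rewrite mule_ge0 ?lee_fin ?wicksell_density_ge0.
  - apply: measurable_funTS; exact: (emeasurable_funM mf1E mg).
  - apply: measurable_funTS; exact: (measurable_funeM _ mf1E).
  - move=> z /=; rewrite in_itv/= => /[dup] /f10 z0 /andP[az _].
    rewrite muleC lee_wpmul2r ?lee_fin// g_le// (le_trans x_ge0)// (le_trans xa)// ltW//.
rewrite ge0_integralZl ?lee_fin ?(ltW B_gt0)//; last first.
  by apply: measurable_funTS; exact: mf1E.
by rewrite EFinM lee_wpmul2l// lee_fin ltW.
Qed.

(** The event is the interval []x, x + 1/T]], of length [1/T]. *)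
Lemma wicksell_law_tail (T : R) : 0 < T ->
  (m [set z | (T <= isqrt x z ^+ 2)%R] <= (B / T)%:E)%E.
Proof.
move=> T0.
have -> : [set z | T <= isqrt x z ^+ 2] = `]x, (x + T^-1)%R]%classic.
  apply/seteqP; split => z /=; rewrite in_itv/=.
    have [zx|xz] := leP z x; first by rewrite isqrt0// expr0n/= leNgt T0.
    rewrite /isqrt exprVn sqr_sqrtr ?subr_ge0 ?(ltW xz)// -lef_pV2 ?posrE ?invr_gt0 ?subr_gt0//.
    by rewrite invrK lerBlDl.
  move=> /andP[xz zT].
  rewrite /isqrt exprVn sqr_sqrtr ?subr_ge0 ?(ltW xz)// -lef_pV2 ?posrE ?invr_gt0 ?subr_gt0//.
  by rewrite invrK lerBlDl.
rewrite m_law// /wicksell_law setIidl; last first.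
  by move=> z /=; rewrite !in_itv/= andbT => /andP[xz _]; rewrite (le_trans x_ge0)// ltW.
apply: (@le_trans _ _ (\int[mu]_(z in `]x, (x + T^-1)%R]) (cst B%:E z))%E).
  apply: ge0_le_integral => //.
  - by move=> z _; exact: wicksell_density_ge0.
  - apply: measurable_funTS; exact: mg.
  - move=> z /=; rewrite in_itv/= => /andP[xz _]; apply: g_le.
    by rewrite (le_trans x_ge0)// ltW.
have e : (mu `]x, (x + T^-1)%R] = (T^-1)%:E)%E.
  by rewrite lebesgue_measure_itv/= lte_fin ltrDl invr_gt0 T0 -EFinD addrAC subrr add0r.
rewrite (@integral_cst _ (measurableTypeR R) R mu _ (measurable_itv _) B%:E).
by rewrite EFinM [X in (_ * X <= _)%E]e.
Qed.

(** Large values are replaced by 0, not by [T]: for [T > 1] the result is [1 / (z - x)] on []x +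
    1/T, x + 1[] and at most 1 elsewhere. *)
Definition sqr_trunc (T z : R) : R := if isqrt x z ^+ 2 < T then isqrt x z ^+ 2 else 0.

Lemma sqr_trunc_ge0 T z : 0 <= sqr_trunc T z.
Proof. by rewrite /sqr_trunc; case: ifP => // _; exact: sqr_ge0. Qed.

Lemma measurable_sqr_trunc T : measurable_fun setT (sqr_trunc T).
Proof.
have mi : measurable_fun setT (fun z => isqrt x z ^+ 2).
  by apply: measurable_funX; exact: measurable_isqrt.
by apply: measurable_fun_ifT => //; exact: measurable_fun_ltr.
Qed.

Lemma isqrt_sqr z : x < z -> isqrt x z ^+ 2 = (z - x)^-1.
Proof. by move=> xz; rewrite /isqrt exprVn sqr_sqrtr// subr_ge0 ltW. Qed.

Lemma sqr_trunc_le1 T z : 1 < T ->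
  ~~ ((x + T^-1 < z) && (z < x + 1)) -> sqr_trunc T z <= 1.
Proof.
move=> T1; rewrite negb_and -!leNgt => /orP[zT|xz].
  have [zx|xz] := leP z x.
    by rewrite /sqr_trunc; case: ifP => // _; rewrite isqrt0// expr0n.
  rewrite /sqr_trunc ifF// isqrt_sqr//; apply/negbTE; rewrite -leNgt.
  by rewrite -[T]invrK lef_pV2 ?posrE ?invr_gt0 ?subr_gt0 ?(lt_trans _ T1)// lerBlDl.
have xz' : x < z by apply: lt_le_trans xz; rewrite ltrDl.
rewrite /sqr_trunc; case: ifP => // _; rewrite isqrt_sqr// invf_le1 ?subr_gt0// lerBrDl//.
Qed.

Lemma sqr_truncE T z : 1 < T -> (x + T^-1 < z) && (z < x + 1) -> sqr_trunc T z = (z - x)^-1.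
Proof.
move=> T1 /andP[xz _].
have xz' : x < z by apply: lt_trans xz; rewrite ltrDl invr_gt0 (lt_trans _ T1).
rewrite /sqr_trunc isqrt_sqr// ifT// -[T]invrK ltf_pV2 ?posrE ?invr_gt0 ?subr_gt0 ?(lt_trans _ T1)//.
by rewrite ltrBrDl.
Qed.

Let minv : measurable_fun setT (fun z : R => (z - x)^-1).
Proof. by apply: (measurableT_comp (@measurable_invr R)); exact: measurable_funB. Qed.

Let xT T : 1 < T -> x <= x + T^-1.
Proof. by move=> T1; rewrite lerDl invr_ge0 ltW// (lt_trans _ T1). Qed.

Lemma integral_sqr_trunc_le (T : R) : 1 < T ->
  (\int[m]_z (sqr_trunc T z)%:E <= (fine (g x) * (ln T + 2) + 1)%:E)%E.
Proof.
move=> T1; apply: (@integral_wicksell_law_le _ (fun z => (z - x)^-1) (x + T^-1)) => //.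
- exact: xT.
- exact: measurable_sqr_trunc.
- exact: sqr_trunc_ge0.
- move=> z /andP[xz _]; rewrite invr_ge0 subr_ge0 ltW//.
  by apply: le_lt_trans xz; exact: xT.
- by move=> z; case: ifPn => h; [rewrite sqr_truncE|exact: sqr_trunc_le1].
under eq_integral do rewrite muleC.
rewrite mulrC EFinM fineK ?g_fin//; exact: wicksell_density_log_average.
Qed.

(** The integral of [(z - x)^-2] from [x + 1/T] on is at most [T]. With [T] proportional to [n], the
    variance of the truncated sum is of order at most [n^2], negligible against [(n L)^2]. *)
Lemma integral_sqr_trunc2_le (T : R) : 1 < T ->
  (\int[m]_z (sqr_trunc T z ^+ 2)%:E <= (B * T + 1)%:E)%E.
Proof.
move=> T1; have T0 : 0 < T by apply: lt_trans T1.
have pos z : (x + T^-1 < z) && (z < x + 1) -> 0 < z - x.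
  by move=> /andP[xz _]; rewrite subr_gt0; apply: le_lt_trans xz; exact: xT.
apply: (@integral_wicksell_law_le _ (fun z => (z - x)^-1 ^+ 2) (x + T^-1)) => //.
- exact: xT.
- by apply: measurable_funX; exact: measurable_sqr_trunc.
- exact: measurable_funX.
- by move=> z; exact: sqr_ge0.
- by move=> z _; exact: sqr_ge0.
- move=> z; case: ifPn => h; first by rewrite sqr_truncE.
  by apply: exprn_ile1; [exact: sqr_trunc_ge0|exact: sqr_trunc_le1].
apply: integral_wicksell_bounded_density; first exact: xT.
- exact: measurable_funX.
- by move=> z _; exact: sqr_ge0.
apply: (@ge0_integral_itvoo_FTC2 R (fun z => - (z - x)^-1)).
- by rewrite ltrD2l invf_lt1.
- move=> z /pos z0; have d1 : is_derive z 1 (fun u : R => u - x) 1.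
    by apply: is_derive_eq; rewrite subr0.
  have z1 : z - x != 0 by rewrite gt_eqF.
  have d2 := is_deriveV (f := fun u : R => u - x) z1 d1.
  apply: is_derive_eq; rewrite /GRing.scale/= mulr1.
  by field; rewrite gt_eqF.
- move=> z /pos z0; apply: (@cvg_comp _ _ _ (fun u : R => (u - x)^-1) (fun w => w ^+ 2) _ (nbhs (z - x)^-1)); last first.
    exact: exprn_continuous.
  apply: cvgV; first by rewrite gt_eqF.
  by apply: cvgB; [exact: cvg_id|exact: cvg_cst].
- by move=> z _; exact: sqr_ge0.
move=> s t xs st tx.
have t0 : 0 < t - x by apply: pos; rewrite tx (lt_trans xs).
have s0 : 0 < s - x by apply: pos; rewrite xs (lt_trans st).
have h : (s - x)^-1 <= T.
  by rewrite -[T]invrK lef_pV2 ?posrE ?invr_gt0// lerBrDl ltW.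
by rewrite opprK addrC lerBlDr (le_trans h)// lerDl invr_ge0 ltW.
Qed.

Lemma integral_isqrt_le : (\int[m]_z (isqrt x z)%:E <= (B * 2 + 1)%:E)%E.
Proof.
have misq := measurable_isqrt x.
have pos z : (x < z) && (z < x + 1) -> 0 < z - x.
  by move=> /andP[xz _]; rewrite subr_gt0.
apply: (@integral_wicksell_law_le _ (isqrt x) x) => //.
- by move=> z; exact: isqrt_ge0.
- by move=> z _; exact: isqrt_ge0.
- move=> z; case: ifPn => //; rewrite negb_and -!leNgt => /orP[zx|xz].
    by rewrite isqrt0.
  by rewrite /isqrt invf_le1 ?sqrtr_gt0 ?subr_gt0 ?(lt_le_trans _ xz) ?ltrDl// -[leLHS]sqrtr1 ler_wsqrtr// lerBrDl.
apply: integral_wicksell_bounded_density => //.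
  by move=> z _; exact: isqrt_ge0.
apply: (@ge0_integral_itvoo_FTC2 R (fun z => 2 * Num.sqrt (z - x))).
- by rewrite ltrDl.
- move=> z /pos z0.
  have d1 : is_derive z 1 (fun u : R => u - x) 1.
    by apply: is_derive_eq; rewrite subr0.
  have d2 := is_derive1_sqrt z0.
  have d3 := @is_derive1_comp _ Num.sqrt (fun u : R => u - x) z _ _ d2 d1.
  apply: is_derive_eq; rewrite /GRing.scale/= /isqrt.
  by field; rewrite gt_eqF// sqrtr_gt0.
- move=> z /pos z0; apply: cvgV; first by rewrite gt_eqF// sqrtr_gt0.
  apply: (@cvg_comp _ _ _ (fun w : R => w - x) Num.sqrt _ (nbhs (z - x))).
    by apply: cvgB; [exact: cvg_id|exact: cvg_cst].
  exact: sqrt_continuous.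
- by move=> z _; exact: isqrt_ge0.
move=> s t xs st tx; rewrite lerBlDr (@le_trans _ _ 2)//; last by rewrite lerDl mulr_ge0// sqrtr_ge0.
by rewrite -[leRHS]mulr1 ler_wpM2l// -[leRHS]sqrtr1 ler_wsqrtr// lerBlDl ltW.
Qed.

Lemma integral_sqr_trunc_ge (v : R) : 0 <= v -> v < fine (g x) ->
  exists c : R, forall T, 1 < T -> ((v * (ln T - c))%:E <= \int[m]_z (sqr_trunc T z)%:E)%E.
Proof.
move=> v0 vg.
have vg' : (v%:E < g x)%E by rewrite -[g x]fineK ?g_fin// lte_fin.
have [del' del'0 delg'] := wicksell_density_lsc x_ge0 vg'.
pose del := Num.min del' 1.
have del0 : 0 < del by rewrite /del lt_min del'0 ltr01.
have del1 : del <= 1 by rewrite /del ge_min lexx orbT.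
have deld : del <= del' by rewrite /del ge_min lexx.
(* The integral of [v / (z - x)] over [[x + 2/T, x + del/2]] is [v ln (T del / 4)]. The factors 2
   keep this interval strictly inside the region where the truncation is inactive and [g0 >= v]. For
   [T <= 4 / del] the lower bound is at most 0. *)
exists (ln (4 / del)) => T T1; have T0 : 0 < T by apply: lt_trans T1.
have [Td|dT] := leP T (4 / del).
  apply: (@le_trans _ _ 0%E).
    by rewrite lee_fin mulr_ge0_le0// subr_le0 ler_ln ?posrE// divr_gt0.
  by apply: integral_ge0 => z _; rewrite lee_fin sqr_trunc_ge0.
pose a := x + 2 / T; pose b := x + del / 2.
have ab : a < b.
  rewrite /a /b ltrD2l ltr_pdivrMr// mulrAC ltr_pdivlMr//.
  by move: dT; rewrite ltr_pdivrMr// mulrC; lra.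
have inJ z : a <= z <= b -> [/\ 0 < z - x, x <= z < x + del' & (x + T^-1 < z) && (z < x + 1)].
  have Ti : 0 < T^-1 by rewrite invr_gt0.
  rewrite /a /b => /andP[h1 h2]; split.
  - lra.
  - by apply/andP; split; lra.
  - by apply/andP; split; lra.
rewrite integral_wicksell_law; [|exact: measurable_sqr_trunc|exact: sqr_trunc_ge0].
apply: (@le_trans _ _ (\int[mu]_(z in `[a, b]) ((sqr_trunc T z)%:E * g z))%E); last first.
  apply: ge0_subset_integral => //.
  - apply: measurable_funTS.
    exact: (emeasurable_funM ((measurable_EFinP _ _).2 (measurable_sqr_trunc T)) mg).
  - by move=> z _; rewrite mule_ge0 ?lee_fin ?sqr_trunc_ge0 ?wicksell_density_ge0.
  - move=> z /=; rewrite !in_itv/= andbT => /inJ[_ /andP[xz _] _].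
    exact: le_trans xz.
apply: (@le_trans _ _ (\int[mu]_(z in `[a, b]) (v / (z - x))%:E)%E); last first.
  apply: ge0_le_integral => //.
  - by move=> z /=; rewrite in_itv/= => /inJ[z0 _ _]; rewrite lee_fin divr_ge0// ltW.
  - have mv : measurable_fun setT (fun z : R => v / (z - x)) by exact: measurable_funM.
    apply: measurable_funTS; exact: ((measurable_EFinP _ _).2 mv).
  - apply: measurable_funTS.
    exact: (emeasurable_funM ((measurable_EFinP _ _).2 (measurable_sqr_trunc T)) mg).
  - move=> z /=; rewrite in_itv/= => /inJ[z0 z1 z2]; rewrite sqr_truncE// EFinM muleC.
    by rewrite lee_wpmul2l ?lee_fin ?invr_ge0 ?(ltW z0)//; exact: delg'.
rewrite [leRHS](_ : _ = (v * ln (b - x) - v * ln (a - x))%:E).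
  rewrite lee_fin -mulrBr ler_wpM2l// /a /b.
  rewrite [x + del / 2]addrC [x + 2 / T]addrC !addrK.
  rewrite -!ln_div ?posrE ?divr_gt0//.
  rewrite (_ : T / (4 / del) = del / 2 / (2 / T))//.
  by field; rewrite !gt_eqF.
apply: (@integral_itv_FTC2 R (fun z : R => v * ln (z - x)) (fun z : R => v / (z - x))) => //.
- move=> z /inJ[z0 _ _]; have d1 := is_derive_ln_shift z0.
  by apply: is_derive_eq; rewrite /GRing.scale/= ?mulr0 ?addr0 ?add0r.
- move=> z /inJ[z0 _ _]; apply: cvgMr; apply: cvgV; first by rewrite gt_eqF.
  by apply: cvgB; [exact: cvg_id|exact: cvg_cst].
Qed.

End WicksellLaw.

(** * Laws of large numbers *)

Lemma markov_le d (W : measurableType d) (R : realType) (P : probability W R)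
    (X : W -> R) (K t : R) : measurable_fun setT X -> (forall w, 0 <= X w) -> 0 < t ->
  (\int[P]_w (X w)%:E <= K%:E)%E ->
  (P [set w | (t <= X w)%R] <= (K / t)%:E)%E.
Proof.
move=> mX X0 t0 XK; set E := [set w | _].
have mE : measurable E.
  by rewrite -[E]setTI; apply: measurable_fun_ler.
rewrite -[X in (P X <= _)%E]setIT -integral_indic// mulrC EFinM.
apply: (@le_trans _ _ (t^-1%:E * \int[P]_w (X w)%:E)%E); last first.
  by rewrite lee_wpmul2l// lee_fin invr_ge0 ltW.
rewrite -ge0_integralZl ?lee_fin ?invr_ge0 ?(ltW t0)//; last 2 first.
- exact/measurable_EFinP.
- by move=> w _; rewrite lee_fin.
apply: ge0_le_integral => //.
- by apply/measurable_EFinP; exact: measurable_indic.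
- by apply: measurable_funeM; exact/measurable_EFinP.
move=> w _; rewrite -EFinM lee_fin indicE; have [|_] := boolP (w \in E).
  by rewrite inE /E /= mulrC ler_pdivlMr// mul1r.
by rewrite mulr_ge0// invr_ge0 ltW.
Qed.

Lemma independent_pair d (W : measurableType d) (R : realType) (P : probability W R)
    (Z : nat -> {RV P >-> R}) (i j : nat) (B C : set R) :
  mutually_independent P Z -> i != j -> measurable B -> measurable C ->
  P (Z i @^-1` B `&` Z j @^-1` C) = (P (Z i @^-1` B) * P (Z j @^-1` C))%E.
Proof.
move=> indZ ij mB mC; pose A k := if k == i then B else C.
have mA k : measurable (A k) by rewrite /A; case: ifP.
have := indZ [fset i; j]%fset A mA.
rewrite big_fsetU1 ?inE// big_seq_fset1 /A eqxx eq_sym (negbTE ij) => <-.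
congr (P _); apply/seteqP; split => w /=.
  move=> [Bi Cj] k /=; rewrite !inE => /orP[/eqP->|/eqP->]; first by rewrite eqxx.
  by rewrite eq_sym (negbTE ij).
move=> h; split; first by have := h i; rewrite /= !inE eqxx; exact.
by have := h j; rewrite /= !inE eqxx orbT eq_sym (negbTE ij); exact.
Qed.

Section WeakLaw.
Context d (W : measurableType d) (R : realType) (P : probability W R)
  (Z : nat -> {RV P >-> R}) (phi : R -> R) (K e s : R).
Hypotheses (indZ : mutually_independent P Z) (mphi : measurable_fun setT phi)
  (phi_ge0 : forall z, 0 <= phi z) (phi_le : forall z, phi z <= K)
  (phi_mean : forall i, \int[P]_w phi (Z i w) = e)
  (phi_sqr : forall i, (\int[P]_w (phi (Z i w) ^+ 2)%:E <= s%:E)%E).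

Let Y i w := phi (Z i w) - e.

Let sphi i : sq_integrable P (fun w => phi (Z i w)).
Proof.
apply: (@sq_integrable_le _ _ _ _ _ (fun=> 0) K 0); last 2 first.
- exact: sq_integrable_cst.
- by move=> w; rewrite mul0r addr0 ger0_norm.
exact: measurableT_comp.
Qed.

Let sY i : sq_integrable P (Y i).
Proof. apply: sq_integrableB; [exact: sphi|exact: sq_integrable_cst]. Qed.

Let cov0 i j : i != j -> \int[P]_w (Y i w * Y j w) = 0.
Proof.
move=> ij; pose psi (u : R * R) := (phi u.1 - e) * (phi u.2 - e).
have mpsi : measurable_fun setT psi.
  by apply: measurable_funM; apply: measurable_funB => //; exact: measurableT_comp.
have ipsi : P.-integrable setT (EFin \o (fun w => psi (Z i w, Z j w))).
  exact: (sq_integrableM (sY i) (sY j)).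
rewrite /Rintegral (Rintegral_independent (fun B C mB mC => independent_pair indZ ij mB mC) mpsi ipsi).
rewrite integral0_eq// => r _.
have mpr : measurable_fun setT (fun y => psi (y, r)).
  by rewrite /psi/=; apply: measurable_funM; [exact: measurable_funB|exact: measurable_cst].
have ipr : P.-integrable setT (EFin \o (fun w => psi (Z i w, r))).
  apply: sq_integrable_integrable; rewrite /psi/=.
  have -> : (fun w => (phi (Z i w) - e) * (phi r - e)) = (fun w => (phi r - e) * Y i w).
    by apply/funext => w; rewrite mulrC.
  exact: sq_integrableZ.
rewrite integral_distribution//; last exact/measurable_EFinP.
rewrite -[LHS]fineK; last exact: integrable_fin_num.
congr EFin; transitivity (\int[P]_w ((phi r - e) * Y i w)).
  by apply: eq_Rintegral => w _; rewrite mulrC.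
rewrite RintegralZl//; last exact: sq_integrable_integrable.
rewrite RintegralB//; [|exact: sq_integrable_integrable|exact: finite_measure_integrable_cst].
by rewrite phi_mean Rintegral_prob_cst subrr mulr0.
Qed.

Let var_le i : \int[P]_w (Y i w * Y i w) <= s.
Proof.
have -> : \int[P]_w (Y i w * Y i w) =
    \int[P]_w (phi (Z i w) ^+ 2 + ((- 2 * e) * phi (Z i w) + e ^+ 2)).
  by apply: eq_Rintegral => w _; rewrite /Y; ring.
have i1 := sq_integrable_integrable (sphi i).
have i2 : P.-integrable setT (EFin \o (fun w => - 2 * e * phi (Z i w))).
  exact: (integrableZl measurableT _ i1).
have i3 : P.-integrable setT (EFin \o (fun=> e ^+ 2)) by exact: finite_measure_integrable_cst.
rewrite RintegralD//; [|exact: (sphi i).2|exact: (integrableD measurableT i2 i3)].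
rewrite RintegralD// RintegralZl// phi_mean Rintegral_prob_cst.
have h : \int[P]_w (phi (Z i w) ^+ 2) <= s.
  rewrite -lee_fin /Rintegral fineK; first exact: phi_sqr.
  exact: integrable_fin_num (sphi i).2.
by have := sqr_ge0 e; lra.
Qed.

(** Pairwise independence removes the cross terms, and each variance is at most the second moment
    [s]; Chebyshev's inequality concludes. *)
Lemma weak_law (n : nat) (t : R) : 0 < t ->
  (P [set w | (t <= `|\sum_(i < n) phi (Z i w) - n%:R * e|)%R] <=
   (n%:R * s / t ^+ 2)%:E)%E.
Proof.
move=> t0; pose S w := \sum_(i < n) Y i w.
have SE w : \sum_(i < n) phi (Z i w) - n%:R * e = S w.
  by rewrite /S /Y sumrB sumr_const card_ord mulr_natl.
have sS : sq_integrable P S by apply: sq_integrable_sum => i _; exact: sY.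
have -> : [set w | (t <= `|\sum_(i < n) phi (Z i w) - n%:R * e|)%R] =
    [set w | (t ^+ 2 <= S w ^+ 2)%R].
  apply/seteqP; split => w /=; rewrite SE -(real_normK (num_real (S w))).
    by rewrite ler_sqr ?nnegrE// ltW.
  by rewrite ler_sqr ?nnegrE// ltW.
apply: markov_le.
- by apply: measurable_funX; exact: sS.1.
- by move=> w; exact: sqr_ge0.
- exact: exprn_gt0.
rewrite -[leLHS]fineK; last exact: integrable_fin_num sS.2.
rewrite lee_fin; change (\int[P]_w (S w ^+ 2) <= n%:R * s).
have -> : \int[P]_w (S w ^+ 2) = \sum_(i < n) \sum_(j < n) \int[P]_w (Y i w * Y j w).
  transitivity (\int[P]_w (\sum_(i < n) \sum_(j < n) Y i w * Y j w)).
    apply: eq_Rintegral => w _; rewrite expr2 {1}/S mulr_suml.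
    by apply: eq_bigr => i _; rewrite mulr_sumr.
  rewrite Rintegral_sum; last first.
    move=> i _; have := @integrable_sum _ _ _ P setT measurableT _ (index_enum 'I_n) xpredT
      (fun j => EFin \o (fun w => Y i w * Y j w)) (fun j _ => sq_integrableM (sY i) (sY j)).
    by apply: eq_integrable => // w _ /=; rewrite sumEFin.
  by apply: eq_bigr => i _; rewrite Rintegral_sum// => j _; exact: sq_integrableM.
apply: (@le_trans _ _ (\sum_(i < n) s)); last by rewrite sumr_const card_ord mulr_natl.
apply: ler_sum => i _; rewrite (bigD1 i)//= big1 ?addr0// => j ji.
by apply: cov0; rewrite eq_sym.
Qed.

End WeakLaw.

(** * Inequalities satisfied by the observations with high probability *)

Section WicksellSample.
Context (R : realType) (F0 : cumulativeBounded (0 : R) (1 : R)) (x B : R)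
  d (W : measurableType d) (P : probability W R) (Z : nat -> {RV P >-> R}).
Hypotheses (x_ge0 : 0 <= x) (B_gt0 : 0 < B) (Z_iid : iid Z (wicksell_law F0))
  (g_le : forall z, 0 <= z -> (wicksell_density F0 z <= B%:E)%E).
Let v := fine (wicksell_density F0 x).

Let Z_law i A : measurable A -> distribution P (Z i) A = wicksell_law F0 A.
Proof. exact: Z_iid.2. Qed.

Let ge0_integral_Z (f : R -> R) i : measurable_fun setT f -> (forall z, 0 <= f z) ->
  (\int[P]_w (f (Z i w))%:E = \int[distribution P (Z i)]_z (f z)%:E)%E.
Proof.
move=> mf f0; rewrite ge0_integral_distribution//; exact/measurable_EFinP.
Qed.

(** [E] is a union of four events of probability at most [eps / 4]: some observation is truncated,
    the truncated sum deviates from its mean, the sum of its squared terms is large, the mean of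
    [isqrt] is large. Off the first event the truncated values are the actual ones. *)
Lemma wicksell_sample_events (eps del : R) : 0 < eps -> 0 < del ->
  exists n0 : nat, forall n : nat, (n0 <= n)%N ->
  exists2 E : set W, measurable E /\ (P E <= eps%:E)%E & forall w, ~ E w ->
    let h i := isqrt x (Z i w) in
    [/\ `|(\sum_(i < n) h i ^+ 2) / (n%:R * ln n%:R) - v| <= del,
        \sum_(i < n) h i ^+ 4 <= del * (n%:R * ln n%:R) ^+ 2 &
        (n%:R^-1 * \sum_(i < n) h i + 1) ^+ 2 <= del * ln n%:R].
Proof.
move=> eps0 del0.
have v0 : 0 <= v by rewrite fine_ge0// wicksell_density_ge0.
(* Some observation reaches the level [T = n K] with probability at most [n B / T = B / K], which
   this choice puts below [eps / 4]. As [K] is independent of [n], [ln T = L + ln K] is still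
   asymptotic to [L]. *)
pose K := 4 * B / eps + 1.
have K1 : 1 < K by rewrite /K ltrDr divr_gt0// mulr_gt0.
have K0 : 0 < K by apply: lt_trans K1.
have BK : B / K <= eps / 4.
  by rewrite ler_pdivrMr// /K mulrDr mulr1 (_ : eps / 4 * _ = B) ?lerDl ?divr_ge0 ?(ltW eps0)//; field; rewrite gt_eqF.
(* The mean may fall short of [v L] by [del L / 2]: half of this pays for the slope [v'], half for
   the constant [v |c|]. If [v' < 0], the required lower bound is at most 0. *)
pose v' := v - del / 4.
have [c cP] : exists c : R, 0 <= v' -> forall T, 1 < T ->
    ((v' * (ln T - c))%:E <= \int[distribution P (Z 0%N)]_z (sqr_trunc x T z)%:E)%E.
  have [v'0|v'0] := leP 0 v'; last by exists 0.
  have v'v : v' < v by rewrite /v' ltrBlDr ltrDl divr_gt0.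
  by have [c cP] := integral_sqr_trunc_ge x_ge0 (Z_law 0%N) g_le v'0 v'v; exists c.
pose q := 4 * (B * 2 + 1) / eps.
have q0 : 0 < q by rewrite divr_gt0// mulr_gt0// addr_gt0// mulr_gt0.
(* All summands are nonnegative, so [L0 <= L] implies every threshold at once: [L >= 1], then those
   for [Eb] and [Ec], for the last conclusion, and for the upper and lower bounds on the mean
   [e]. *)
pose L0 := 1 + 16 * (B * K + 1) / (del ^+ 2 * eps) + 4 * (B * K + 1) / (del * eps) +
  (q + 1) ^+ 2 / del + 2 * (v * (ln K + 2) + 1) / del + 4 * v * `|c| / del.
exists (Num.truncn (expR L0)).+1 => n n0.
pose N : R := n%:R; pose L := ln N.
have NL0 : expR L0 <= N.
  by rewrite (le_trans (ltW (truncnS_gt _)))// ler_nat.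
have N0 : 0 < N by apply: lt_le_trans (expR_gt0 _) NL0.
have n_gt0 : (0 < n)%N by rewrite -(ltr0n R).
have LL0 : L0 <= L by rewrite -ler_expR /L lnK ?posrE.
have p1 : 0 <= 16 * (B * K + 1) / (del ^+ 2 * eps).
  by rewrite divr_ge0 ?mulr_ge0 ?addr_ge0 ?mulr_ge0 ?sqr_ge0 ?ltW.
have p2 : 0 <= 4 * (B * K + 1) / (del * eps).
  by rewrite divr_ge0 ?mulr_ge0 ?addr_ge0 ?mulr_ge0 ?ltW.
have p3 : 0 <= (q + 1) ^+ 2 / del by rewrite divr_ge0 ?sqr_ge0// ltW.
have lnK0 : 0 <= ln K by rewrite ln_ge0// ltW.
have p4 : 0 <= 2 * (v * (ln K + 2) + 1) / del.
  by rewrite divr_ge0 ?mulr_ge0 ?addr_ge0 ?mulr_ge0 ?addr_ge0// ltW.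
have p5 : 0 <= 4 * v * `|c| / del by rewrite divr_ge0 ?mulr_ge0// ltW.
have L1 : 1 <= L by apply: le_trans LL0; rewrite /L0; lra.
have b1 : 16 * (B * K + 1) / (del ^+ 2 * eps) <= L by apply: le_trans LL0; rewrite /L0; lra.
have b2 : 4 * (B * K + 1) / (del * eps) <= L by apply: le_trans LL0; rewrite /L0; lra.
have b3 : (q + 1) ^+ 2 / del <= L by apply: le_trans LL0; rewrite /L0; lra.
have b4 : 2 * (v * (ln K + 2) + 1) / del <= L by apply: le_trans LL0; rewrite /L0; lra.
have b5 : 4 * v * `|c| / del <= L by apply: le_trans LL0; rewrite /L0; lra.
have {L0 n0 NL0 LL0 p1 p2 p3 p4 p5} L_gt0 : 0 < L by apply: lt_le_trans L1.
have N1 : 1 <= N by rewrite ler1n.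
pose T := N * K.
have T1 : 1 < T by rewrite (lt_le_trans K1)// ler_peMl// ltW.
have T0 : 0 < T by apply: lt_trans T1.
pose phi := sqr_trunc x T.
have mphi : measurable_fun setT phi by exact: measurable_sqr_trunc.
have phi0 z : 0 <= phi z by exact: sqr_trunc_ge0.
have phiT z : phi z <= T.
  by rewrite /phi /sqr_trunc; case: ifP => [/ltW//|_]; exact: ltW.
pose e := \int[distribution P (Z 0%N)]_z phi z.
have phiE i : \int[P]_w phi (Z i w) = e.
  rewrite /e /Rintegral ge0_integral_Z//; congr fine.
  by apply: eq_measure_integral => A mA _; exact: etrans (Z_law i mA) (esym (Z_law 0%N mA)).
have s_le i : (\int[P]_w (phi (Z i w) ^+ 2)%:E <= (B * T + 1)%:E)%E.
  rewrite (@ge0_integral_Z (fun z => phi z ^+ 2))//.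
  - exact: (integral_sqr_trunc2_le x_ge0 B_gt0 (Z_law i) g_le T1).
  - exact: measurable_funX.
  - by move=> z; exact: sqr_ge0.
have eE : e%:E = (\int[distribution P (Z 0%N)]_z (phi z)%:E)%E.
  rewrite /e /Rintegral fineK// ge0_fin_numE; last by apply: integral_ge0 => z _; rewrite lee_fin.
  by apply: le_lt_trans (integral_sqr_trunc_le x_ge0 (Z_law 0%N) g_le T1) _; rewrite ltry.
have e_le : e <= (v + del / 2) * L.
  have h : e <= v * (ln T + 2) + 1.
    by rewrite -lee_fin eE; exact: (integral_sqr_trunc_le x_ge0 (Z_law 0%N) g_le T1).
  have lnT : ln T = L + ln K by rewrite /T lnM.
  move: b4; rewrite ler_pdivrMr//; move: h; rewrite lnT; generalize (ln K) e => ? ? h1 h2; lra.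
have e_ge : (v - del / 2) * L <= e.
  have [v'0|v'0] := leP 0 v'; last first.
    apply: (@le_trans _ _ 0); last by apply: Rintegral_ge0.
    by rewrite mulr_le0_ge0 ?(ltW L_gt0)//; move: v'0; rewrite /v'; have := del0; lra.
  have h : v' * (ln T - c) <= e.
    by rewrite -lee_fin eE; exact: (cP v'0 T T1).
  have lnT : ln T = L + ln K by rewrite /T lnM.
  have h2 : v' * c <= v * `|c|.
    apply: (@le_trans _ _ (v' * `|c|)); first by rewrite ler_wpM2l// ler_norm.
    by rewrite ler_wpM2r// /v'; have := del0; lra.
  have h3 := mulr_ge0 v'0 lnK0.
  move: b5; rewrite ler_pdivrMr//; move: h h2 h3; rewrite lnT /v'.
  generalize (ln K) e `|c| => ? ? ? h1 h2 h3 h4; lra.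
have mh i : measurable_fun setT (fun w => isqrt x (Z i w)).
  by apply: measurableT_comp => //; exact: measurable_isqrt.
pose Ea := \bigcup_(i in `I_n) [set w | T <= isqrt x (Z i w) ^+ 2].
pose Eb := [set w | N * L * del / 2 <= `|\sum_(i < n) phi (Z i w) - N * e|].
pose Ec := [set w | del * (N * L) ^+ 2 <= \sum_(i < n) phi (Z i w) ^+ 2].
pose Ed := [set w | N * q <= \sum_(i < n) isqrt x (Z i w)].
have mEa1 i : measurable [set w | T <= isqrt x (Z i w) ^+ 2].
  rewrite -[X in measurable X]setTI; apply: measurable_fun_ler => //.
  exact: measurable_funX.
have mEa : measurable Ea by apply: bigcup_measurable => i _; exact: mEa1.
have mEb : measurable Eb.
  rewrite -[X in measurable X]setTI; apply: measurable_fun_ler => //.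
  apply: measurableT_comp => //; apply: measurable_funB => //.
  by apply: measurable_sum => i; exact: measurableT_comp.
have mEc : measurable Ec.
  rewrite -[X in measurable X]setTI; apply: measurable_fun_ler => //.
  by apply: measurable_sum => i; apply: measurable_funX; exact: measurableT_comp.
have mEd : measurable Ed.
  rewrite -[X in measurable X]setTI; apply: measurable_fun_ler => //.
  by apply: measurable_sum => i.
have PEa : (P Ea <= (eps / 4)%:E)%E.
  apply: (@le_trans _ _ (\sum_(i < n) P [set w | (T <= isqrt x (Z i w) ^+ 2)%R])%E).
    by rewrite /Ea bigcup_mkord; exact: (Boole_inequality P (fun i (_ : (i < n)%N) => mEa1 i)).
  apply: (@le_trans _ _ (\sum_(i < n) (B / T)%:E)%E).
    apply: lee_sum => i _; exact: (wicksell_law_tail x_ge0 (Z_law i) g_le T0).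
  rewrite sumEFin lee_fin sumr_const card_ord -[leLHS]mulr_natl -/N.
  apply: le_trans BK; rewrite le_eqVlt; apply/orP; left; apply/eqP.
  by rewrite /T; field; rewrite !gt_eqF.
have NBT : N * (B * T + 1) <= N ^+ 2 * (B * K + 1).
  have -> : N ^+ 2 * (B * K + 1) = N * (B * (N * K) + N) by ring.
  by rewrite ler_wpM2l ?(ltW N0)// lerD2l.
have LL : L <= L ^+ 2 by rewrite expr2 ler_peMl// ltW.
have PEb : (P Eb <= (eps / 4)%:E)%E.
  have t0 : 0 < N * L * del / 2 by rewrite divr_gt0// !mulr_gt0.
  apply: le_trans (weak_law Z_iid.1 mphi phi0 phiT phiE s_le n t0) _.
  rewrite lee_fin ler_pdivrMr ?exprn_gt0// -/N (le_trans NBT)//.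
  rewrite [leRHS](_ : _ = N ^+ 2 * (L ^+ 2 * (del ^+ 2 * eps) / 16)); last by field.
  rewrite ler_wpM2l ?sqr_ge0// ler_pdivlMr// mulrC.
  move: b1; rewrite ler_pdivrMr ?mulr_gt0 ?exprn_gt0// => /le_trans; apply.
  by rewrite ler_wpM2r// mulr_ge0 ?sqr_ge0// ltW.
have PEc : (P Ec <= (eps / 4)%:E)%E.
  have t0 : 0 < del * (N * L) ^+ 2 by rewrite mulr_gt0// exprn_gt0// mulr_gt0.
  apply: le_trans (@markov_le _ _ _ P (fun w => \sum_(i < n) phi (Z i w) ^+ 2) (N * (B * T + 1)) _ _ _ t0 _) _.
  - by apply: measurable_sum => i; apply: measurable_funX; exact: measurableT_comp.
  - by move=> w; apply: sumr_ge0 => i _; exact: sqr_ge0.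
  - under eq_integral do rewrite -sumEFin.
    rewrite ge0_integral_sum//; last 2 first.
    + by move=> i; apply/measurable_EFinP; apply: measurable_funX; exact: measurableT_comp.
    + by move=> i w _; rewrite lee_fin sqr_ge0.
    apply: (@le_trans _ _ (\sum_(i < n) (B * T + 1)%:E)%E); first by apply: lee_sum => i _.
    by rewrite sumEFin lee_fin sumr_const card_ord -[leLHS]mulr_natl.
  rewrite lee_fin ler_pdivrMr// (le_trans NBT)//.
  rewrite [leRHS](_ : _ = N ^+ 2 * (L ^+ 2 * (del * eps) / 4)); last by field.
  rewrite ler_wpM2l ?sqr_ge0// ler_pdivlMr// mulrC.
  move: b2; rewrite ler_pdivrMr ?mulr_gt0// => /le_trans; apply.
  by rewrite ler_wpM2r// mulr_ge0// ltW.
have PEd : (P Ed <= (eps / 4)%:E)%E.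
  apply: le_trans (@markov_le _ _ _ P (fun w => \sum_(i < n) isqrt x (Z i w)) (N * (B * 2 + 1)) _ _ _ (mulr_gt0 N0 q0) _) _.
  - by apply: measurable_sum => i.
  - by move=> w; apply: sumr_ge0 => i _; exact: isqrt_ge0.
  - under eq_integral do rewrite -sumEFin.
    rewrite ge0_integral_sum//; last 2 first.
    + by move=> i; apply/measurable_EFinP.
    + by move=> i w _; rewrite lee_fin isqrt_ge0.
    apply: (@le_trans _ _ (\sum_(i < n) (B * 2 + 1)%:E)%E).
      apply: lee_sum => i _; rewrite (@ge0_integral_Z (isqrt x))//.
      + exact: (integral_isqrt_le x_ge0 B_gt0 (Z_law i) g_le).
      + exact: measurable_isqrt.
      + exact: isqrt_ge0.
    by rewrite sumEFin lee_fin sumr_const card_ord -[leLHS]mulr_natl.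
  have B2 : 0 < B * 2 + 1 by rewrite addr_gt0// mulr_gt0.
  rewrite lee_fin le_eqVlt; apply/orP; left; apply/eqP; rewrite /q; field.
  by rewrite !gt_eqF.
exists (Ea `|` (Eb `|` (Ec `|` Ed))).
  split; first by apply: measurableU => //; apply: measurableU => //; exact: measurableU.
  have -> : eps%:E = ((eps / 4)%:E + ((eps / 4)%:E + ((eps / 4)%:E + (eps / 4)%:E)))%E.
    by rewrite -!EFinD; congr EFin; field.
  apply: (le_trans (measureU2 _ mEa _)).
    by apply: measurableU => //; exact: measurableU.
  apply: leeD => //; apply: (le_trans (measureU2 _ mEb _)); first exact: measurableU.
  apply: leeD => //; apply: (le_trans (measureU2 _ mEc _)) => //.
  exact: leeD.
move=> w nE h.
have hT i : (i < n)%N -> phi (Z i w) = h i ^+ 2.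
  move=> i_n; rewrite /phi /sqr_trunc ifT// ltNge; apply/negP => hi; apply: nE; left.
  by exists i.
have nEb : ~ Eb w by move=> ?; apply: nE; right; left.
have nEc : ~ Ec w by move=> ?; apply: nE; right; right; left.
have nEd : ~ Ed w by move=> ?; apply: nE; right; right; right.
rewrite -/N -/L; split.
- have : `|\sum_(i < n) h i ^+ 2 - N * e| < N * L * del / 2.
    rewrite ltNge; apply/negP => hb; apply: nEb; rewrite /Eb /=.
    by under eq_bigr => i _ do rewrite hT//.
  move=> /ltW; rewrite ler_norml => /andP[h1 h2].
  have k1 := ler_wpM2l (ltW N0) e_le; have k2 := ler_wpM2l (ltW N0) e_ge.
  have NL : 0 < N * L by rewrite mulr_gt0.
  rewrite ler_norml lerBrDr lerBlDr ler_pdivlMr// ler_pdivrMr//.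
  move: h1 h2 k1 k2; generalize (\sum_(i < n) h i ^+ 2) e => S e'.
  by move=> *; apply/andP; split; lra.
- apply: ltW; rewrite ltNge; apply/negP => hc; apply: nEc; rewrite /Ec/=.
  by under eq_bigr => i _ do rewrite hT// -exprM.
- have hq : N^-1 * \sum_(i < n) h i <= q.
    rewrite ler_pdivrMl//; apply: ltW; rewrite ltNge; apply/negP => hd; exact: nEd.
  have : (q + 1) ^+ 2 <= del * L by rewrite -ler_pdivrMl// mulrC.
  apply: le_trans; apply: lerXn2r; rewrite ?nnegrE ?lerD2r// addr_ge0// ?(ltW q0)//.
  by rewrite mulr_ge0 ?invr_ge0 ?(ltW N0)//; apply: sumr_ge0 => i _; exact: isqrt_ge0.
Qed.

End WicksellSample.

(** * From the bound for fixed data to convergence in probability *)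

Lemma eventually_large (R : realType) (K : R) : exists n0 : nat, forall n : nat,
  (n0 <= n)%N -> K <= n%:R.
Proof.
exists (Num.truncn K).+1 => n n0.
by rewrite (le_trans (ltW (truncnS_gt _)))// ler_nat.
Qed.

Theorem theorem2p1 (R : realType)
    (F0 : cumulativeBounded (0 : R) (1 : R)) (F0_pos : F0 0 = 0)
    (d : measure_display) (W : measurableType d) (P : probability W R)
    (Z : nat -> {RV P >-> R}) (Z_iid : iid Z (wicksell_law F0))
    (alpha : {finite_measure set R -> \bar R})
    (alpha_pos : alpha [set z | z < 0] = 0%E) (alpha_neq0 : alpha setT != 0%E)
    (x : R) (x_ge0 : 0 <= x)
    (g0_bounded :
      (ereal_sup [set `|wicksell_density F0 z| | z in `[0%R, +oo[]
       < +oo)%E)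
    (alpha_int :
      (\int[alpha]_(s in `]x, +oo[) ((Num.sqrt (s - x))^-1)%:E < +oo)%E)
    (post : nat -> W -> probability (pprobability R R) R)
    (post_DP : forall n w,
      dirichlet_process (posterior_base alpha (fun i => Z i w) n) (post n w)) :
  cond_weak_cvg P post
    (fun n w (G : pprobability R R) =>
       Num.sqrt n%:R / Num.sqrt (ln n%:R)
       * (V (G : probability R R) x - V (empirical R (fun i => Z i w) n) x))
    (normal_law 0 (fine (wicksell_density F0 x))).
Proof.
have [B B0 gB] : exists2 B : R, 0 < B &
    forall z, 0 <= z -> (wicksell_density F0 z <= B%:E)%E.
  move: g0_bounded; set s := ereal_sup _ => s_lt.
  have gs z : 0 <= z -> (wicksell_density F0 z <= s)%E.
    move=> z0; apply: le_trans (lee_abs _) _; apply: ereal_sup_ubound.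
    by exists z => //; rewrite /= in_itv/= z0.
  have s0 : (0 <= s)%E by apply: le_trans (gs 0 (lexx 0)); exact: wicksell_density_ge0.
  exists (fine s + 1); first by rewrite ltr_wpDl// fine_ge0.
  move=> z /gs /le_trans; apply.
  by rewrite EFinD fineK ?ge0_fin_numE// leeDl// lee_fin.
have alpha_int' : (\int[alpha]_t (isqrt x t)%:E < +oo)%E by rewrite -integral_isqrt.
pose v := fine (wicksell_density F0 x); pose C := \int[alpha]_t isqrt x t.
pose a0 := fine (alpha setT); pose K0 := 4 + C + a0 + 2 * v.
have v0 : 0 <= v by rewrite fine_ge0// wicksell_density_ge0.
have a00 : 0 <= a0 by exact: fine_ge0.
have C0 : 0 <= C by apply: Rintegral_ge0 => t _; exact: isqrt_ge0.
have K00 : 0 < K0 by rewrite /K0 ltr_wpDr ?mulr_ge0// ltr_wpDr// ltr_wpDr.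
pose Kc := 13 + 8 * K0 + 8 * (K0 / v).
have Kc0 : 0 < Kc.
  have K0v : 0 <= K0 / v by rewrite divr_ge0// ltW.
  by rewrite /Kc; lra.
move=> eps eps0; pose kap := Num.min (1 / 2) (eps / Kc).
have kap0 : 0 < kap by rewrite /kap lt_min !divr_gt0.
have kap12 : kap <= 1 / 2 by rewrite /kap ge_min lexx.
have kapK : Kc * kap <= eps by rewrite mulrC -ler_pdivlMr// /kap ge_min lexx orbT.
pose del := kap ^+ 4; have del0 : 0 < del by exact: exprn_gt0.
(* [expR 1] ensures [ln n >= 1]; [del^-2] and [del^-1] make [1 / M] and [1 / n] at most [del];
   [2 a0 / del] does the same for [1 - (n / A)^2]. *)
have [n1 n1P] := eventually_large (expR 1 + del^-1 ^+ 2 + del^-1 + 2 * a0 / del).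
have bad n : (n1 <= n)%N ->
    [/\ (0 < n)%N, 0 < ln n%:R :> R, (Num.sqrt n%:R * Num.sqrt (ln n%:R))^-1 <= del,
        1 - (n%:R / (a0 + n%:R)) ^+ 2 <= del & n%:R^-1 <= del].
  move=> /n1P; set N : R := n%:R => hN.
  have d1 : 0 < del^-1 by rewrite invr_gt0.
  have d2 : 0 < del^-1 ^+ 2 by exact: exprn_gt0.
  have d3 : 0 <= 2 * a0 / del by rewrite divr_ge0 ?mulr_ge0// ltW.
  have e1 : 0 < expR (1 : R) by exact: expR_gt0.
  have h1 : expR 1 <= N by apply: le_trans hN; lra.
  have h2 : del^-1 ^+ 2 <= N by apply: le_trans hN; lra.
  have h3 : del^-1 <= N by apply: le_trans hN; lra.
  have h4 : 2 * a0 / del <= N by apply: le_trans hN; lra.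
  have N0 : 0 < N by exact: lt_le_trans h1.
  have L1 : 1 <= ln N by rewrite -ler_expR lnK ?posrE.
  have L0 : 0 < ln N by exact: lt_le_trans L1.
  split => //.
  - by rewrite -(ltr0n R).
  - rewrite -[leRHS]invrK lef_pV2 ?posrE ?mulr_gt0 ?sqrtr_gt0//.
    apply: (@le_trans _ _ (Num.sqrt N)).
      by rewrite -[leLHS](gtr0_norm d1) -sqrtr_sqr ler_wsqrtr.
    by rewrite ler_peMr ?sqrtr_ge0// -[leLHS]sqrtr1 ler_wsqrtr.
  - have A0 : 0 < a0 + N by rewrite ltr_wpDl.
    have -> : 1 - (N / (a0 + N)) ^+ 2 = a0 * (a0 + 2 * N) / (a0 + N) ^+ 2.
      by field; rewrite gt_eqF.
    rewrite ler_pdivrMr ?exprn_gt0//; move: h4; rewrite ler_pdivrMr// => h4.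
    apply: (@le_trans _ _ (a0 * 2 * (a0 + N))).
      by rewrite -mulrA ler_wpM2l// mulrDr lerD2r ler_peMl// ler1n.
    rewrite expr2 mulrA ler_pM2r// mulrC (le_trans h4)// mulrC ler_wpM2l ?(ltW del0)//.
    by rewrite lerDr.
  - by rewrite -[leRHS]invrK lef_pV2 ?posrE.
pose S n := [set w | eps < sup [set `|\int[post n w]_G f (Num.sqrt n%:R / Num.sqrt (ln n%:R)
  * (V (G : probability R R) x - V (empirical R (fun i => Z i w) n) x)) -
  \int[normal_law 0 v]_u f u| | f in @BL1 R]].
change ((P^*)%mu (S n) @[n --> \oo] --> 0%E).
(* Sample points whose data satisfy the three inequalities lie outside [S n]; no probability is
   involved here. *)
have S_sub n w (h := fun i => isqrt x (Z i w)) : (n1 <= n)%N ->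
    `|(\sum_(i < n) h i ^+ 2) / (n%:R * ln n%:R) - v| <= del ->
    \sum_(i < n) h i ^+ 4 <= del * (n%:R * ln n%:R) ^+ 2 ->
    (n%:R^-1 * \sum_(i < n) h i + 1) ^+ 2 <= del * ln n%:R -> ~ S n w.
  move=> /bad [n_gt0 L0 hM hA hN] h2 h4 hm; rewrite /S/= => /lt_geF/negP; apply.
  apply: ge_sup.
    (* The zero function shows that the set is nonempty, so its supremum is at most any common
       bound. *)
    by eexists; exists (fun=> 0) => //; split => *; rewrite ?subrr normr0.
  move=> _ [f fBL <-]; apply: le_trans kapK.
  exact: (posterior_distance n_gt0 (post_DP n w) alpha_int' L0 v0 kap0 kap12 h2 h4 hm hM hA hN fBL).
have PS e : 0 < e -> \forall n \near \oo, ((P^*)%mu (S n) <= e%:E)%E.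
  move=> e0; have [n0 n0P] := wicksell_sample_events x_ge0 B0 Z_iid gB e0 del0.
  exists (maxn n0 n1) => // n /=; rewrite geq_max => /andP[n0n n1n].
  have [E [mE PE] EP] := n0P n n0n.
  (* [S n] need not be measurable; it is covered by the measurable event [E], whose outer measure is
     its probability. *)
  apply: le_trans PE; rewrite -(measurable_mu_extE P mE).
  apply: le_outer_measure => w Sw; apply: contrapT => nE.
  by have [h2 h4 hm] := EP w nE; exact: (S_sub n w n1n h2 h4 hm).
apply/fine_cvgP; split.
  near=> n; rewrite ge0_fin_numE ?outer_measure_ge0//.
  apply: (@le_lt_trans _ _ 1%:E); last by rewrite ltry.
  by near: n; exact: PS.
apply/cvgr0Pnorm_le => e e0; near=> n.
have h : ((P^*)%mu (S n) <= e%:E)%E by near: n; exact: PS.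
rewrite /= ger0_norm ?fine_ge0 ?outer_measure_ge0//.
rewrite -lee_fin fineK// ge0_fin_numE ?outer_measure_ge0//.
by apply: le_lt_trans h _; rewrite ltry.
Unshelve. all: by end_near. Qed.
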